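(* Let $T>0$, let $A\in L^1(0,T;\mathbb{R}^{n\times n})$, $B\in L^2(0,T;\mathbb{R}^{n\times m})$, and for $i=0,1,\ldots,k$ let $Q_i\in L^1(0,T;\mathbb{S}^n)$ with $Q_i\ge 0$ a.e. and $R_i\in L^\infty(0,T;\mathbb{S}^m)$ with $R_i\ge 0$ a.e., and suppose there is $\delta>0$ with $R_0(s)\ge\delta I$ for a.e. $s$. Assume that the system $[A,B]$ is completely controllable. Let $c=(c_1,\ldots,c_k)^\top$ with $c_1,\ldots,c_k>0$, and let $(t,x,y)\in[0,T)\times\mathbb{R}^n\times\mathbb{R}^n$ be given. Suppose there exists at least one strictly feasible control with respect to $(t,x,y)$. Let $\Gamma=\{\lambda=(\lambda_1,\ldots,\lambda_k):\lambda_i\ge0,\ i=1,\ldots,k\}$, and let $P(\lambda,\cdot),\Pi(\lambda,\cdot),\Phi(\lambda,\cdot),\Psi(\lambda,\cdot)$ be as defined in the context. Then the function $L(\cdot,t,x,y):\Gamma\to\mathbb{R}$ defined by $$L(\lambda,t,x,y)=\langle P(\lambda,t)x,x\rangle-2\langle\Psi(\lambda,T)\Phi(\lambda,t)^{-1}x,y\rangle+\langle\Pi(\lambda,T)y,y\rangle-\lambda^\top c$$ achieves its maximum at some $\lambda^*\in\Gamma$, and the optimal control of Problem (CLQ) for $(t,x,y)$ is given by $$u(\lambda^*,s)=-R(\lambda^*,s)^{-1}B(s)^\top\big[P(\lambda^*,s)X(\lambda^*,s)+\eta(\lambda^*,s)\big],\qquad s\in[t,T),$$ where $$\eta(\lambda^*,s)=-\big[\Psi(\lambda^*,T)\Phi(\lambda^*,s)^{-1}\big]^\top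 y,\qquad s\in[0,T),$$ and $X(\lambda^*,\cdot)$ is the solution to the closed-loop system $$\dot X(\lambda^*,s)=\big[A(s)-B(s)R(\lambda^*,s)^{-1}B(s)^\top P(\lambda^*,s)\big]X(\lambda^*,s)-B(s)R(\lambda^*,s)^{-1}B(s)^\top\eta(\lambda^*,s),\ s\in[t,T),\qquad X(\lambda^*,t)=x.$$
   Context: $\mathbb{S}^n$ is the space of symmetric real $n\times n$ matrices, $\mathbb{S}^n_+$ the set of symmetric positive definite ones; inequalities between symmetric matrices are in the positive semidefinite order. $\sigma(M)$ is the spectrum of $M$. Solutions of differential equations are in the Carathéodory sense (absolutely continuous on compact subintervals, equation satisfied a.e.). Controls are identified when equal a.e. For $u\in L^2(t,T;\mathbb{R}^m)$, $X(\cdot\,;t,x,u)$ denotes the solution of $\dot X(s)=A(s)X(s)+B(s)u(s)$ on $[t,T]$, $X(t)=x$. The system $[A,B]$ is completely controllable if for every $0\le t_0<t_1\le T$ and all $x,y\in\mathbb{R}^n$ there is $u\in L^2(t_0,t_1;\mathbb{R}^m)$ such that the solution of $\dot X=AX+Bu$ on $[t_0,t_1]$ with $X(t_0)=x$ satisfies $X(t_1)=y$. For $i=0,1,\ldots,k$ and $u$ with $X(T;t,x,u)=y$, writing $X(s)=X(s;t,x,u)$, $$J_i(t,x,y;u)=\int_t^T\big[\langle Q_i(s)X(s),X(s)\rangle+\langle R_i(s)u(s),u(s)\rangle\big]ds.$$ A control $u\in L^2(t,T;\mathbb{R}^m)$ is feasible with respect to $(t,x,y)$ if $X(T;t,x,u)=y$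 and $J_i(t,x,y;u)\le c_i$ for $i=1,\ldots,k$; it is strictly feasible if moreover $J_i(t,x,y;u)<c_i$ for $i=1,\ldots,k$. Problem (CLQ) for $(t,x,y)$: minimize $J_0(t,x,y;u)$ over all feasible controls $u$; a feasible control attaining the minimum is called optimal. For $\lambda\in\Gamma$ put $Q(\lambda,s)=Q_0(s)+\sum_{i=1}^k\lambda_iQ_i(s)$ and $R(\lambda,s)=R_0(s)+\sum_{i=1}^k\lambda_iR_i(s)$. $P(\lambda,\cdot)\in C([0,T);\mathbb{S}^n_+)$ is the unique solution (which exists under the stated hypotheses) of $$\dot P(\lambda,s)+P(\lambda,s)A(s)+A(s)^\top P(\lambda,s)+Q(\lambda,s)-P(\lambda,s)B(s)R(\lambda,s)^{-1}B(s)^\top P(\lambda,s)=0,\ s\in[0,T),\quad \lim_{s\to T}\min\sigma(P(\lambda,s))=\infty.$$ $\Pi(\lambda,\cdot)\in C((t,T];\mathbb{S}^n_+)$ (depending also on $t$) is the unique solution (which exists under the stated hypotheses) of $$\dot\Pi(\lambda,s)+\Pi(\lambda,s)A(s)+A(s)^\top\Pi(\lambda,s)-Q(\lambda,s)+\Pi(\lambda,s)B(s)R(\lambda,s)^{-1}B(s)^\top\Pi(\lambda,s)=0,\ s\in(t,T],\quad \lim_{s\to t}\min\sigma(\Pi(\lambda,s))=\infty.$$ $\Phi(\lambda,\cdot)$ is the ($\mathbb{R}^{n\times n}$-valued, invertible) solution of $$\dot\Phi(\lambda,s)=\big[A(s)-B(s)R(\lambda,s)^{-1}B(s)^\top P(\lambda,s)\big]\Phi(\lambda,s),\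 s\in[0,T),\quad\Phi(\lambda,0)=I,$$ which satisfies $\lim_{s\to T}\Phi(\lambda,s)=0$ and is extended continuously to $[0,T]$ by $\Phi(\lambda,T)=0$. $\Psi(\lambda,\cdot)$ is the solution on $[0,T]$ of $$\dot\Psi(\lambda,s)=-A(s)^\top\Psi(\lambda,s)-Q(\lambda,s)\Phi(\lambda,s),\quad\Psi(\lambda,0)=P(\lambda,0).$$ *)

(* Defs.v *)
From HB Require Import structures.
From mathcomp Require Import all_boot all_order all_algebra.
From mathcomp Require Import all_classical all_reals all_analysis.
Import Order.TTheory GRing.Theory Num.Theory.
Import numFieldNormedType.Exports.

Set Implicit Arguments.
Unset Strict Implicit.
Unset Printing Implicit Defensive.

Local Open Scope classical_set_scope.
Local Open Scope ring_scope.

Definition inner_cv (R : realType) (n : nat) (u v : 'cV[R]_n) : R :=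
  (u^T *m v) ord0 ord0.

Definition psdmx (R : realType) (n : nat) (M : 'M[R]_n) : Prop :=
  M^T = M /\ forall v : 'cV[R]_n, 0 <= inner_cv (M *m v) v.

Definition pdmx (R : realType) (n : nat) (M : 'M[R]_n) : Prop :=
  M^T = M /\ forall v : 'cV[R]_n, v != 0 -> 0 < inner_cv (M *m v) v.

Definition spectrum (R : realType) (n : nat) (M : 'M[R]_n) : set R :=
  [set a | eigenvalue M a].

(* The spectrum is finite, so the infimum is attained when the spectrum is
   nonempty; the extended-real value only matters for n = 0, where it is +oo. *)
Definition min_spectrum (R : realType) (n : nat) (M : 'M[R]_n) : \bar R :=
  ereal_inf (EFin @` spectrum M).

(* Elements of the Lebesgue spaces are represented by Borel functions on [a, b],
   extended arbitrarily to the line. *)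
Definition L1mx (R : realType) (p q : nat) (a b : R) (F : R -> 'M[R]_(p, q)) :
    Prop :=
  forall i j, (@lebesgue_measure R).-integrable `[a, b]
    (fun s => (F s i j)%:E).

Definition L2mx (R : realType) (p q : nat) (a b : R) (F : R -> 'M[R]_(p, q)) :
    Prop :=
  forall i j, measurable_fun `[a, b] (fun s => F s i j) /\
    (@lebesgue_measure R).-integrable `[a, b] (fun s => (F s i j ^+ 2)%:E).

Definition Loomx (R : realType) (p q : nat) (a b : R) (F : R -> 'M[R]_(p, q)) :
    Prop :=
  forall i j, measurable_fun `[a, b] (fun s => F s i j) /\
    exists M : R, \forall s \ae (@lebesgue_measure R),
      s \in `[a, b] -> `|F s i j| <= M.

Definition abs_continuous (R : realType) (V : normedModType R) (a b : R)
    (f : R -> V) : Prop :=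
  forall e : R, 0 < e -> exists2 d : R, 0 < d &
    forall (N : nat) (u v : 'I_N -> R),
      (forall i, a <= u i /\ u i <= v i /\ v i <= b) ->
      trivIset [set: 'I_N] (fun i => `]u i, v i[%classic) ->
      \sum_(i < N) (v i - u i) < d ->
      \sum_(i < N) `|f (v i) - f (u i)| < e.

(* dX/ds = F on the interval J in the Caratheodory sense; for a differential
   equation, F is its right-hand side evaluated along X. *)
Definition ode_solution (R : realType) (p q : nat) (J : interval R)
    (X F : R -> 'M[R]_(p, q)) : Prop :=
  (forall a b : R, [set` `[a, b]] `<=` [set` J] -> abs_continuous a b X) /\
  (\forall s \ae (@lebesgue_measure R),
     s \in J -> is_derive s (1 : R) X (F s)).

Definition state_trajectory (R : realType) (n m : nat)
    (A : R -> 'M[R]_n) (B : R -> 'M[R]_(n, m)) (t0 t1 : R) (x : 'cV[R]_n)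
    (u : R -> 'cV[R]_m) (X : R -> 'cV[R]_n) : Prop :=
  ode_solution `[t0, t1] X (fun s => A s *m X s + B s *m u s) /\ X t0 = x.

Definition completely_controllable (R : realType) (n m : nat)
    (A : R -> 'M[R]_n) (B : R -> 'M[R]_(n, m)) (T : R) : Prop :=
  forall t0 t1 : R, 0 <= t0 -> t0 < t1 -> t1 <= T ->
  forall x y : 'cV[R]_n, exists u : R -> 'cV[R]_m, exists X : R -> 'cV[R]_n,
    [/\ L2mx t0 t1 u, state_trajectory A B t0 t1 x u X & X t1 = y].

Definition cost (R : realType) (n m : nat) (Q : R -> 'M[R]_n) (Rc : R -> 'M[R]_m)
    (t T : R) (X : R -> 'cV[R]_n) (u : R -> 'cV[R]_m) : R :=
  \int[@lebesgue_measure R]_(s in `[t, T])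
    (inner_cv (Q s *m X s) (X s) + inner_cv (Rc s *m u s) (u s)).

Definition steers (R : realType) (n m : nat)
    (A : R -> 'M[R]_n) (B : R -> 'M[R]_(n, m)) (t T : R) (x y : 'cV[R]_n)
    (u : R -> 'cV[R]_m) (X : R -> 'cV[R]_n) : Prop :=
  [/\ L2mx t T u, state_trajectory A B t T x u X & X T = y].

(* The index set {0, ..., k} is 'I_k.+1; the constraint indices 1, ..., k are
   the [lift ord0 i] with i : 'I_k. *)
Definition feasible_pair (R : realType) (k n m : nat)
    (A : R -> 'M[R]_n) (B : R -> 'M[R]_(n, m))
    (Q : 'I_k.+1 -> R -> 'M[R]_n) (Rc : 'I_k.+1 -> R -> 'M[R]_m)
    (c : 'cV[R]_k) (t T : R) (x y : 'cV[R]_n)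
    (u : R -> 'cV[R]_m) (X : R -> 'cV[R]_n) : Prop :=
  steers A B t T x y u X /\
  forall i : 'I_k,
    cost (Q (lift ord0 i)) (Rc (lift ord0 i)) t T X u <= c i ord0.

Definition strictly_feasible (R : realType) (k n m : nat)
    (A : R -> 'M[R]_n) (B : R -> 'M[R]_(n, m))
    (Q : 'I_k.+1 -> R -> 'M[R]_n) (Rc : 'I_k.+1 -> R -> 'M[R]_m)
    (c : 'cV[R]_k) (t T : R) (x y : 'cV[R]_n) (u : R -> 'cV[R]_m) : Prop :=
  exists X : R -> 'cV[R]_n, steers A B t T x y u X /\
  forall i : 'I_k,
    cost (Q (lift ord0 i)) (Rc (lift ord0 i)) t T X u < c i ord0.

Definition CLQ_optimal (R : realType) (k n m : nat)
    (A : R -> 'M[R]_n) (B : R -> 'M[R]_(n, m))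
    (Q : 'I_k.+1 -> R -> 'M[R]_n) (Rc : 'I_k.+1 -> R -> 'M[R]_m)
    (c : 'cV[R]_k) (t T : R) (x y : 'cV[R]_n) (u : R -> 'cV[R]_m) : Prop :=
  exists X : R -> 'cV[R]_n, feasible_pair A B Q Rc c t T x y u X /\
  forall (v : R -> 'cV[R]_m) (Y : R -> 'cV[R]_n),
    feasible_pair A B Q Rc c t T x y v Y ->
    cost (Q ord0) (Rc ord0) t T X u <= cost (Q ord0) (Rc ord0) t T Y v.

Definition CLQ_the_optimal (R : realType) (k n m : nat)
    (A : R -> 'M[R]_n) (B : R -> 'M[R]_(n, m))
    (Q : 'I_k.+1 -> R -> 'M[R]_n) (Rc : 'I_k.+1 -> R -> 'M[R]_m)
    (c : 'cV[R]_k) (t T : R) (x y : 'cV[R]_n) (u : R -> 'cV[R]_m) : Prop :=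
  CLQ_optimal A B Q Rc c t T x y u /\
  forall v : R -> 'cV[R]_m, CLQ_optimal A B Q Rc c t T x y v ->
    \forall s \ae (@lebesgue_measure R), s \in `[t, T] -> v s = u s.

Definition multipliers (R : realType) (k : nat) : set 'cV[R]_k :=
  [set lam | forall i, 0 <= lam i ord0].
Arguments multipliers : clear implicits.

Definition weighted (R : realType) (k p : nat) (M : 'I_k.+1 -> R -> 'M[R]_p)
    (lam : 'cV[R]_k) (s : R) : 'M[R]_p :=
  M ord0 s + \sum_(i < k) lam i ord0 *: M (lift ord0 i) s.

(* From here on a single Q or Rc stands for Q(lambda, .) or R(lambda, .). *)
Definition gain (R : realType) (n m : nat)
    (B : R -> 'M[R]_(n, m)) (Rc : R -> 'M[R]_m) (s : R) : 'M[R]_n :=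
  B s *m invmx (Rc s) *m (B s)^T.

Definition is_P (R : realType) (n m : nat)
    (A : R -> 'M[R]_n) (B : R -> 'M[R]_(n, m)) (Q : R -> 'M[R]_n)
    (Rc : R -> 'M[R]_m) (T : R) (P : R -> 'M[R]_n) : Prop :=
  [/\ forall s, s \in `[0, T[ -> pdmx (P s),
      ode_solution `[0, T[ P (fun s =>
        - (P s *m A s + (A s)^T *m P s + Q s - P s *m gain B Rc s *m P s)) &
      min_spectrum (P s) @[s --> T^'-] --> +oo%E].

Definition is_Pi (R : realType) (n m : nat)
    (A : R -> 'M[R]_n) (B : R -> 'M[R]_(n, m)) (Q : R -> 'M[R]_n)
    (Rc : R -> 'M[R]_m) (t T : R) (Pi : R -> 'M[R]_n) : Prop :=
  [/\ forall s, s \in `]t, T] -> pdmx (Pi s),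
      ode_solution `]t, T] Pi (fun s =>
        - (Pi s *m A s + (A s)^T *m Pi s - Q s + Pi s *m gain B Rc s *m Pi s)) &
      min_spectrum (Pi s) @[s --> t^'+] --> +oo%E].

Definition is_Phi (R : realType) (n m : nat)
    (A : R -> 'M[R]_n) (B : R -> 'M[R]_(n, m)) (Rc : R -> 'M[R]_m) (T : R)
    (P Phi : R -> 'M[R]_n) : Prop :=
  [/\ ode_solution `[0, T[ Phi (fun s => (A s - gain B Rc s *m P s) *m Phi s),
      Phi 0 = 1%:M & Phi T = 0].

Definition is_Psi (R : realType) (n : nat)
    (A : R -> 'M[R]_n) (Q : R -> 'M[R]_n) (T : R)
    (P Phi Psi : R -> 'M[R]_n) : Prop :=
  ode_solution `[0, T] Psi (fun s => - (A s)^T *m Psi s - Q s *m Phi s) /\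
  Psi 0 = P 0.

Definition dual_function (R : realType) (k n : nat)
    (P Pi Phi Psi : 'cV[R]_k -> R -> 'M[R]_n) (c : 'cV[R]_k)
    (t T : R) (x y : 'cV[R]_n) (lam : 'cV[R]_k) : R :=
  inner_cv (P lam t *m x) x
  - 2 * inner_cv (Psi lam T *m invmx (Phi lam t) *m x) y
  + inner_cv (Pi lam T *m y) y - inner_cv lam c.

Definition eta_term (R : realType) (n : nat) (Phi Psi : R -> 'M[R]_n) (T : R)
    (y : 'cV[R]_n) (s : R) : 'cV[R]_n :=
  - (Psi T *m invmx (Phi s))^T *m y.

Definition closed_loop_state (R : realType) (n m : nat)
    (A : R -> 'M[R]_n) (B : R -> 'M[R]_(n, m)) (Rc : R -> 'M[R]_m) (t T : R)
    (P : R -> 'M[R]_n) (h : R -> 'cV[R]_n) (x : 'cV[R]_n)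
    (X : R -> 'cV[R]_n) : Prop :=
  ode_solution `[t, T[ X (fun s =>
    (A s - gain B Rc s *m P s) *m X s - gain B Rc s *m h s) /\ X t = x.

Definition feedback (R : realType) (n m : nat)
    (B : R -> 'M[R]_(n, m)) (Rc : R -> 'M[R]_m) (P : R -> 'M[R]_n)
    (h X : R -> 'cV[R]_n) (s : R) : 'cV[R]_m :=
  - invmx (Rc s) *m (B s)^T *m (P s *m X s + h s).

(* Main.v *)
(* For a fixed multiplier, [Psi = P Phi] turns [(Phi, Psi)] into a solution of the
   Hamiltonian system [X' = A X - g p], [p' = - A^T p - Q X] with [Phi(T) = 0].
   Variation of constants along [Phi] produces the extremal [(X, p)] with
   [p = P X + eta]; Gronwall's inequality extends it to [T], the symplectic
   pairing with [(Phi, Psi)] gives [X(T) = y], and comparison with [Pi] through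
   [X + Pi^-1 p] gives [p(T)].  Integrating [<p, Y>'] along an arbitrary steering
   pair [(Y, v)] shows that the weighted cost of [(Y, v)] is the value
   [V(lam) = L(lam) + lam^T c] plus the weighted cost of the difference with the
   extremal.  Hence [L] is an infimum of affine functions; by the Slater point it
   is coercive and attains its maximum.  Perturbing a maximizer [lam*] towards any
   multiplier, strong convexity makes the perturbed minimizers converge, which
   yields feasibility and complementary slackness of the extremal at [lam*], and
   therefore optimality and uniqueness. *)

Require Import Defs.
From HB Require Import structures.
From mathcomp Require Import all_boot all_order all_algebra.
From mathcomp Require Import all_classical all_reals all_analysis.
From mathcomp Require Import perm measurable_realfun ring lra.
Import Order.TTheory GRing.Theory Num.Theory.
Import numFieldNormedType.Exports.

Set Implicit Arguments.
Unset Strict Implicit.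
Unset Printing Implicit Defensive.

Local Open Scope classical_set_scope.
Local Open Scope ring_scope.

(** * Absolutely continuous functions *)

(** Each Riccati solution blows up at one end, [P] at [T] and [Pi] at [t]. What happens at a
    singular end is therefore read off the linear Hamiltonian system, whose coefficients are
    integrable on all of [[0, T]] and contain no Riccati solution; [P] and [Pi] serve on half-open
    intervals, and values left free at the singular end are replaced by continuous extensions. Since
    the equations hold only almost everywhere, the fundamental theorem and both Gronwall
    inequalities are drawn from one monotonicity theorem for absolutely continuous functions.

    The duality argument is abstract: a type of points, costs [J i], and costs [q i] of differences.
    The explicit extremal at each multiplier supplies the minimizers, and estimates comparing
    neighbouring extremals stand in for derivatives of the dual function. For this [q ord0] must
    dominate every [q i]: differences of steering pairs start from the zero state, so their control
    energy bounds all their costs, while [R_0 >= delta I] bounds that energy by [q ord0]. *)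

(** Cousin-type compactness: the supremum of the points reached from [a] is itself reached and,
    unless it is [b], passed. The local hypothesis concerns only pairs [u <= x <= v], because a
    derivative at [x] controls increments over intervals that contain [x]. *)
Lemma interval_chain_induction (R : realType) (good : R -> R -> Prop) (a b : R) :
  a <= b ->
  (forall u v w, good u v -> good v w -> good u w) ->
  (forall x, a <= x <= b -> exists2 d, 0 < d & forall u v,
     a <= u <= x -> x <= v <= b -> x - d < u -> v < x + d -> good u v) ->
  good a b.
Proof.
move=> ab tr loc.
pose S := [set c | a <= c <= b /\ good a c].
have Sa : S a.
  split; first by rewrite lexx.
  have [|d d0 H] := loc a; first by rewrite lexx.
  by apply: H; rewrite ?lexx ?ab //; lra.
have hS : has_sup S.
  split; first by exists a.
  by exists b => c [/andP[]].
set s := sup S.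
have sa : a <= s by apply: ub_le_sup => //; case: hS.
have sb : s <= b by apply: ge_sup; [exists a|move=> c [/andP[]]].
have [|d d0 H] := loc s; first by rewrite sa sb.
have [c [/andP[ac cb] gc] sc] := sup_adherent d0 hS.
have cs : c <= s by apply: ub_le_sup => //; [case: hS|split=> //; rewrite ac cb].
pose s' := Num.min b (s + d / 2).
have ss' : s <= s' by rewrite le_min sb /=; lra.
have gs' : good a s'.
  apply: tr gc _; apply: H; rewrite ?ac ?cs ?ss' ?ge_min ?lexx //=.
  by rewrite gt_min; apply/orP; right; lra.
have : s' <= s.
  apply: ub_le_sup; first by case: hS.
  by split=> //; rewrite (le_trans sa ss') ge_min lexx.
move: gs'; rewrite /s'; case: (leP b (s + d / 2)) => // _ _; lra.
Qed.

Lemma trivIset_itv_nth (R : realType) (s : seq (R * R)) (x0 : R * R) :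
  pairwise (fun p q => p.2 <= q.1) s ->
  trivIset [set: 'I_(size s)]
    (fun i : 'I_(size s) => `](nth x0 s i).1, (nth x0 s i).2[%classic).
Proof.
move=> ps; have key (i j : 'I_(size s)) z : (i < j)%N ->
    `](nth x0 s i).1, (nth x0 s i).2[%classic z ->
    `](nth x0 s j).1, (nth x0 s j).2[%classic z -> False.
  move=> ij; rewrite /= !in_itv /= => /andP[_ zi] /andP[jz _].
  have /(pairwiseP x0) := ps.
  move=> /(_ i j (ltn_ord i) (ltn_ord j) ij) h.
  by have := lt_trans jz zi; rewrite ltNge h.
apply/trivIsetP => i j _ _ ij; apply/seteqP; split=> // z [zi zj].
have [lt|lt|e] := ltngtP i j.
- exact: key lt zi zj.
- exact: key lt zj zi.
- by move/val_inj : e ij => -> ; rewrite eqxx.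
Qed.

(** Families of intervals become ordered lists, because these can be concatenated when intervals are
    chained. *)
Lemma ac_disjoint_seq (R : realType) (V : normedModType R) (a b : R) (f : R -> V) :
  abs_continuous a b f -> forall e : R, 0 < e -> exists2 d : R, 0 < d &
    forall s : seq (R * R),
    all (fun p => (a <= p.1) && (p.1 <= p.2) && (p.2 <= b)) s ->
    pairwise (fun p q => p.2 <= q.1) s ->
    \sum_(p <- s) (p.2 - p.1) < d ->
    \sum_(p <- s) `|f p.2 - f p.1| < e.
Proof.
move=> acf e e0; have [d d0 H] := acf e e0; exists d => // s /allP sab ps.
rewrite (big_nth (0, 0)) big_mkord (big_nth (0, 0)) big_mkord.
apply: (H (size s) (fun i => (nth (0, 0) s i).1) (fun i => (nth (0, 0) s i).2)).
- move=> i; have /sab/andP[/andP[? ?] ?] := mem_nth (0, 0) (ltn_ord i).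
  by split.
- exact: trivIset_itv_nth.
Qed.

(** The open intervals are disjoint and lie in [U], so finite additivity and monotonicity of the
    measure apply. *)
Lemma sum_length_le_measure (R : realType) (s : seq (R * R)) (U : set R) :
  open U -> all (fun p => p.1 <= p.2) s ->
  pairwise (fun p q => p.2 <= q.1) s ->
  (forall p, p \in s -> `]p.1, p.2[ `<=` U) ->
  ((\sum_(p <- s) (p.2 - p.1))%:E <= lebesgue_measure U)%E.
Proof.
move=> oU /allP sle ps sU.
pose F (i : 'I_(size s)) : set R :=
  `](nth (0, 0) s i).1, (nth (0, 0) s i).2[%classic.
have mF i : measurable (F i) by exact: measurable_itv.
have mB : measurable (\big[setU/set0]_(i < size s) F i).
  by apply: bigsetU_measurable.
have := @measure_semi_additive_ord _ _ _ (@lebesgue_measure R) _ F mF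
  (@trivIset_itv_nth _ s (0, 0) ps) mB.
rewrite (big_nth (0, 0)) big_mkord -sumEFin => eqF.
have -> : (\sum_(i < size s) ((nth (0, 0) s i).2 - (nth (0, 0) s i).1)%:E =
   \sum_(i < size s) lebesgue_measure (F i))%E.
  apply: eq_bigr => i _; rewrite lebesgue_measure_itv /= lte_fin.
  case: ltP => // h; suff -> : (nth (0, 0) s i).1 = (nth (0, 0) s i).2.
    by rewrite subrr.
  by apply/eqP; rewrite eq_le h sle // mem_nth.
rewrite -eqF; apply: le_measure; rewrite ?inE //.
- by apply: measurable_realfun.open_measurable.
- move=> z; rewrite -bigcup_seq /= => -[i _].
  by apply: sU; rewrite mem_nth.
Qed.

Lemma is_derive_approx (R : realType) (f : R -> R) (s d e : R) :
  is_derive s (1 : R) f d -> 0 < e -> exists2 r, 0 < r &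
    forall z, `|z - s| < r -> `|f z - f s - d * (z - s)| <= e * `|z - s|.
Proof.
move=> [/cvg_ex[l fl] Dfd] e0.
have ld : l = d by rewrite -Dfd; apply/esym/cvg_lim.
move: fl; rewrite ld => /cvgrPdist_le /(_ e e0) [r /= r0 H].
exists r => // z zr; have [->|zs] := eqVneq z s.
  by rewrite !subrr mulr0 subrr normr0 mulr0.
have zs0 : z - s != 0 by rewrite subr_eq0.
have := H (z - s); rewrite /= sub0r normrN => /(_ zr zs0).
rewrite [X in f X](_ : _ = z) => [h|]; last first.
  by rewrite /GRing.scale /= mulr1 subrK.
have -> : f z - f s - d * (z - s) = - ((d - (z - s)^-1 *: (f z - f s)) * (z - s)).
  by rewrite /GRing.scale /=; field.
by rewrite normrN normrM ler_wpM2r.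
Qed.

(* Cover the exceptional null set by an open set of small measure: absolute
   continuity controls the increments on intervals inside it, the sign of the
   derivative controls the others, and interval induction glues them. *)
Lemma ac_nonincreasing (R : realType) (a b : R) (f g : R -> R) : a <= b ->
  abs_continuous a b f ->
  (\forall s \ae (@lebesgue_measure R), s \in `]a, b[ ->
     is_derive s (1 : R) f (g s) /\ g s <= 0) ->
  f b <= f a.
Proof.
move=> ab acf [N [mN N0 Nsub]].
apply/ler_addgt0Pr => e0 e00.
(* The total error is [e * (b - a)] from the points of differentiability plus [e] from the
   exceptional set, that is [e0]. *)
pose e := e0 / (b - a + 1).
have ba1 : 0 < b - a + 1 by lra.
have epos : 0 < e by rewrite divr_gt0.
have [d d0 ac_derive] := ac_disjoint_seq acf epos.
(* The derivative is given on the open interval only, so both endpoints count as exceptional. *)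
pose N' : set R := N `|` [set a] `|` [set b].
have mN' : measurable N' by do 2 apply: measurableU => //.
have N'0 : lebesgue_measure N' = 0%E.
  rewrite measureU0 //; last exact: lebesgue_measure_set1.
    rewrite measureU0 //; exact: lebesgue_measure_set1.
  exact: measurableU.
have [U [oU N'U UN']] : exists U : set R,
    [/\ open U, N' `<=` U & (lebesgue_measure (U `\` N') < d%:E)%E].
  by apply: lebesgue_regularity_outer => //; rewrite [X in (X < _)%E]N'0.
have muU : (lebesgue_measure U < d%:E)%E.
  have mU : measurable U by exact: measurable_realfun.open_measurable.
  rewrite -(setDUK N'U); apply: le_lt_trans UN'.
  apply: le_trans (measureU2 _ _ _) _ => //; first exact: measurableD.
  by rewrite [X in (X + _ <= _)%E]N'0 add0e.
(* The increments near exceptional points are kept as a list, so that chaining merely concatenates;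
   absolute continuity is applied once, to the final list. *)
pose good (u v : R) := u <= v /\ exists s : seq (R * R),
  [/\ all (fun p => (u <= p.1) && (p.1 <= p.2) && (p.2 <= v)) s,
   pairwise (fun p q => p.2 <= q.1) s,
   (forall p, p \in s -> `]p.1, p.2[ `<=` U) &
   f v - f u <= e * (v - u) + \sum_(p <- s) `|f p.2 - f p.1|].
suff [_ [s [sab ps sU fs]]] : good a b.
  have : \sum_(p <- s) `|f p.2 - f p.1| < e.
    apply: ac_derive => //; rewrite -lte_fin.
    apply: le_lt_trans (sum_length_le_measure oU _ ps sU) muU.
    by apply: sub_all sab => p /andP[/andP[]].
  move=> h; have : f b - f a < e * (b - a + 1) by lra.
  by rewrite /e mulrVK ?unitfE ?gt_eqF //; lra.
apply: interval_chain_induction => // [u v w [uv [s [sab ps sU fs]]]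
    [vw [s' [sab' ps' sU' fs']]]|x /andP[ax xb]].
  split; first exact: le_trans uv vw.
  exists (s ++ s'); split.
  - rewrite all_cat; apply/andP; split.
      apply: sub_all sab => p /andP[/andP[-> ->]] /= pv; exact: le_trans pv vw.
    apply: sub_all sab' => p /andP[/andP[vp ->] ->]; rewrite !andbT.
    exact: le_trans uv vp.
  - rewrite pairwise_cat ps ps' !andbT; apply/allrelP => p q ip iq.
    have /allP/(_ _ ip)/andP[_ pv] := sab.
    have /allP/(_ _ iq)/andP[/andP[vq _] _] := sab'.
    exact: le_trans pv vq.
  - by move=> p; rewrite mem_cat => /orP[/sU|/sU'].
  - by rewrite big_cat /=; lra.
have [xN'|xN'] := pselect (N' x).
  have /nbhs_ballP[r /= r0 rU] : nbhs x U.
    by apply: open_nbhs_nbhs; split=> //; exact: N'U.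
  exists r => // u v /andP[au ux] /andP[xv vb] xu vx.
  have uv : u <= v by exact: le_trans ux xv.
  split => //; exists [:: (u, v)]; split=> //=.
  - by rewrite !lexx uv.
  - move=> p; rewrite inE => /eqP -> z /=; rewrite in_itv /= => /andP[uz zv].
    apply: rU; rewrite /ball /= ltr_norml; apply/andP; split; lra.
  - rewrite big_seq1 /=; have := ler_norm (f v - f u).
    suff : 0 <= e * (v - u) by lra.
    by apply: mulr_ge0; [exact: ltW|lra].
have axs : a != x by apply/eqP => xe; apply: xN'; left; right; exact/esym.
have xbs : x != b by apply/eqP => xe; apply: xN'; right.
have [Dx gx] : is_derive x (1 : R) f (g x) /\ g x <= 0.
  apply: contrapT => h; apply: xN'; left; left; apply: Nsub => /=.
  apply: contra_not h; apply; rewrite in_itv /= !lt_neqAle ax xb.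
  by rewrite axs xbs.
have [r r0 H] := is_derive_approx Dx epos.
exists r => // u v /andP[au ux] /andP[xv vb] xu vx.
have uv : u <= v by exact: le_trans ux xv.
split => //; exists [::]; split=> //=; rewrite big_nil addr0.
have := H v; rewrite ger0_norm ?subr_ge0 // => /(_ _)/ler_normlW h1.
have nu : `|u - x| = x - u by rewrite distrC ger0_norm ?subr_ge0.
have := H u; rewrite nu => h2.
have {}h2 : x - u < r -> - (e * (x - u)) <= f u - f x - g x * (u - x).
  by move=> /h2; rewrite ler_norml => /andP[].
have h1' : v - x < r by lra.
have h2' : x - u < r by lra.
have := h1 h1'; have := h2 h2'.
have : g x * (v - u) <= 0 by apply: mulr_le0_ge0 => //; lra.
lra.
Qed.

Lemma ae_imply (R : realType) (P Q : R -> Prop) : (forall s, P s -> Q s) ->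
  (\forall s \ae (@lebesgue_measure R), P s) ->
  \forall s \ae (@lebesgue_measure R), Q s.
Proof. by move=> PQ; apply: (@filterS _ _ (ae_filter_ringOfSetsType _)). Qed.

Lemma ae_imply2 (R : realType) (P1 P2 Q : R -> Prop) :
  (forall s, P1 s -> P2 s -> Q s) ->
  (\forall s \ae (@lebesgue_measure R), P1 s) ->
  (\forall s \ae (@lebesgue_measure R), P2 s) ->
  \forall s \ae (@lebesgue_measure R), Q s.
Proof. by move=> PQ; apply: (@filterS2 _ _ (ae_filter_ringOfSetsType _)). Qed.

Lemma ae_imply3 (R : realType) (P1 P2 P3 Q : R -> Prop) :
  (forall s, P1 s -> P2 s -> P3 s -> Q s) ->
  (\forall s \ae (@lebesgue_measure R), P1 s) ->
  (\forall s \ae (@lebesgue_measure R), P2 s) ->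
  (\forall s \ae (@lebesgue_measure R), P3 s) ->
  \forall s \ae (@lebesgue_measure R), Q s.
Proof. by move=> PQ; apply: (@filterS3 _ _ (ae_filter_ringOfSetsType _)). Qed.

Lemma ae_forall_fin (R : realType) (I : finType) (P : I -> R -> Prop) :
  (forall i, \forall s \ae (@lebesgue_measure R), P i s) ->
  \forall s \ae (@lebesgue_measure R), forall i, P i s.
Proof.
move=> h.
have : \forall s \ae (@lebesgue_measure R), forall i, i \in enum I -> P i s.
  elim: (enum I) => [|i r IH]; first exact: aeW.
  apply: ae_imply2 (h i) IH => s Pi Pr j.
  by rewrite inE => /orP[/eqP ->|/Pr].
by apply: ae_imply => s H i; apply: H; rewrite mem_enum.
Qed.

(** * Primitives of integrable functions *)

Definition integrable_on (R : realType) (a b : R) (f : R -> R) : Prop :=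
  (@lebesgue_measure R).-integrable `[a, b] (EFin \o f).

Lemma integrable_on_measurable (R : realType) (a b : R) (f : R -> R) :
  integrable_on a b f -> measurable_fun `[a, b] f.
Proof. by move/integrableP => [/measurable_EFinP]. Qed.

Lemma integrable_on_cst (R : realType) (a b k : R) :
  integrable_on a b (cst k).
Proof.
apply: measurable_bounded_integrable => //.
- have : (lebesgue_measure (`[a, b]%classic : set R) < +oo)%E.
    by rewrite lebesgue_measure_itv /=; case: ifP => _; rewrite ?ltry.
  by [].
- by exists `|k|; split; rewrite ?num_real // => M kM x _; exact: ltW.
Qed.

Lemma integrable_on_le (R : realType) (a b : R) (f g : R -> R) :
  measurable_fun `[a, b] f -> integrable_on a b g ->
  (\forall s \ae (@lebesgue_measure R), s \in `[a, b] -> `|f s| <= g s) ->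
  integrable_on a b f.
Proof.
move=> mf ig fg; apply/integrableP; split; first exact/measurable_EFinP.
move/integrableP : (ig) => [_]; apply: le_lt_trans.
apply: ae_ge0_le_integral => //.
- by apply: measurableT_comp => //; exact/measurable_EFinP.
- apply: measurableT_comp => //; apply/measurable_EFinP.
  exact: integrable_on_measurable.
- apply: ae_imply fg => s h sab; rewrite /= lee_fin.
  by apply: le_trans (ler_norm _); apply: h.
Qed.

(** Dominated convergence with majorant [|g|]: at each point the truncation is exact for all large
    [n]. *)
Lemma truncation_integral_cvg0 (R : realType) (a b : R) (g : R -> R) :
  integrable_on a b g ->
  (fun n : nat => \int[@lebesgue_measure R]_(x in `[a, b])
     (`|g x| - Num.min `|g x| n%:R)) @ \oo --> (0 : R).
Proof.
move=> ig.
have mg : measurable_fun `[a, b] g.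
  by move/integrableP : ig => [/measurable_EFinP].
have ign : (@lebesgue_measure R).-integrable `[a, b] (EFin \o (fun x => `|g x|)).
  exact: (@integrable_norm _ _ _ (@lebesgue_measure R)).
have mn : measurable_fun `[a, b] (fun x => `|g x|) by exact: measurableT_comp.
pose h (n : nat) (x : R) : R := `|g x| - Num.min `|g x| n%:R.
have h0 n x : 0 <= h n x by rewrite /h subr_ge0 ge_min lexx.
have hle n x : h n x <= `|g x| by rewrite /h gerBl le_min normr_ge0 /=.
have mh n : measurable_fun `[a, b] (h n).
  apply: measurable_funB => //; exact: measurable_minr.
have H : (\int[(@lebesgue_measure R)]_(x in `[a, b]) (h n x)%:E)%E @[n --> \oo] --> (0%R)%:E.
  have [||||_ _ H] := @dominated_convergence _ _ _ (@lebesgue_measure R) `[a, b] (measurable_itv _)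
    (fun n x => (h n x)%:E) (cst 0%E) (fun x => `|g x|%:E) _ _ _ ign.
  - by move=> n; apply/measurable_EFinP; exact: mh.
  - exact: measurable_cst.
  - apply: aeW => x _; apply: cvg_near_cst.
    exists (Num.truncn `|g x|).+1 => // n /= hn.
    rewrite /h min_l ?subrr //; apply/ltW.
    apply: (lt_le_trans (truncnS_gt _)); by rewrite ler_nat.
  - by apply: aeW => x n _; rewrite /= lee_fin ger0_norm.
  - by move: H; rewrite integral0.
exact: fine_cvg H.
Qed.

Lemma integrable_onS (R : realType) (a b : R) (g : R -> R) (D : set R) :
  integrable_on a b g -> measurable D -> D `<=` `[a, b] ->
  (@lebesgue_measure R).-integrable D (EFin \o g).
Proof. by move=> ig mD sD; apply: integrableS ig => //; exact: measurable_itv. Qed.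

Lemma integral_itvB (R : realType) (a b u v : R) (g : R -> R) :
  integrable_on a b g -> a <= u -> u <= v -> v <= b ->
  \int[@lebesgue_measure R]_(x in `[a, v]) g x -
    \int[@lebesgue_measure R]_(x in `[a, u]) g x =
  \int[@lebesgue_measure R]_(x in `]u, v[) g x.
Proof.
move=> ig au uv vb.
rewrite Rintegral_itvB ?bnd_simp //.
- rewrite -Rintegral_itv_bndo_bndc //.
  apply: integrable_onS ig _ _; first exact: measurable_itv.
  move=> x /=; rewrite !in_itv /= => /andP[ux xv].
  by rewrite (le_trans au (ltW ux)) (le_trans (ltW xv) vb).
- apply: integrable_onS ig _ _; first exact: measurable_itv.
  by move=> x /=; rewrite !in_itv /= => /andP[-> /le_trans]; apply.
Qed.

(** [|g|] is split at a level [n] into a tail [h], whose integral over all of [[a, b]] is below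
    [e / 2], and a part bounded by [n], whose integral is at most [n] times the total length of the
    intervals. *)
Lemma abs_continuous_integral (R : realType) (a b : R) (g : R -> R) :
  integrable_on a b g ->
  abs_continuous a b (fun s => \int[@lebesgue_measure R]_(x in `[a, s]) g x).
Proof.
move=> ig e e0.
have mg : measurable_fun `[a, b] g.
  by move/integrableP : ig => [/measurable_EFinP].
have ign : (@lebesgue_measure R).-integrable `[a, b] (EFin \o (fun x => `|g x|)).
  exact: (@integrable_norm _ _ _ (@lebesgue_measure R)).
have mn : measurable_fun `[a, b] (fun x => `|g x|) by exact: measurableT_comp.
have e2 : 0 < e / 2 by lra.
have /cvgrPdist_lt/(_ _ e2)[n _ /(_ n (leqnn n))] := truncation_integral_cvg0 ig.
rewrite sub0r normrN => intn.
pose h (x : R) : R := `|g x| - Num.min `|g x| n%:R.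
have h0 x : 0 <= h x by rewrite /h subr_ge0 ge_min lexx.
have hle x : h x <= `|g x| by rewrite /h gerBl le_min normr_ge0 /=.
have gh x : `|g x| <= h x + n%:R.
  rewrite /h; have : Num.min `|g x| n%:R <= n%:R by rewrite ge_min lexx orbT.
  lra.
have mh : measurable_fun `[a, b] h.
  apply: measurable_funB => //; exact: measurable_minr.
have ih : integrable_on a b h.
  apply: integrable_on_le mh ign _.
  by apply: aeW => x _; rewrite ger0_norm.
have n1 : 0 < n%:R + 1 :> R by rewrite ltr_wpDl.
(* The level [n] may be zero, hence the division by [n + 1]. *)
exists (e / 2 / (n%:R + 1)); first by rewrite divr_gt0.
move=> N u v uv tF suv.
pose F (i : 'I_N) : set R := `]u i, v i[%classic.
have mF i : measurable (F i) by exact: measurable_itv.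
have sF i : F i `<=` `[a, b].
  have [au [_ vb]] := uv i.
  move=> x /=; rewrite !in_itv /= => /andP[ux xv].
  by rewrite (le_trans au (ltW ux)) (le_trans (ltW xv) vb).
have step i : `|\int[(@lebesgue_measure R)]_(x in `[a, v i]) g x - \int[(@lebesgue_measure R)]_(x in `[a, u i]) g x|
   <= \int[(@lebesgue_measure R)]_(x in F i) h x + n%:R * (v i - u i).
  have [au [uv' vb]] := uv i.
  rewrite (integral_itvB ig) // -/(F i).
  have igF := integrable_onS ig (mF i) (sF i).
  have ihF := integrable_onS ih (mF i) (sF i).
  have ignF := integrable_onS ign (mF i) (sF i).
  have icF : (@lebesgue_measure R).-integrable (F i) (EFin \o cst (n%:R : R)).
    exact: integrable_onS (integrable_on_cst a b n%:R) (mF i) (sF i).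
  apply: le_trans (le_normr_Rintegral _ igF) _; first exact: mF.
  have -> : n%:R * (v i - u i) = \int[(@lebesgue_measure R)]_(x in F i) cst n%:R x.
    have muF : lebesgue_measure (F i) = (v i - u i)%:E.
      rewrite /F lebesgue_measure_itv /= lte_fin; case: ltP => // vu.
      have -> : u i = v i by apply/eqP; rewrite eq_le uv' vu.
      by rewrite subrr.
    rewrite Rintegral_cst; last exact: mF.
    by congr (_ * _); rewrite [X in fine X]muF.
  rewrite -RintegralD //.
  apply: (@le_Rintegral _ _ R (@lebesgue_measure R) (F i)
    (fun t => `|g t|) (fun x => h x + n%:R)).
  - exact: mF.
  - exact: ignF.
  - exact: (@integrableD _ _ R (@lebesgue_measure R) (F i) (mF i) _ _ ihF icF).
  - by move=> x _; exact: gh.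
  - exact: mF.
apply: le_lt_trans (ler_sum _ (fun i _ => step i)) _.
rewrite big_split /= -mulr_sumr.
have sumh : \sum_(i < N) \int[(@lebesgue_measure R)]_(x in F i) h x <= \int[(@lebesgue_measure R)]_(x in `[a, b]) h x.
  have fF i : ((\int[(@lebesgue_measure R)]_(x in F i) h x)%:E = \int[(@lebesgue_measure R)]_(x in F i) (h x)%:E)%E.
    rewrite /Rintegral fineK //; apply: integrable_fin_num; first exact: mF.
    exact: integrable_onS ih (mF i) (sF i).
  rewrite -lee_fin -sumEFin (eq_bigr _ (fun i _ => fF i)) /Rintegral fineK; last first.
    by apply: integrable_fin_num => //; exact: measurable_itv.
  have mhE : measurable_fun `[a, b] (EFin \o h) by exact/measurable_EFinP.
  have sub : \big[setU/set0]_(i < N) F i `<=` `[a, b].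
    by move=> x; rewrite -bigcup_seq => -[i _] /sF.
  have mB : measurable (\big[setU/set0]_(i < N) F i).
    by apply: bigsetU_measurable => i _; exact: mF.
  rewrite -ge0_integral_bigsetU //=.
  - apply: ge0_subset_integral.
    + exact: mB.
    + exact: measurable_itv.
    + exact: mhE.
    + by move=> x _; rewrite lee_fin.
    + exact: sub.
  - by rewrite index_enum_uniq.
  - by apply: sub_trivIset tF.
  - exact: measurable_funS mhE.
  - by move=> x _; rewrite lee_fin.
have : \int[@lebesgue_measure R]_(x in `[a, b]) h x < e / 2.
  exact: le_lt_trans (ler_norm _) intn.
have nS : n%:R * (\sum_(i < N) (v i - u i)) <= (n%:R + 1) * (\sum_(i < N) (v i - u i)).
  apply: ler_wpM2r; last lra.
  by apply: sumr_ge0 => i _; have [_ [? _]] := uv i; lra.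
have nS' : (n%:R + 1) * (\sum_(i < N) (v i - u i)) < e / 2.
  by rewrite mulrC -ltr_pdivlMr.
move=> he; rewrite [e]splitr; apply: ltrD.
  exact: le_lt_trans sumh he.
exact: le_lt_trans nS nS'.
Qed.

(** A relation, because [g] matters only up to a null set and right-hand sides of equations are
    rewritten almost everywhere. [is_derive] is two-sided, so asking for it on the open interval
    leaves [f] free outside [[a, b]]. *)
Definition ac_derive (R : realType) (a b : R) (f g : R -> R) : Prop :=
  abs_continuous a b f /\
  \forall s \ae (@lebesgue_measure R), s \in `]a, b[ -> is_derive s (1 : R) f (g s).

(** Lebesgue differentiation: the derivative exists at the Lebesgue points of [g] cut off outside
    [[a, b]], and near an interior point the cut-off does not change the primitive. *)
Lemma ac_derive_integral (R : realType) (a b : R) (g : R -> R) :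
  integrable_on a b g ->
  ac_derive a b (fun s => \int[@lebesgue_measure R]_(x in `[a, s]) g x) g.
Proof.
move=> ig; split; first exact: abs_continuous_integral.
have := lebesgue_differentiation (integrable_locally (measurable_itv _) ig).
apply: ae_imply => s ls; rewrite in_itv /= => /andP[as_ sb].
pose g0 := g \_ `[a, b].
have g0g x : a <= x <= b -> g0 x = g x.
  by move=> axb; rewrite /g0 patchE mem_set //= in_itv.
have ig0 : (@lebesgue_measure R).-integrable `[a, b] (EFin \o g0).
  apply: eq_integrable ig; first exact: measurable_itv.
  by move=> x; rewrite inE /= in_itv /= => /g0g ->.
have [dF F's] := @FTC1_lebesgue_pt R g0 (BLeft a) s b sb ig0 as_ ls.
have -> : g s = 'D_1 (fun y => \int[lebesgue_measure]_(x in `[a, y]) g0 x) s.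
  by rewrite -derive1E F's g0g // (ltW as_) (ltW sb).
apply: near_eq_is_derive (derivableP dF).
near=> y; apply: eq_Rintegral => x; rewrite inE /= in_itv /= => /andP[ax xy].
rewrite g0g // ax /=; apply: le_trans xy _; apply: ltW.
by near: y; exact: lt_nbhsl.
Unshelve. all: by end_near. Qed.

Lemma ac_derive_congr (R : realType) (a b : R) (f f' g g' : R -> R) :
  (forall s, a <= s <= b -> f' s = f s) ->
  (\forall s \ae (@lebesgue_measure R), s \in `]a, b[ -> g' s = g s) ->
  ac_derive a b f g -> ac_derive a b f' g'.
Proof.
move=> ff gg [acf Df]; split.
  move=> e /acf [d d0 H]; exists d => // N u v uv tr /(H _ _ _ uv tr).
  congr (_ < _); apply: eq_bigr => i _; have [? [? ?]] := uv i.
  by rewrite !ff //; apply/andP; split => //; lra.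
apply: ae_imply2 gg Df => s gs Df sab; rewrite gs //; have := Df sab.
apply: near_eq_is_derive.
near=> y; apply/esym/ff.
have : y \in `]a, b[ by near: y; exact: near_in_itvoo.
by rewrite in_itv /= => /andP[/ltW -> /ltW ->].
Unshelve. all: by end_near. Qed.

Lemma abs_continuousS (R : realType) (V : normedModType R) (a b a' b' : R)
    (f : R -> V) :
  a <= a' -> b' <= b -> abs_continuous a b f -> abs_continuous a' b' f.
Proof.
move=> aa bb acf e /acf [d d0 H]; exists d => // N u v uv tr; apply: H => //.
move=> i; have [? [? ?]] := uv i; split; first by lra.
by split => //; lra.
Qed.

Lemma ac_deriveS (R : realType) (a b a' b' : R) (f g : R -> R) :
  a <= a' -> b' <= b -> ac_derive a b f g -> ac_derive a' b' f g.
Proof.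
move=> aa bb [acf Df]; split; first exact: abs_continuousS acf.
apply: ae_imply Df => s H; rewrite in_itv /= => /andP[? ?]; apply: H.
by rewrite in_itv /=; apply/andP; split; lra.
Qed.

Lemma abs_continuous_modulus (R : realType) (V : normedModType R) (a b : R)
    (f : R -> V) : abs_continuous a b f ->
  forall e : R, 0 < e -> exists2 d : R, 0 < d & forall x y, a <= x <= b ->
    a <= y <= b -> `|x - y| < d -> `|f x - f y| < e.
Proof.
move=> acf e e0; have [d d0 H] := acf e e0; exists d => //.
have key x y : a <= x -> y <= b -> x <= y -> y - x < d -> `|f x - f y| < e.
  move=> ax yb xy yxd; rewrite distrC.
  have := H 1%N (fun=> x) (fun=> y); rewrite !big_ord1; apply => //.
  by apply/trivIsetP => i j _ _; rewrite !ord1 eqxx.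
move=> x y /andP[ax xb] /andP[ay yb]; have [xy|yx] := leP x y.
  by rewrite distrC ger0_norm ?subr_ge0 //; exact: key.
by rewrite gtr0_norm ?subr_gt0 // (distrC (f x)); apply: key => //; exact: ltW.
Qed.

Lemma within_continuous_itv (R : realType) (a b : R) (f : R -> R) :
  (forall x, a <= x <= b -> forall e : R, 0 < e -> exists2 d : R, 0 < d &
     forall y, a <= y <= b -> `|x - y| < d -> `|f x - f y| < e) ->
  {within `[a, b], continuous f}.
Proof.
move=> H; apply/subspace_continuousP => x /=; rewrite in_itv /= => xab.
apply/cvgrPdist_lt => e e0; have [d d0 Hd] := H x xab e e0.
rewrite near_withinE; apply/nbhs_ballP; exists d => //= y xyd yab.
by apply: Hd => //; move: yab; rewrite in_itv.
Qed.

Lemma abs_continuous_within (R : realType) (a b : R) (f : R -> R) :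
  abs_continuous a b f -> {within `[a, b], continuous f}.
Proof.
move=> acf; apply: within_continuous_itv => x xab e e0.
have [d d0 H] := abs_continuous_modulus acf e0.
by exists d => // y yab xy; apply: H.
Qed.

Lemma within_continuous_bounded (R : realType) (a b : R) (f : R -> R) :
  {within `[a, b], continuous f} ->
  exists2 M, 0 < M & forall x, a <= x <= b -> `|f x| <= M.
Proof.
move=> cf; have [ab|ba] := leP a b; last first.
  by exists 1 => // x /andP[ax xb]; have := le_trans ax xb; rewrite leNgt ba.
have [c _ Hc] := EVT_max ab cf; have [c' _ Hc'] := EVT_min ab cf.
exists (`|f c| + `|f c'| + 1); first by rewrite ltr_wpDl // addr_ge0.
move=> x xab; have xab' : x \in `[a, b] by rewrite in_itv.
have := Hc x xab'; have := Hc' x xab'.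
have := ler_norm (f c); have := ler_norm (- f c'); rewrite normrN.
have := normr_ge0 (f c); have := normr_ge0 (f c').
by move=> *; rewrite ler_norml; apply/andP; split; lra.
Qed.

Lemma abs_continuous_bounded (R : realType) (a b : R) (f : R -> R) :
  abs_continuous a b f ->
  exists2 M, 0 < M & forall x, a <= x <= b -> `|f x| <= M.
Proof. by move=> /abs_continuous_within; exact: within_continuous_bounded. Qed.

(** * Calculus rules and comparison for absolutely continuous functions *)

Lemma ac_derive_cst (R : realType) (a b k : R) : ac_derive a b (cst k) (cst 0).
Proof.
split; last by apply: aeW => s _; exact: is_derive_cst.
move=> e e0; exists 1 => // N u v _ _ _.
by under eq_bigr do rewrite subrr normr0; rewrite big1.
Qed.

Lemma ac_deriveD (R : realType) (a b : R) (f1 f2 g1 g2 : R -> R) :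
  ac_derive a b f1 g1 -> ac_derive a b f2 g2 ->
  ac_derive a b (fun s => f1 s + f2 s) (fun s => g1 s + g2 s).
Proof.
move=> [ac1 D1] [ac2 D2]; split; last first.
  by apply: ae_imply2 D1 D2 => s D1 D2 sab; apply: is_deriveD; [apply: D1|apply: D2].
move=> e e0; have e2 : 0 < e / 2 by lra.
have [d1 d10 H1] := ac1 _ e2; have [d2 d20 H2] := ac2 _ e2.
exists (Num.min d1 d2); first by rewrite lt_min d10.
move=> N u v uv tr; rewrite lt_min => /andP[s1 s2].
have h1 := H1 N u v uv tr s1; have h2 := H2 N u v uv tr s2.
rewrite [e]splitr; apply: le_lt_trans (ltrD h1 h2).
rewrite -big_split /=; apply: ler_sum => i _.
by rewrite opprD addrACA; exact: ler_normD.
Qed.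

Lemma ac_deriveM (R : realType) (a b : R) (f1 f2 g1 g2 : R -> R) :
  ac_derive a b f1 g1 -> ac_derive a b f2 g2 ->
  ac_derive a b (fun s => f1 s * f2 s) (fun s => g1 s * f2 s + f1 s * g2 s).
Proof.
move=> [ac1 D1] [ac2 D2]; split; last first.
  apply: ae_imply2 D1 D2 => s D1 D2 sab.
  have := is_deriveM (D1 sab) (D2 sab).
  by rewrite /GRing.scale /= addrC (mulrC (f2 s)).
move=> e e0; have [M1 M10 b1] := abs_continuous_bounded ac1.
have [M2 M20 b2] := abs_continuous_bounded ac2.
have e1 : 0 < e / 2 / M2 by rewrite !divr_gt0.
have e2 : 0 < e / 2 / M1 by rewrite !divr_gt0.
have [d1 d10 H1] := ac1 _ e1; have [d2 d20 H2] := ac2 _ e2.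
exists (Num.min d1 d2); first by rewrite lt_min d10.
move=> N u v uv tr; rewrite lt_min => /andP[s1 s2].
have := H1 N u v uv tr s1; have := H2 N u v uv tr s2.
rewrite ltr_pdivlMr // => h2; rewrite ltr_pdivlMr // => h1.
rewrite [e]splitr; apply: le_lt_trans (ltrD h1 h2).
rewrite !mulr_suml -big_split /=; apply: ler_sum => i _.
have -> : f1 (v i) * f2 (v i) - f1 (u i) * f2 (u i) =
  (f1 (v i) - f1 (u i)) * f2 (v i) + (f2 (v i) - f2 (u i)) * f1 (u i) by ring.
have [au [uvi vb]] := uv i.
apply: le_trans (ler_normD _ _) _; rewrite !normrM; apply: lerD.
  by apply: ler_wpM2l => //; apply: b2; apply/andP; split; lra.
by apply: ler_wpM2l => //; apply: b1; apply/andP; split; lra.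
Qed.

(** The Lipschitz bound is asked only along the values of [f] on [[a, b]]; this admits the
    exponential, which is Lipschitz on half-lines bounded above, and the inverse, which is Lipschitz
    away from zero. *)
Lemma ac_derive_comp (R : realType) (a b K : R) (f g phi phi' : R -> R) :
  0 < K ->
  (forall x y, a <= x <= b -> a <= y <= b ->
     `|phi (f x) - phi (f y)| <= K * `|f x - f y|) ->
  (forall s, a < s < b -> is_derive (f s) (1 : R) phi (phi' (f s))) ->
  ac_derive a b f g -> ac_derive a b (phi \o f) (fun s => phi' (f s) * g s).
Proof.
move=> K0 lip Dphi [ac D]; split; last first.
  apply: ae_imply D => s D sab; apply: is_derive1_comp; last exact: D.
  by apply: Dphi; move: sab; rewrite in_itv.
move=> e e0; have eK : 0 < e / K by rewrite divr_gt0.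
have [d d0 H] := ac _ eK; exists d => // N u v uv tr /(H N u v uv tr).
rewrite ltr_pdivlMr // => h; apply: le_lt_trans h; rewrite mulr_suml.
apply: ler_sum => i _; rewrite mulrC; apply: lip.
  by have [? [? ?]] := uv i; apply/andP; split; lra.
by have [? [? ?]] := uv i; apply/andP; split; lra.
Qed.

Lemma expR_lipschitz (R : realType) (M x y : R) : x <= M -> y <= M ->
  `|expR x - expR y| <= expR M * `|x - y|.
Proof.
have key (u v : R) : u <= v -> v <= M -> expR v - expR u <= expR M * (v - u).
  move=> uv vM; have -> : expR v - expR u = expR v * (1 - expR (u - v)).
    by rewrite mulrBr mulr1 -expRD (addrC v) subrK.
  have h1 : 1 - expR (u - v) <= v - u by have := expR_ge1Dx (u - v); lra.
  apply: (@le_trans _ _ (expR v * (v - u))).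
    by rewrite ler_pM2l ?expR_gt0.
  by apply: ler_wpM2r; [lra|rewrite ler_expR].
move=> xM yM; have [xy|yx] := leP x y.
  rewrite distrC (distrC x) !ger0_norm ?subr_ge0 ?ler_expR //; exact: key.
rewrite !ger0_norm ?subr_ge0 ?ler_expR ?(ltW yx) //; apply: key => //; exact: ltW.
Qed.

Lemma ac_derive_expR (R : realType) (a b : R) (f g : R -> R) :
  ac_derive a b f g -> ac_derive a b (fun s => expR (f s)) (fun s => expR (f s) * g s).
Proof.
move=> acf; have [M M0 bM] := abs_continuous_bounded (proj1 acf).
apply: (@ac_derive_comp R a b (expR M) f g expR expR) => //; first exact: expR_gt0.
  move=> x y xab yab; apply: expR_lipschitz.
    exact: le_trans (ler_norm _) (bM x xab).
  exact: le_trans (ler_norm _) (bM y yab).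
Qed.

Lemma ac_derive_inv (R : realType) (a b m : R) (f g : R -> R) : 0 < m ->
  (forall s, a <= s <= b -> m <= `|f s|) ->
  ac_derive a b f g ->
  ac_derive a b (fun s => (f s)^-1) (fun s => - (f s) ^- 2 * g s).
Proof.
move=> m0 fm acf.
have f0 s : a <= s <= b -> f s != 0.
  by move=> /fm h; rewrite -normr_gt0; exact: lt_le_trans h.
apply: (@ac_derive_comp R a b (m ^- 2) f g GRing.inv (fun x => - x ^- 2)) => //.
- by rewrite invr_gt0 exprn_gt0.
- move=> x y xab yab; have fx0 := f0 x xab; have fy0 := f0 y yab.
  have -> : (f x)^-1 - (f y)^-1 = - ((f x)^-1 * (f y)^-1 * (f x - f y)).
    by field; rewrite fx0 fy0.
  rewrite normrN normrM; apply: ler_wpM2r => //.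
  rewrite normrM !normfV expr2 invfM; apply: ler_pM; rewrite ?invr_ge0 //.
    by rewrite lef_pV2 ?posrE ?normr_gt0 //; exact: fm.
  by rewrite lef_pV2 ?posrE ?normr_gt0 //; exact: fm.
- move=> s /andP[/ltW as_ /ltW sb]; have fs0 : f s != 0 by apply: f0; rewrite as_.
  have := @is_deriveV R id (f s) 1 1 fs0 (is_derive_id _ _).
  by rewrite /GRing.scale /= mulr1.
Qed.

Lemma ac_derive_sum (R : realType) (a b : R) (I : Type) (r : seq I) (P : pred I)
    (f g : I -> R -> R) :
  (forall i, P i -> ac_derive a b (f i) (g i)) ->
  ac_derive a b (fun s => \sum_(i <- r | P i) f i s) (fun s => \sum_(i <- r | P i) g i s).
Proof.
move=> H; elim: r => [|i r IH].
  apply: ac_derive_congr (ac_derive_cst a b 0); first by move=> s _; rewrite big_nil.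
  by apply: aeW => s _; rewrite big_nil.
case Pi : (P i).
  apply: ac_derive_congr (ac_deriveD (H i Pi) IH); first by move=> s _; rewrite big_cons Pi.
  by apply: aeW => s _; rewrite big_cons Pi.
apply: ac_derive_congr IH; first by move=> s _; rewrite big_cons Pi.
by apply: aeW => s _; rewrite big_cons Pi.
Qed.

Lemma ac_deriveZ (R : realType) (a b k : R) (f g : R -> R) :
  ac_derive a b f g -> ac_derive a b (fun s => k * f s) (fun s => k * g s).
Proof.
move=> acf; apply: ac_derive_congr (ac_deriveM (ac_derive_cst a b k) acf) => //.
by apply: aeW => s _; rewrite mul0r add0r.
Qed.

Lemma ac_deriveB (R : realType) (a b : R) (f1 f2 g1 g2 : R -> R) :
  ac_derive a b f1 g1 -> ac_derive a b f2 g2 ->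
  ac_derive a b (fun s => f1 s - f2 s) (fun s => g1 s - g2 s).
Proof.
move=> h1 h2; apply: ac_derive_congr (ac_deriveD h1 (ac_deriveZ (-1) h2)).
  by move=> s _; rewrite mulN1r.
by apply: aeW => s _; rewrite mulN1r.
Qed.

Lemma ac_derive_le (R : realType) (a b : R) (f1 f2 g1 g2 : R -> R) : a <= b ->
  ac_derive a b f1 g1 -> ac_derive a b f2 g2 ->
  (\forall s \ae (@lebesgue_measure R), s \in `]a, b[ -> g1 s <= g2 s) ->
  f1 b - f1 a <= f2 b - f2 a.
Proof.
move=> ab h1 h2 le12; have [ac D] := ac_deriveB h1 h2.
have := ac_nonincreasing (g := fun s => g1 s - g2 s) ab ac.
suff H : \forall s \ae lebesgue_measure, s \in `]a, b[ ->
    is_derive s 1 (fun s0 : R => f1 s0 - f2 s0) (g1 s - g2 s) /\ g1 s - g2 s <= 0.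
  by move=> /(_ H); lra.
apply: ae_imply2 D le12 => s D le12 sab; split; first exact: D.
by rewrite subr_le0; exact: le12.
Qed.

(** [f] is compared in both directions with the primitive of [g], which has the same derivative
    almost everywhere. *)
Lemma ac_derive_FTC (R : realType) (a b : R) (f g : R -> R) : a <= b ->
  ac_derive a b f g -> integrable_on a b g ->
  f b - f a = \int[@lebesgue_measure R]_(x in `[a, b]) g x.
Proof.
move=> ab acf ig; have acG := ac_derive_integral ig.
have G0 : \int[@lebesgue_measure R]_(x in `[a, a]) g x = 0.
  by rewrite set_itv1 Rintegral_set1.
have gg : \forall s \ae (@lebesgue_measure R), s \in `]a, b[ -> g s <= g s by exact: aeW.
have e1 := ac_derive_le ab acf acG gg; have e2 := ac_derive_le ab acG acf gg.
by apply/eqP; rewrite eq_le; move: e1 e2; rewrite G0 subr0 => -> ->.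
Qed.

(** The integrating factor is the exponential of minus the primitive of [alpha]. It is at most [1]
    because [alpha] is nonnegative, so the product of [E] with it has derivative at most [beta]. *)
Lemma gronwall (R : realType) (a b : R) (E g alpha beta : R -> R) : a <= b ->
  ac_derive a b E g -> (forall s, a <= s <= b -> 0 <= E s) ->
  integrable_on a b alpha -> integrable_on a b beta ->
  (forall s, 0 <= alpha s) -> (forall s, 0 <= beta s) ->
  (\forall s \ae (@lebesgue_measure R), s \in `]a, b[ ->
     g s <= alpha s * E s + beta s) ->
  E b <= expR (\int[@lebesgue_measure R]_(x in `[a, b]) alpha x) *
    (E a + \int[@lebesgue_measure R]_(x in `[a, b]) beta x).
Proof.
move=> ab acE E0 ia ib a0 b0 gle.
set Aa := fun s => \int[@lebesgue_measure R]_(x in `[a, s]) alpha x.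
have acA : ac_derive a b Aa alpha by exact: ac_derive_integral.
have acB := ac_derive_integral ib.
have Aa0 s : 0 <= Aa s by apply: Rintegral_ge0 => x _.
have := ac_derive_expR (ac_deriveZ (-1) acA) => acX.
have := ac_derive_le ab (ac_deriveM acE acX) acB _.
have I0 (h : R -> R) : \int[@lebesgue_measure R]_(x in `[a, a]) h x = 0.
  by rewrite set_itv1 Rintegral_set1.
rewrite /= /Aa !I0 mulr0 expR0 mulr1 subr0 => H.
have {}H := H _; rewrite mulrC -ler_pdivrMr ?expR_gt0 //.
rewrite -expRN -mulN1r -lerBlDl; apply: H.
apply: ae_imply gle => s gle sab.
rewrite -/(Aa s) mulrCA -[leRHS]mul1r.
have sab' : a <= s <= b by move: sab; rewrite in_itv /= => /andP[/ltW -> /ltW ->].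
have := gle sab => {}gle.
set X := expR (-1 * Aa s).
have X0 : 0 < X by exact: expR_gt0.
have X1 : X <= 1 by rewrite /X -[leRHS]expR0 ler_expR mulN1r oppr_le0; exact: Aa0.
have : X * (g s - alpha s * E s - beta s) <= 0.
  by apply: mulr_ge0_le0; [exact: ltW|lra].
have : (1 - X) * beta s >= 0 by apply: mulr_ge0 => //; lra.
nra.
Qed.

(** The opposite integrating factor makes a nondecreasing product. A solution of a linear equation
    that vanishes at the right end then vanishes at the left end, which is how injectivity of the
    flow is obtained later. *)
Lemma gronwall_backward (R : realType) (a b : R) (E g alpha : R -> R) : a <= b ->
  ac_derive a b E g -> integrable_on a b alpha ->
  (\forall s \ae (@lebesgue_measure R), s \in `]a, b[ ->
     - (alpha s * E s) <= g s) ->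
  E a <= expR (\int[@lebesgue_measure R]_(x in `[a, b]) alpha x) * E b.
Proof.
move=> ab acE ia gle.
set Aa := fun s => \int[@lebesgue_measure R]_(x in `[a, s]) alpha x.
have acA : ac_derive a b Aa alpha by exact: ac_derive_integral.
have acX := ac_derive_expR acA.
have := ac_derive_le ab (ac_derive_cst a b 0) (ac_deriveM acE acX) _.
have I0 (h : R -> R) : \int[@lebesgue_measure R]_(x in `[a, a]) h x = 0.
  by rewrite set_itv1 Rintegral_set1.
rewrite /= /Aa I0 expR0 mulr1 subrr mulrC subr_ge0; apply.
apply: ae_imply gle => s gle sab; have {}gle := gle sab.
rewrite -/(Aa s); have := expR_gt0 (Aa s); set X := expR _ => X0.
have : 0 <= X * (g s + alpha s * E s) by apply: mulr_ge0; [exact: ltW|lra].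
by rewrite mulrDr; lra.
Qed.

(** * Integrals over compact intervals *)

Lemma integrable_onD (R : realType) (a b : R) (f g : R -> R) :
  integrable_on a b f -> integrable_on a b g ->
  integrable_on a b (fun s => f s + g s).
Proof.
move=> ifn ign.
exact: (@integrableD _ _ R (@lebesgue_measure R) `[a, b] (measurable_itv _) _ _ ifn ign).
Qed.

Lemma integrable_onZ (R : realType) (a b k : R) (f : R -> R) :
  integrable_on a b f -> integrable_on a b (fun s => k * f s).
Proof.
move=> ifn.
exact: (@integrableZl _ _ R (@lebesgue_measure R) `[a, b] (measurable_itv _) k _ ifn).
Qed.

Lemma integrable_on_eq (R : realType) (a b : R) (f g : R -> R) :
  (forall s, a <= s <= b -> f s = g s) -> integrable_on a b g ->
  integrable_on a b f.
Proof.
move=> fg ig; apply: eq_integrable ig; first exact: measurable_itv.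
by move=> x; rewrite inE /= in_itv /= => /fg ->.
Qed.

Lemma integrable_onB (R : realType) (a b : R) (f g : R -> R) :
  integrable_on a b f -> integrable_on a b g ->
  integrable_on a b (fun s => f s - g s).
Proof.
move=> ifn /(integrable_onZ (-1)) ign.
by apply: integrable_on_eq (integrable_onD ifn ign) => s _; rewrite mulN1r.
Qed.

Lemma integrable_on_sum (R : realType) (a b : R) (I : Type) (r : seq I)
    (P : pred I) (f : I -> R -> R) :
  (forall i, P i -> integrable_on a b (f i)) ->
  integrable_on a b (fun s => \sum_(i <- r | P i) f i s).
Proof.
move=> H; elim: r => [|i r IH].
  apply: integrable_on_eq (integrable_on_cst a b 0) => s _.
  by rewrite big_nil.
case Pi : (P i).
  apply: integrable_on_eq (integrable_onD (H i Pi) IH) => s _.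
  by rewrite big_cons Pi.
by apply: integrable_on_eq IH => s _; rewrite big_cons Pi.
Qed.

Lemma integrable_on_norm (R : realType) (a b : R) (f : R -> R) :
  integrable_on a b f -> integrable_on a b (fun s => `|f s|).
Proof. by move=> ifn; exact: (@integrable_norm _ _ R (@lebesgue_measure R)). Qed.

Lemma integrable_on_subitv (R : realType) (a b a' b' : R) (f : R -> R) :
  a <= a' -> b' <= b -> integrable_on a b f -> integrable_on a' b' f.
Proof.
move=> aa bb ifn; apply: integrable_onS ifn _ _; first exact: measurable_itv.
by move=> x /=; rewrite !in_itv /= => /andP[? ?]; apply/andP; split; lra.
Qed.

Lemma integrable_onM_sqr (R : realType) (a b : R) (f g : R -> R) :
  measurable_fun `[a, b] f -> measurable_fun `[a, b] g ->
  integrable_on a b (fun s => f s ^+ 2) -> integrable_on a b (fun s => g s ^+ 2) ->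
  integrable_on a b (fun s => f s * g s).
Proof.
move=> mf mg if2 ig2.
apply: integrable_on_le (integrable_onD if2 ig2) _; first exact: measurable_funM.
apply: aeW => s _; rewrite normrM -(real_normK (num_real (f s))).
rewrite -(real_normK (num_real (g s))).
have := normr_ge0 (f s); have := normr_ge0 (g s); nra.
Qed.

Lemma integrable_onM_bounded (R : realType) (a b : R) (f g : R -> R) :
  integrable_on a b f -> measurable_fun `[a, b] g ->
  (exists M : R, \forall s \ae (@lebesgue_measure R), s \in `[a, b] -> `|g s| <= M) ->
  integrable_on a b (fun s => f s * g s).
Proof.
move=> ifn mg [M gM].
apply: integrable_on_le (integrable_onZ `|M| (integrable_on_norm ifn)) _.
  by apply: measurable_funM => //; exact: integrable_on_measurable.
apply: ae_imply gM => s gM sab; rewrite normrM mulrC; apply: ler_wpM2r => //.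
exact: le_trans (gM sab) (ler_norm _).
Qed.

Lemma within_continuous_measurable (R : realType) (a b : R) (f : R -> R) :
  {within `[a, b], continuous f} -> measurable_fun `[a, b] f.
Proof.
by move=> cf; apply: subspace_continuous_measurable_fun => //; exact: measurable_itv.
Qed.

Lemma RintD (R : realType) (a b : R) (f g : R -> R) :
  integrable_on a b f -> integrable_on a b g ->
  \int[@lebesgue_measure R]_(s in `[a, b]) (f s + g s) =
  \int[@lebesgue_measure R]_(s in `[a, b]) f s +
  \int[@lebesgue_measure R]_(s in `[a, b]) g s.
Proof. by move=> ? ?; rewrite RintegralD //; exact: measurable_itv. Qed.

Lemma RintZ (R : realType) (a b k : R) (f : R -> R) :
  integrable_on a b f ->
  \int[@lebesgue_measure R]_(s in `[a, b]) (k * f s) =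
  k * \int[@lebesgue_measure R]_(s in `[a, b]) f s.
Proof. by move=> ?; rewrite RintegralZl //; exact: measurable_itv. Qed.

Lemma Rint_ae_eq (R : realType) (a b : R) (f g : R -> R) :
  measurable_fun `[a, b] f -> measurable_fun `[a, b] g ->
  (\forall s \ae (@lebesgue_measure R), s \in `[a, b] -> f s = g s) ->
  \int[@lebesgue_measure R]_(s in `[a, b]) f s =
  \int[@lebesgue_measure R]_(s in `[a, b]) g s.
Proof.
move=> mf mg fg; rewrite /Rintegral; congr fine; apply: ae_eq_integral => //.
- exact/measurable_EFinP.
- exact/measurable_EFinP.
- by apply: ae_imply fg => s h /= sab; rewrite h.
Qed.

(** Replacing [f] by [|f|] off a null set turns a sign known almost everywhere into one that holds
    everywhere. *)
Lemma Rint_ae_ge0 (R : realType) (a b : R) (f : R -> R) :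
  measurable_fun `[a, b] f ->
  (\forall s \ae (@lebesgue_measure R), s \in `[a, b] -> 0 <= f s) ->
  0 <= \int[@lebesgue_measure R]_(s in `[a, b]) f s.
Proof.
move=> mf f0; rewrite (@Rint_ae_eq _ _ _ f (fun s => `|f s|)) //.
- by apply: Rintegral_ge0 => x _.
- exact: measurableT_comp.
- by apply: ae_imply f0 => s h sab; rewrite ger0_norm // h.
Qed.

Lemma Rint_ae_le (R : realType) (a b : R) (f g : R -> R) :
  integrable_on a b f -> integrable_on a b g ->
  (\forall s \ae (@lebesgue_measure R), s \in `[a, b] -> f s <= g s) ->
  \int[@lebesgue_measure R]_(s in `[a, b]) f s <=
  \int[@lebesgue_measure R]_(s in `[a, b]) g s.
Proof.
move=> ifn ign fg.
have h : 0 <= \int[@lebesgue_measure R]_(s in `[a, b]) (g s - f s).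
  apply: Rint_ae_ge0; first by apply: integrable_on_measurable; exact: integrable_onB.
  by apply: ae_imply fg => s h sab; rewrite subr_ge0 h.
have : \int[@lebesgue_measure R]_(s in `[a, b]) g s =
  \int[@lebesgue_measure R]_(s in `[a, b]) (g s - f s) +
  \int[@lebesgue_measure R]_(s in `[a, b]) f s.
  rewrite -RintD //; last exact: integrable_onB.
  by apply: eq_Rintegral => s _; rewrite subrK.
by move=> ->; rewrite lerDr.
Qed.

Lemma Rint_sum (R : realType) (a b : R) (I : Type) (r : seq I)
    (f : I -> R -> R) :
  (forall i, integrable_on a b (f i)) ->
  \int[@lebesgue_measure R]_(s in `[a, b]) (\sum_(i <- r) f i s) =
  \sum_(i <- r) \int[@lebesgue_measure R]_(s in `[a, b]) f i s.
Proof.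
move=> H; elim: r => [|i r IH].
  rewrite big_nil; under eq_Rintegral do rewrite big_nil.
  by rewrite Rintegral_cst ?mul0r //; exact: measurable_itv.
rewrite big_cons -IH -RintD //; last exact: integrable_on_sum.
by apply: eq_Rintegral => s _; rewrite big_cons.
Qed.

Lemma Rint_subitv (R : realType) (a b a' b' : R) (f : R -> R) :
  a <= a' -> b' <= b -> integrable_on a b f -> (forall s, 0 <= f s) ->
  \int[@lebesgue_measure R]_(s in `[a', b']) f s <=
  \int[@lebesgue_measure R]_(s in `[a, b]) f s.
Proof.
move=> aa bb ifn f0.
have mf : measurable_fun `[a, b] (EFin \o f).
  by apply/measurable_EFinP; exact: integrable_on_measurable.
rewrite /Rintegral fine_le //.
- apply: integrable_fin_num; first exact: measurable_itv.
  exact: integrable_on_subitv ifn.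
- by apply: integrable_fin_num; first exact: measurable_itv.
- apply: ge0_subset_integral.
  + exact: measurable_itv.
  + exact: measurable_itv.
  + exact: mf.
  + by move=> x _; rewrite lee_fin.
  + by move=> x /=; rewrite !in_itv /= => /andP[? ?]; apply/andP; split; lra.
Qed.

Lemma Rint_eq0_ae (R : realType) (a b : R) (f : R -> R) :
  integrable_on a b f -> (forall s, 0 <= f s) ->
  \int[@lebesgue_measure R]_(s in `[a, b]) f s <= 0 ->
  \forall s \ae (@lebesgue_measure R), s \in `[a, b] -> f s = 0.
Proof.
move=> ifn f0 int0.
have mf : measurable_fun `[a, b] (EFin \o f).
  by apply/measurable_EFinP; exact: integrable_on_measurable.
have h : (\int[@lebesgue_measure R]_(s in `[a, b]) `|(f s)%:E| = 0)%E.
  under eq_integral do rewrite gee0_abs ?lee_fin //.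
  apply/eqP; rewrite eq_le; apply/andP; split; last first.
    by apply: integral_ge0 => x _; rewrite lee_fin.
  by rewrite -[X in (X <= _)%E]fineK // ?lee_fin //;
   apply: integrable_fin_num => //; exact: measurable_itv.
have := (ae_eq_integral_abs (@lebesgue_measure R) (measurable_itv _) mf).1 h.
by apply: ae_imply => s H sab; have /= [] := H sab.
Qed.

(** The extension is [f a] plus the primitive of [g]. The original value [f b] is discarded: at a
    singular end the hypotheses of the problem do not tie it to the values before it. *)
Lemma ac_derive_extend (R : realType) (a b : R) (f g : R -> R) :
  (forall c, a <= c -> c < b -> ac_derive a c f g) -> integrable_on a b g ->
  exists2 f', ac_derive a b f' g & forall s, a <= s -> s < b -> f' s = f s.
Proof.
move=> H ig.
exists (fun s => f a + \int[@lebesgue_measure R]_(x in `[a, s]) g x).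
  apply: ac_derive_congr (ac_deriveD (ac_derive_cst a b (f a)) (ac_derive_integral ig)) => //.
  by apply: aeW => s _; rewrite add0r.
move=> s as_ sb; rewrite -(ac_derive_FTC as_ (H s as_ sb)); first by rewrite addrC subrK.
by apply: integrable_on_subitv ig => //; exact: ltW.
Qed.

(** Continuity at [b]. Relations that involve [P], available only before [T], are carried to [T] in
    this way. *)
Lemma ac_derive_ge0_right (R : realType) (a b : R) (f g : R -> R) : a < b ->
  ac_derive a b f g -> (forall s, a <= s -> s < b -> 0 <= f s) -> 0 <= f b.
Proof.
move=> ab [acf _] H; rewrite leNgt; apply/negP => fb.
have e0 : 0 < - f b by rewrite oppr_gt0.
have [d d0 Hd] := abs_continuous_modulus acf e0.
pose s := Num.max a (b - d / 2).
have as_ : a <= s by rewrite le_max lexx.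
have sb : s < b by rewrite gt_max ab /=; lra.
have bs : b - d / 2 <= s by rewrite le_max lexx orbT.
have := Hd s b; rewrite as_ (ltW sb) (ltW ab) lexx /= => /(_ isT isT).
rewrite ltr0_norm ?subr_lt0 // => h.
have /h : - (s - b) < d by lra.
have := H s as_ sb; have := ler_norm (f s - f b); lra.
Qed.

Lemma ac_derive_eq_right (R : realType) (a b k : R) (f g : R -> R) : a < b ->
  ac_derive a b f g -> (forall s, a <= s -> s < b -> f s = k) -> f b = k.
Proof.
move=> ab acf H; apply/eqP; rewrite eq_le.
have h1 := @ac_derive_ge0_right _ a b _ _ ab (ac_deriveB acf (ac_derive_cst a b k)).
have h2 := @ac_derive_ge0_right _ a b _ _ ab (ac_deriveB (ac_derive_cst a b k) acf).
rewrite -subr_ge0 h2 /= ?subr_ge0; last by move=> s *; rewrite H ?subrr.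
by rewrite -subr_ge0; apply: h1 => s *; rewrite H ?subrr.
Qed.

(** * Matrix-valued absolutely continuous functions *)

Lemma mx_norm_coord (R : realType) (p q : nat) (M : 'M[R]_(p, q)) i j :
  `|M i j| <= `|M|.
Proof.
rewrite [leRHS]/Num.Def.normr /= mx_normrE.
exact: (le_bigmax _ (fun ij : 'I_p * 'I_q => `|M ij.1 ij.2|) (i, j)).
Qed.

Lemma mx_norm_le_sum (R : realType) (p q : nat) (M : 'M[R]_(p, q)) :
  `|M| <= \sum_i \sum_j `|M i j|.
Proof.
rewrite [leLHS]/Num.Def.normr /= mx_normrE; apply: bigmax_le.
  by do 2 apply: sumr_ge0 => ? _.
move=> [i j] _ /=; rewrite (bigD1 i) //= (bigD1 j) //= -addrA lerDl.
by apply: addr_ge0; do ?[apply: sumr_ge0 => ? _].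
Qed.

Lemma is_derive_mxP (R : realType) (p q : nat) (X : R -> 'M[R]_(p, q)) (s : R)
    (F : 'M[R]_(p, q)) :
  is_derive s (1 : R) X F <->
  forall i j, is_derive s (1 : R) (fun r => X r i j) (F i j).
Proof.
split=> [[dX XF] i j|H].
  have /derivable_mxP/(_ i j) dXij := dX.
  by split=> //; move: XF; rewrite derive_mx // => <-; rewrite mxE.
have dX : derivable X s 1 by apply/derivable_mxP => i j; case: (H i j).
split=> //; rewrite derive_mx //; apply/matrixP => i j; rewrite mxE.
by case: (H i j).
Qed.

Definition mx_ac_derive (R : realType) (p q : nat) (a b : R) (X F : R -> 'M[R]_(p, q)) :=
  forall i j, ac_derive a b (fun s => X s i j) (fun s => F s i j).

Lemma abs_continuous_coord (R : realType) (p q : nat) (a b : R)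
    (X : R -> 'M[R]_(p, q)) i j :
  abs_continuous a b X -> abs_continuous a b (fun s => X s i j).
Proof.
move=> acX e /acX [d d0 H]; exists d => // N u v uv tr /(H N u v uv tr).
apply: le_lt_trans; apply: ler_sum => k _.
by have := mx_norm_coord (X (v k) - X (u k)) i j; rewrite !mxE.
Qed.

Lemma abs_continuous_mx (R : realType) (p q : nat) (a b : R)
    (X : R -> 'M[R]_(p, q)) :
  (forall i j, abs_continuous a b (fun s => X s i j)) -> abs_continuous a b X.
Proof.
(* The matrix norm is at most the sum of its [p * q] entries, each of which receives [e / K]; the
   added [1] keeps [K] positive for empty matrices and the final inequality strict. *)
move=> acX e e0; pose K : R := (p * q)%N%:R + 1.
have K0 : 0 < K by rewrite /K ltr_wpDl.
have eK : 0 < e / K by rewrite divr_gt0.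
have H ij : {d : R | 0 < d /\ forall (N : nat) (u v : 'I_N -> R),
    (forall i, a <= u i /\ u i <= v i /\ v i <= b) ->
    trivIset [set: 'I_N] (fun i => `]u i, v i[%classic) ->
    \sum_(i < N) (v i - u i) < d ->
    \sum_(i < N) `|X (v i) ij.1 ij.2 - X (u i) ij.1 ij.2| < e / K}.
  by apply: cid; have [d d0 Hd] := acX ij.1 ij.2 _ eK; exists d.
pose d := \big[Order.min/1]_ij sval (H ij).
exists d.
  rewrite /d; elim/big_ind : _ => //.
    by move=> x y x0 y0; rewrite lt_min x0.
  by move=> ij _; case: (svalP (H ij)).
move=> N u v uv tr sd.
apply: (@le_lt_trans _ _ (\sum_(ij : 'I_p * 'I_q) (e / K))); last first.
  rewrite sumr_const card_prod !card_ord -mulr_natr -mulrA gtr_pMr //.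
  by rewrite mulrC ltr_pdivrMr // mul1r /K ltrDl.
apply: (@le_trans _ _ (\sum_(i < N) \sum_ij
    `|X (v i) ij.1 ij.2 - X (u i) ij.1 ij.2|)).
  apply: ler_sum => i _; apply: le_trans (mx_norm_le_sum _) _.
  rewrite pair_bigA /=; apply: ler_sum => -[k l] _ /=.
  by rewrite !mxE.
rewrite exchange_big /=; apply: ler_sum => ij _.
have [_ h] := svalP (H ij); apply/ltW/h => //.
apply: lt_le_trans sd _; rewrite /d; exact: bigmin_le.
Qed.

Lemma ode_ac_derive (R : realType) (p q : nat) (J : interval R) (a b : R)
    (X F : R -> 'M[R]_(p, q)) :
  [set` `[a, b]] `<=` [set` J] -> ode_solution J X F -> mx_ac_derive a b X F.
Proof.
move=> abJ [ac D] i j; split.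
  by apply: abs_continuous_coord; exact: ac.
apply: ae_imply D => s D sab.
have sJ : s \in J.
  apply: abJ; move: sab; rewrite /= !in_itv /=.
  by move=> /andP[/ltW -> /ltW ->].
by have /is_derive_mxP := D sJ; apply.
Qed.

Lemma ae_neq (R : realType) (k : R) :
  \forall s \ae (@lebesgue_measure R), s <> k.
Proof.
exists [set k]; split; first exact: measurable_set1.
  exact: lebesgue_measure_set1.
by move=> s /= /contrapT.
Qed.

(** [ode_solution] also asks for the derivative at endpoints belonging to [J]; these form a null
    set. *)
Lemma mx_ac_derive_ode (R : realType) (p q : nat) (J : interval R) (a b : R)
    (X F : R -> 'M[R]_(p, q)) :
  [set` J] `<=` [set` `[a, b]] -> mx_ac_derive a b X F -> ode_solution J X F.
Proof.
move=> Jab H; split.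
  move=> a' b' abJ; apply: abs_continuous_mx => i j.
  (* For a reversed pair the inclusion in [J] is vacuous, and so is absolute continuity, since no
     subinterval is admissible. *)
  have [ba|ab] := ltP b' a'.
    move=> e e0; exists 1 => // N u v uv _ _; rewrite big1 // => k _.
    have [? [? ?]] := uv k; have : a' <= b' by lra.
    by rewrite leNgt ba.
  have aJ : a' \in `[a, b] by apply/Jab/abJ; rewrite /= in_itv /= lexx.
  have bJ : b' \in `[a, b] by apply/Jab/abJ; rewrite /= in_itv /= lexx ab.
  move: aJ bJ; rewrite !in_itv /= => /andP[aa _] /andP[_ bb].
  by have [ac _] := H i j; exact: abs_continuousS ac.
have Dall : \forall s \ae (@lebesgue_measure R), forall ij : 'I_p * 'I_q,
    s \in `]a, b[ -> is_derive s (1 : R) (fun r => X r ij.1 ij.2) (F s ij.1 ij.2).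
  by apply: ae_forall_fin => ij; case: (H ij.1 ij.2).
apply: ae_imply3 Dall (ae_neq a) (ae_neq b) => s D sa sb /Jab /=.
rewrite in_itv /= => /andP[as_ sb'].
apply/is_derive_mxP => i j; apply: (D (i, j)); rewrite in_itv /= !lt_neqAle as_ sb'.
rewrite !andbT eq_sym; apply/andP; split; exact/eqP.
Qed.

Lemma mx_ac_derive_congr (R : realType) (p q : nat) (a b : R) (X X' F F' : R -> 'M[R]_(p, q)) :
  (forall s, a <= s <= b -> X' s = X s) ->
  (\forall s \ae (@lebesgue_measure R), s \in `]a, b[ -> F' s = F s) ->
  mx_ac_derive a b X F -> mx_ac_derive a b X' F'.
Proof.
move=> XX FF H i j; apply: ac_derive_congr (H i j).
  by move=> s /XX ->.
by apply: ae_imply FF => s h /h ->.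
Qed.

Lemma mx_ac_deriveS (R : realType) (p q : nat) (a b a' b' : R) (X F : R -> 'M[R]_(p, q)) :
  a <= a' -> b' <= b -> mx_ac_derive a b X F -> mx_ac_derive a' b' X F.
Proof. by move=> aa bb H i j; exact: ac_deriveS (H i j). Qed.

Lemma mx_ac_derive_cst (R : realType) (p q : nat) (a b : R) (M : 'M[R]_(p, q)) :
  mx_ac_derive a b (fun=> M) (fun=> 0).
Proof.
move=> i j; apply: ac_derive_congr (ac_derive_cst a b (M i j)) => //.
by apply: aeW => s _; rewrite mxE.
Qed.

Lemma mx_ac_deriveD (R : realType) (p q : nat) (a b : R) (X Y F G : R -> 'M[R]_(p, q)) :
  mx_ac_derive a b X F -> mx_ac_derive a b Y G ->
  mx_ac_derive a b (fun s => X s + Y s) (fun s => F s + G s).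
Proof.
move=> HX HY i j; apply: ac_derive_congr (ac_deriveD (HX i j) (HY i j)).
  by move=> s _; rewrite mxE.
by apply: aeW => s _; rewrite mxE.
Qed.

Lemma mx_ac_deriveN (R : realType) (p q : nat) (a b : R) (X F : R -> 'M[R]_(p, q)) :
  mx_ac_derive a b X F -> mx_ac_derive a b (fun s => - X s) (fun s => - F s).
Proof.
move=> HX i j; apply: ac_derive_congr (ac_deriveZ (-1) (HX i j)).
  by move=> s _; rewrite mxE mulN1r.
by apply: aeW => s _; rewrite mxE mulN1r.
Qed.

Lemma mx_ac_deriveB (R : realType) (p q : nat) (a b : R) (X Y F G : R -> 'M[R]_(p, q)) :
  mx_ac_derive a b X F -> mx_ac_derive a b Y G ->
  mx_ac_derive a b (fun s => X s - Y s) (fun s => F s - G s).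
Proof. by move=> HX HY; exact: mx_ac_deriveD HX (mx_ac_deriveN HY). Qed.

Lemma mx_ac_deriveM (R : realType) (p q r : nat) (a b : R) (X F : R -> 'M[R]_(p, q))
    (Y G : R -> 'M[R]_(q, r)) :
  mx_ac_derive a b X F -> mx_ac_derive a b Y G ->
  mx_ac_derive a b (fun s => X s *m Y s) (fun s => F s *m Y s + X s *m G s).
Proof.
move=> HX HY i j.
have := ac_derive_sum (index_enum 'I_q) (P := xpredT) (fun k _ => ac_deriveM (HX i k) (HY k j)).
apply: ac_derive_congr; first by move=> s _; rewrite mxE.
by apply: aeW => s _; rewrite !mxE -big_split.
Qed.

Lemma mx_ac_deriveT (R : realType) (p q : nat) (a b : R) (X F : R -> 'M[R]_(p, q)) :
  mx_ac_derive a b X F -> mx_ac_derive a b (fun s => (X s)^T) (fun s => (F s)^T).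
Proof.
move=> H i j; apply: ac_derive_congr (H j i); first by move=> s _; rewrite mxE.
by apply: aeW => s _; rewrite mxE.
Qed.

Lemma mx_ac_deriveMr (R : realType) (p q r : nat) (a b : R) (X F : R -> 'M[R]_(p, q))
    (M : 'M[R]_(q, r)) :
  mx_ac_derive a b X F -> mx_ac_derive a b (fun s => X s *m M) (fun s => F s *m M).
Proof.
move=> HX; apply: mx_ac_derive_congr (mx_ac_deriveM HX (mx_ac_derive_cst a b M)) => //.
by apply: aeW => s _; rewrite mulmx0 addr0.
Qed.

Lemma mx_ac_deriveMl (R : realType) (p q r : nat) (a b : R) (X F : R -> 'M[R]_(q, r))
    (M : 'M[R]_(p, q)) :
  mx_ac_derive a b X F -> mx_ac_derive a b (fun s => M *m X s) (fun s => M *m F s).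
Proof.
move=> HX; apply: mx_ac_derive_congr (mx_ac_deriveM (mx_ac_derive_cst a b M) HX) => //.
by apply: aeW => s _; rewrite mul0mx add0r.
Qed.

Lemma mx_ac_derive_col_mx (R : realType) (p p' q : nat) (a b : R)
    (X F : R -> 'M[R]_(p, q)) (Y G : R -> 'M[R]_(p', q)) :
  mx_ac_derive a b X F -> mx_ac_derive a b Y G ->
  mx_ac_derive a b (fun s => col_mx (X s) (Y s)) (fun s => col_mx (F s) (G s)).
Proof.
move=> HX HY i j; case: (splitP i) => k ik.
  have -> : i = lshift p' k by exact: val_inj.
  apply: ac_derive_congr (HX k j); first by move=> s _; rewrite col_mxEu.
  by apply: aeW => s _; rewrite col_mxEu.
have -> : i = rshift p k by exact: val_inj.
apply: ac_derive_congr (HY k j); first by move=> s _; rewrite col_mxEd.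
by apply: aeW => s _; rewrite col_mxEd.
Qed.

Lemma inner_cvE (R : realType) (n : nat) (u v : 'cV[R]_n) :
  inner_cv u v = \sum_i u i ord0 * v i ord0.
Proof. by rewrite /inner_cv mxE; apply: eq_bigr => i _; rewrite mxE. Qed.

Lemma ac_derive_inner (R : realType) (n : nat) (a b : R) (X F Y G : R -> 'cV[R]_n) :
  mx_ac_derive a b X F -> mx_ac_derive a b Y G ->
  ac_derive a b (fun s => inner_cv (X s) (Y s))
          (fun s => inner_cv (F s) (Y s) + inner_cv (X s) (G s)).
Proof.
move=> HX HY; have := mx_ac_deriveM (mx_ac_deriveT HX) HY ord0 ord0.
by apply: ac_derive_congr => //; apply: aeW => s _; rewrite mxE.
Qed.

Lemma ac_derive_abs_continuous (R : realType) (a b : R) (f g : R -> R) :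
  ac_derive a b f g -> abs_continuous a b f.
Proof. by case. Qed.

(** The square of [f] is continuous on [[a, b]], so it attains a minimum, which is nonzero. *)
Lemma ac_derive_lower_bound (R : realType) (a b : R) (f g : R -> R) :
  ac_derive a b f g -> (forall s, a <= s <= b -> f s != 0) ->
  exists2 m, 0 < m & forall s, a <= s <= b -> m <= `|f s|.
Proof.
move=> acf f0; have [ab|ba] := leP a b; last first.
  by exists 1 => // x /andP[ax xb]; have := le_trans ax xb; rewrite leNgt ba.
have cf := abs_continuous_within (ac_derive_abs_continuous (ac_deriveM acf acf)).
have [c cab Hc] := EVT_min ab cf; rewrite in_itv /= in cab.
exists `|f c|; first by rewrite normr_gt0 f0.
move=> s sab; have := Hc s; rewrite in_itv /= => /(_ sab).
by rewrite -!expr2 -(real_normK (num_real (f c))) -(real_normK (num_real (f s)))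
  ler_pXn2r.
Qed.

Definition ac_derivable (R : realType) (a b : R) (f : R -> R) := exists g, ac_derive a b f g.

Lemma ac_derivable_prod (R : realType) (a b : R) (I : Type) (r : seq I) (f : I -> R -> R) :
  (forall i, ac_derivable a b (f i)) -> ac_derivable a b (fun s => \prod_(i <- r) f i s).
Proof.
move=> H; elim: r => [|i r [g IH]].
  exists (cst 0); apply: ac_derive_congr (ac_derive_cst a b 1); last exact: aeW.
  by move=> s _; rewrite big_nil.
have [h Hi] := H i; eexists; apply: ac_derive_congr (ac_deriveM Hi IH); last exact: aeW.
by move=> s _; rewrite big_cons.
Qed.

Lemma ac_derivable_det (R : realType) (a b : R) (n : nat) (X : R -> 'M[R]_n) :
  (forall i j, ac_derivable a b (fun s => X s i j)) -> ac_derivable a b (fun s => \det (X s)).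
Proof.
move=> H.
have /choice [g Hg] (s : {perm 'I_n}) : exists g, ac_derive a b
    (fun r => (-1) ^+ s * \prod_i X r i (s i)) g.
  have [g Hg] := ac_derivable_prod (index_enum 'I_n) (fun i => H i (s i)).
  by eexists; exact: ac_deriveZ Hg.
eexists; apply: ac_derive_congr
  (ac_derive_sum (index_enum {perm 'I_n}) (P := xpredT) (fun s _ => Hg s)).
  by [].
exact: aeW.
Qed.

(* The entries of the inverse are rational in those of [X], hence
   differentiable; the value comes from differentiating [X *m invmx X = 1]. *)
Lemma mx_ac_derive_inv (R : realType) (a b : R) (n : nat) (X F : R -> 'M[R]_n) :
  (forall s, a <= s <= b -> X s \in unitmx) -> mx_ac_derive a b X F ->
  mx_ac_derive a b (fun s => invmx (X s)) (fun s => - (invmx (X s) *m F s *m invmx (X s))).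
Proof.
move=> uX HX.
have [d Hd] : ac_derivable a b (fun s => \det (X s)).
  by apply: ac_derivable_det => i j; eexists; exact: HX.
have d0 s : a <= s <= b -> \det (X s) != 0.
  by move=> /uX; rewrite unitmxE unitfE.
have [m m0 mlb] := ac_derive_lower_bound Hd d0.
have Hdi := ac_derive_inv m0 mlb Hd.
have H i : exists Gi : 'I_n -> R -> R, forall j, ac_derive a b (fun s => invmx (X s) i j) (Gi j).
  have /choice [Gi HG] j : exists g, ac_derive a b (fun s => invmx (X s) i j) g.
    have [c Hc] : ac_derivable a b (fun s => cofactor (X s) j i).
      have [c Hc] : ac_derivable a b (fun s => \det (row' j (col' i (X s)))).
        apply: ac_derivable_det => k l; eexists.
        by apply: ac_derive_congr (HX (lift j k) (lift i l)); [move=> s _; rewrite !mxE|exact: aeW].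
      by eexists; exact: ac_deriveZ Hc.
    eexists; apply: ac_derive_congr (ac_deriveM Hdi Hc); last exact: aeW.
    by move=> s sab; rewrite /invmx (uX s sab) !mxE.
  by exists Gi.
have /choice [G HG] := H.
pose Gm s := \matrix_(i, j) G i j s.
have HGm : mx_ac_derive a b (fun s => invmx (X s)) Gm.
  move=> i j; apply: ac_derive_congr (HG i j) => //.
  by apply: aeW => s _; rewrite mxE.
suff : \forall s \ae (@lebesgue_measure R), s \in `]a, b[ ->
    - (invmx (X s) *m F s *m invmx (X s)) = Gm s.
  by move=> h; apply: mx_ac_derive_congr HGm.
have : mx_ac_derive a b (fun s => X s *m invmx (X s)) (fun s => F s *m invmx (X s) + X s *m Gm s).
  exact: mx_ac_deriveM.
move=> Hone.
have Dall : \forall s \ae (@lebesgue_measure R), forall ij : 'I_n * 'I_n,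
    s \in `]a, b[ -> is_derive s (1 : R) (fun r => (X r *m invmx (X r)) ij.1 ij.2)
      ((F s *m invmx (X s) + X s *m Gm s) ij.1 ij.2).
  by apply: ae_forall_fin => ij; case: (Hone ij.1 ij.2).
apply: ae_imply Dall => s D sab.
have sab' : a <= s <= b by move: sab; rewrite in_itv /= => /andP[/ltW -> /ltW ->].
have e0 : F s *m invmx (X s) + X s *m Gm s = 0.
  apply/matrixP => i j.
  have Dij := D (i, j) sab.
  have Dc : is_derive s (1 : R) (fun r => (X r *m invmx (X r)) i j) 0.
    apply: near_eq_is_derive (is_derive_cst ((1%:M : 'M[R]_n) i j) s (1 : R)).
    near=> r.
    have : r \in `]a, b[ by near: r; exact: near_in_itvoo.
    rewrite in_itv /= => /andP[/ltW ar /ltW rb]; rewrite mulmxV //.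
    by apply: uX; rewrite ar.
  have /= := @derive_val _ _ _ _ _ _ _ Dij.
  have /= := @derive_val _ _ _ _ _ _ _ Dc.
  by move=> -> <-; rewrite mxE.
apply/eqP; rewrite eq_sym -addr_eq0 addrC; apply/eqP.
have := congr1 (mulmx (invmx (X s))) e0.
by rewrite mulmxDr mulmx0 mulmxA mulKmx // uX.
Unshelve. all: by end_near. Qed.

(** * Lebesgue spaces of matrix functions *)

Lemma measurable_fun_ext (R : realType) (D : set R) (f g : R -> R) :
  (forall s, f s = g s) -> measurable_fun D g -> measurable_fun D f.
Proof. by move=> /funext ->. Qed.

Lemma measurable_funV (R : realType) (D : set R) (f : R -> R) :
  measurable_fun D f -> measurable_fun D (fun s => (f s)^-1).
Proof.
move=> mf.
(* The real power with exponent [-1] is inversion on nonnegative numbers, hence the square; where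
   [f] vanishes both sides are [0] by the convention [0^-1 = 0]. *)
have -> : (fun s => (f s)^-1) = (fun s => f s * ((f s ^+ 2) `^ (- 1))).
  apply/funext => s; rewrite powR_inv1 ?sqr_ge0 //.
  have [->|f0] := eqVneq (f s) 0; first by rewrite invr0 mul0r.
  by rewrite expr2 invfM mulrA mulfV // mul1r.
apply: measurable_funM => //.
apply: (@measurableT_comp _ _ _ _ _ _ (fun x : R => x `^ (- 1)) _ (fun s => f s ^+ 2)).
  exact: measurable_powR.
exact: measurable_funX.
Qed.

Lemma measurable_fun_bigsum (R : realType) (D : set R) (I : Type) (r : seq I)
    (f : I -> R -> R) :
  (forall i, measurable_fun D (f i)) ->
  measurable_fun D (fun s => \sum_(i <- r) f i s).
Proof.
move=> H; elim: r => [|i r IH].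
  by under eq_fun do rewrite big_nil; exact: measurable_cst.
by under eq_fun do rewrite big_cons; exact: measurable_funD.
Qed.

Lemma measurable_fun_bigprod (R : realType) (D : set R) (I : Type) (r : seq I)
    (f : I -> R -> R) :
  (forall i, measurable_fun D (f i)) ->
  measurable_fun D (fun s => \prod_(i <- r) f i s).
Proof.
move=> H; elim: r => [|i r IH].
  by under eq_fun do rewrite big_nil; exact: measurable_cst.
by under eq_fun do rewrite big_cons; exact: measurable_funM.
Qed.

Lemma measurable_det (R : realType) (D : set R) (n : nat) (M : R -> 'M[R]_n) :
  (forall i j, measurable_fun D (fun s => M s i j)) ->
  measurable_fun D (fun s => \det (M s)).
Proof.
move=> H; apply: measurable_fun_bigsum => s; apply: measurable_funM.
  exact: measurable_cst.
by apply: measurable_fun_bigprod => i; exact: H.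
Qed.

(* [invmx M] is [M] itself when [M] is singular; with [0^-1 = 0], the factor
   [1 - d * d^-1] is the indicator of [d = 0]. *)
Lemma measurable_invmx (R : realType) (D : set R) (n : nat) (M : R -> 'M[R]_n) :
  (forall i j, measurable_fun D (fun s => M s i j)) ->
  forall i j, measurable_fun D (fun s => invmx (M s) i j).
Proof.
move=> H i j; have mdet := measurable_det H.
have -> : (fun s => invmx (M s) i j) = (fun s => (\det (M s))^-1 * cofactor (M s) j i
    + (1 - \det (M s) * (\det (M s))^-1) * M s i j).
  apply/funext => s; rewrite /invmx unitmxE unitfE.
  have [->|d0] := eqVneq (\det (M s)) 0.
    by rewrite /= invr0 mul0r mul0r add0r subr0 mul1r.
  by rewrite /= mulfV // subrr mul0r addr0 !mxE.
apply: measurable_funD; apply: measurable_funM.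
- exact: measurable_funV.
- apply: measurable_funM; first exact: measurable_cst.
  by apply: measurable_det => k l; under eq_fun do rewrite !mxE; exact: H.
- apply: measurable_funB; first exact: measurable_cst.
  by apply: measurable_funM => //; exact: measurable_funV.
- exact: H.
Qed.

Lemma L1mxS (R : realType) (p q : nat) (a b a' b' : R) (F : R -> 'M[R]_(p, q)) :
  a <= a' -> b' <= b -> L1mx a b F -> L1mx a' b' F.
Proof.
move=> aa bb H i j.
exact: (integrable_on_subitv (f := fun s => F s i j) aa bb (H i j)).
Qed.

Lemma subset_itv_cc (R : realType) (a b a' b' : R) :
  a <= a' -> b' <= b -> (`[a', b']%classic : set R) `<=` `[a, b]%classic.
Proof.
by move=> aa bb x /=; rewrite !in_itv /= => /andP[? ?]; apply/andP; split; lra.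
Qed.

Lemma L2mxS (R : realType) (p q : nat) (a b a' b' : R) (F : R -> 'M[R]_(p, q)) :
  a <= a' -> b' <= b -> L2mx a b F -> L2mx a' b' F.
Proof.
move=> aa bb H i j; have [mF iF] := H i j; split.
  by apply: measurable_funS mF; [exact: measurable_itv|exact: subset_itv_cc].
exact: (integrable_on_subitv (f := fun s => F s i j ^+ 2) aa bb iF).
Qed.

Lemma LoomxS (R : realType) (p q : nat) (a b a' b' : R) (F : R -> 'M[R]_(p, q)) :
  a <= a' -> b' <= b -> Loomx a b F -> Loomx a' b' F.
Proof.
move=> aa bb H i j; have [mF [M HM]] := H i j; split.
  by apply: measurable_funS mF; [exact: measurable_itv|exact: subset_itv_cc].
exists M; apply: ae_imply HM => s h sab; apply: h.
exact: (subset_itv_cc aa bb sab).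
Qed.

Lemma mx_ac_derive_Loomx (R : realType) (p q : nat) (a b : R) (X F : R -> 'M[R]_(p, q)) :
  mx_ac_derive a b X F -> Loomx a b X.
Proof.
move=> H i j; have [ac _] := H i j; split.
  exact: within_continuous_measurable (abs_continuous_within ac).
have [M _ HM] := abs_continuous_bounded ac; exists M.
by apply: aeW => s; rewrite in_itv /=; exact: HM.
Qed.

Lemma L1mxD (R : realType) (p q : nat) (a b : R) (F G : R -> 'M[R]_(p, q)) :
  L1mx a b F -> L1mx a b G -> L1mx a b (fun s => F s + G s).
Proof.
move=> HF HG i j.
apply: integrable_on_eq (integrable_onD (HF i j) (HG i j)) => s _.
by rewrite mxE.
Qed.

Lemma L1mxN (R : realType) (p q : nat) (a b : R) (F : R -> 'M[R]_(p, q)) :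
  L1mx a b F -> L1mx a b (fun s => - F s).
Proof.
move=> HF i j.
apply: integrable_on_eq (integrable_onZ (-1) (HF i j)) => s _.
by rewrite mxE mulN1r.
Qed.

Lemma L1mxT (R : realType) (p q : nat) (a b : R) (F : R -> 'M[R]_(p, q)) :
  L1mx a b F -> L1mx a b (fun s => (F s)^T).
Proof.
by move=> HF i j; apply: integrable_on_eq (HF j i) => s _; rewrite mxE.
Qed.

Lemma L2mxT (R : realType) (p q : nat) (a b : R) (F : R -> 'M[R]_(p, q)) :
  L2mx a b F -> L2mx a b (fun s => (F s)^T).
Proof.
move=> HF i j; have [mF iF] := HF j i; split.
  by apply: measurable_fun_ext mF => s; rewrite mxE.
by apply: integrable_on_eq iF => s _; rewrite mxE.
Qed.

Lemma LoomxT (R : realType) (p q : nat) (a b : R) (F : R -> 'M[R]_(p, q)) :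
  Loomx a b F -> Loomx a b (fun s => (F s)^T).
Proof.
move=> HF i j; have [mF [M HM]] := HF j i; split.
  by apply: measurable_fun_ext mF => s; rewrite mxE.
by exists M; apply: ae_imply HM => s; rewrite mxE.
Qed.

Lemma L1mx_Loomx_mul (R : realType) (p q r : nat) (a b : R) (F : R -> 'M[R]_(p, q))
    (G : R -> 'M[R]_(q, r)) :
  L1mx a b F -> Loomx a b G -> L1mx a b (fun s => F s *m G s).
Proof.
move=> HF HG i j.
apply: (@integrable_on_eq _ _ _ _ (fun s => \sum_k F s i k * G s k j)).
  by move=> s _; rewrite mxE.
apply: integrable_on_sum => k _; have [mG bG] := HG k j.
exact: integrable_onM_bounded (HF i k) mG bG.
Qed.

Lemma Loomx_L1mx_mul (R : realType) (p q r : nat) (a b : R) (F : R -> 'M[R]_(p, q))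
    (G : R -> 'M[R]_(q, r)) :
  Loomx a b F -> L1mx a b G -> L1mx a b (fun s => F s *m G s).
Proof.
move=> HF HG.
have := L1mxT (L1mx_Loomx_mul (L1mxT HG) (LoomxT HF)).
move=> H i j; apply: integrable_on_eq (H i j) => s _.
by rewrite trmx_mul !trmxK.
Qed.

Lemma L2mx_mul (R : realType) (p q r : nat) (a b : R) (F : R -> 'M[R]_(p, q))
    (G : R -> 'M[R]_(q, r)) :
  L2mx a b F -> L2mx a b G -> L1mx a b (fun s => F s *m G s).
Proof.
move=> HF HG i j.
apply: (@integrable_on_eq _ _ _ _ (fun s => \sum_k F s i k * G s k j)).
  by move=> s _; rewrite mxE.
apply: integrable_on_sum => k _; have [mG bG] := HG k j; have [mF bF] := HF i k.
exact: integrable_onM_sqr.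
Qed.

Lemma L2mxD (R : realType) (p q : nat) (a b : R) (F G : R -> 'M[R]_(p, q)) :
  L2mx a b F -> L2mx a b G -> L2mx a b (fun s => F s + G s).
Proof.
move=> HF HG i j; have [mF iF] := HF i j; have [mG iG] := HG i j; split.
  by apply: measurable_fun_ext (measurable_funD mF mG) => s; rewrite mxE.
apply: (@integrable_on_eq _ _ _ _ (fun s => F s i j ^+ 2 + 2 * (F s i j * G s i j) + G s i j ^+ 2)).
  by move=> s _; rewrite mxE; ring.
apply: integrable_onD => //; apply: integrable_onD => //; apply: integrable_onZ.
exact: integrable_onM_sqr.
Qed.

Lemma L2mxN (R : realType) (p q : nat) (a b : R) (F : R -> 'M[R]_(p, q)) :
  L2mx a b F -> L2mx a b (fun s => - F s).
Proof.
move=> HF i j; have [mF iF] := HF i j; split.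
  by apply: measurable_fun_ext (measurable_funN mF) => s; rewrite mxE.
by apply: integrable_on_eq iF => s _; rewrite mxE sqrrN.
Qed.

Lemma Loomx_L2mx_mul (R : realType) (p q r : nat) (a b : R) (F : R -> 'M[R]_(p, q))
    (G : R -> 'M[R]_(q, r)) :
  Loomx a b F -> L2mx a b G -> L2mx a b (fun s => F s *m G s).
Proof.
move=> HF HG i j.
have mFG : measurable_fun `[a, b] (fun s => (F s *m G s) i j).
  apply: (@measurable_fun_ext _ _ _ (fun s => \sum_k F s i k * G s k j)).
    by move=> s; rewrite mxE.
  apply: measurable_fun_bigsum => k; apply: measurable_funM.
    by case: (HF i k).
  by case: (HG k j).
split=> //.
have sumL2 (I : Type) (l : seq I) (h : I -> R -> R) :
   (forall k, measurable_fun `[a, b] (h k) /\ integrable_on a b (fun s => h k s ^+ 2)) ->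
   integrable_on a b (fun s => (\sum_(k <- l) h k s) ^+ 2).
  move=> hh; elim: l => [|k l IH].
    apply: integrable_on_eq (integrable_on_cst a b 0) => s _.
    by rewrite big_nil expr2 mul0r.
  have [mh ih] := hh k.
  have ms : measurable_fun `[a, b] (fun s => \sum_(k <- l) h k s).
    by apply: measurable_fun_bigsum => k'; case: (hh k').
  apply: (@integrable_on_eq _ _ _ _ (fun s => h k s ^+ 2 + 2 * (h k s * \sum_(k <- l) h k s) + (\sum_(k <- l) h k s) ^+ 2)).
    by move=> s _; rewrite big_cons; ring.
  apply: integrable_onD => //; apply: integrable_onD => //; apply: integrable_onZ.
  exact: integrable_onM_sqr.
apply: (@integrable_on_eq _ _ _ _ (fun s => (\sum_k F s i k * G s k j) ^+ 2)).
  by move=> s _; rewrite mxE.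
apply: sumL2 => k; have [mF [M HM]] := HF i k; have [mG iG] := HG k j.
split; first exact: measurable_funM.
apply: (@integrable_on_eq _ _ _ _ (fun s => G s k j ^+ 2 * F s i k ^+ 2)).
  by move=> s _; rewrite exprMn mulrC.
apply: integrable_onM_bounded => //; first exact: measurable_funX.
exists (M ^+ 2); apply: ae_imply HM => s h sab; rewrite normrX ler_sqr ?nnegrE //.
  exact: h.
exact: le_trans (normr_ge0 _) (h sab).
Qed.

Lemma mx_ac_derive_integral (R : realType) (p q : nat) (a b : R) (F : R -> 'M[R]_(p, q)) :
  L1mx a b F ->
  mx_ac_derive a b (fun s => \matrix_(i, j) \int[@lebesgue_measure R]_(x in `[a, s]) F x i j) F.
Proof.
move=> HF i j; apply: ac_derive_congr (ac_derive_integral (HF i j)); last exact: aeW.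
by move=> s _; rewrite mxE.
Qed.

Lemma mx_ac_derive_extend (R : realType) (p q : nat) (a b : R) (X F : R -> 'M[R]_(p, q)) :
  (forall c, a <= c -> c < b -> mx_ac_derive a c X F) -> L1mx a b F ->
  exists2 X', mx_ac_derive a b X' F & forall s, a <= s -> s < b -> X' s = X s.
Proof.
move=> H HF.
have /choice [f Hf] (ij : 'I_p * 'I_q) : exists f', ac_derive a b f' (fun s => F s ij.1 ij.2) /\
    forall s, a <= s -> s < b -> f' s = X s ij.1 ij.2.
  have [f' H1 H2] := ac_derive_extend (fun c ac cb => H c ac cb ij.1 ij.2) (HF ij.1 ij.2).
  by exists f'.
exists (fun s => \matrix_(i, j) f (i, j) s).
  move=> i j; have [h _] := Hf (i, j); apply: ac_derive_congr h; last exact: aeW.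
  by move=> s _; rewrite mxE.
move=> s as_ sb; apply/matrixP => i j; rewrite mxE.
by have [_ ->] := Hf (i, j).
Qed.

(** * Quadratic forms and linear differential equations *)

Lemma inner_ge0 (R : realType) (n : nat) (u : 'cV[R]_n) : 0 <= inner_cv u u.
Proof. by rewrite inner_cvE; apply: sumr_ge0 => i _; rewrite -expr2 sqr_ge0. Qed.

Lemma inner_eq0 (R : realType) (n : nat) (u : 'cV[R]_n) : inner_cv u u <= 0 -> u = 0.
Proof.
rewrite inner_cvE => h.
have /eqP : \sum_i u i ord0 * u i ord0 = 0.
  apply/eqP; rewrite eq_le h; apply: sumr_ge0 => i _.
  by rewrite -expr2 sqr_ge0.
rewrite psumr_eq0; last by move=> i _; rewrite -expr2 sqr_ge0.
move=> /allP H; apply/colP => i; have := H i (mem_index_enum _).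
by rewrite /= mulf_eq0 orbb mxE => /eqP.
Qed.

(** A crude operator norm: its integrability follows entry by entry, and it bounds bilinear forms
    well enough for Gronwall. *)
Definition mxsum (R : realType) (p q : nat) (M : 'M[R]_(p, q)) : R :=
  \sum_i \sum_j `|M i j|.

Lemma mxsum_ge0 (R : realType) (p q : nat) (M : 'M[R]_(p, q)) : 0 <= mxsum M.
Proof. by do 2 apply: sumr_ge0 => ? _. Qed.

Lemma coord_sqr_le (R : realType) (n : nat) (u : 'cV[R]_n) i :
  u i ord0 ^+ 2 <= inner_cv u u.
Proof.
rewrite inner_cvE (bigD1 i) //= expr2 lerDl; apply: sumr_ge0 => j _.
by rewrite -expr2 sqr_ge0.
Qed.

(** For each entry, [2 |z_j| |w_i| <= z_j^2 + w_i^2 <= |z|^2 + |w|^2]. *)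
Lemma inner_mul_le (R : realType) (p q : nat) (M : 'M[R]_(p, q)) (z : 'cV[R]_q)
    (w : 'cV[R]_p) :
  2 * `|inner_cv (M *m z) w| <= mxsum M * (inner_cv z z + inner_cv w w).
Proof.
rewrite inner_cvE /mxsum.
apply: (@le_trans _ _ (2 * \sum_i \sum_j `|M i j| * (`|z j ord0| * `|w i ord0|))).
  rewrite ler_pM2l //; apply: le_trans (ler_norm_sum _ _ _) _.
  apply: ler_sum => i _; rewrite mxE mulr_suml.
  apply: le_trans (ler_norm_sum _ _ _) _; apply: ler_sum => j _.
  by rewrite !normrM mulrA.
rewrite mulr_sumr mulr_suml; apply: ler_sum => i _.
rewrite mulr_sumr mulr_suml; apply: ler_sum => j _.
rewrite mulrCA; apply: ler_wpM2l => //.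
have := coord_sqr_le z j; have := coord_sqr_le w i.
rewrite -(real_normK (num_real (z j ord0))) -(real_normK (num_real (w i ord0))).
have := sqr_ge0 (`|z j ord0| - `|w i ord0|); nra.
Qed.

Lemma integrable_on_mxsum (R : realType) (p q : nat) (a b : R) (F : R -> 'M[R]_(p, q)) :
  L1mx a b F -> integrable_on a b (fun s => mxsum (F s)).
Proof.
move=> HF; apply: integrable_on_sum => i _; apply: integrable_on_sum => j _.
by apply: integrable_on_norm; exact: HF.
Qed.

Lemma innerC (R : realType) (n : nat) (u v : 'cV[R]_n) : inner_cv u v = inner_cv v u.
Proof. by rewrite !inner_cvE; apply: eq_bigr => i _; rewrite mulrC. Qed.

Lemma innerDl (R : realType) (n : nat) (u v w : 'cV[R]_n) :
  inner_cv (u + v) w = inner_cv u w + inner_cv v w.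
Proof. by rewrite /inner_cv linearD /= mulmxDl mxE. Qed.

Lemma innerDr (R : realType) (n : nat) (u v w : 'cV[R]_n) :
  inner_cv w (u + v) = inner_cv w u + inner_cv w v.
Proof. by rewrite innerC innerDl !(innerC w). Qed.

Lemma innerNl (R : realType) (n : nat) (u v : 'cV[R]_n) :
  inner_cv (- u) v = - inner_cv u v.
Proof. by rewrite /inner_cv linearN /= mulNmx mxE. Qed.

Lemma innerNr (R : realType) (n : nat) (u v : 'cV[R]_n) :
  inner_cv u (- v) = - inner_cv u v.
Proof. by rewrite innerC innerNl innerC. Qed.

Lemma innerZl (R : realType) (n : nat) (k : R) (u v : 'cV[R]_n) :
  inner_cv (k *: u) v = k * inner_cv u v.
Proof. by rewrite /inner_cv linearZ /= -scalemxAl mxE. Qed.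

Lemma innerZr (R : realType) (n : nat) (k : R) (u v : 'cV[R]_n) :
  inner_cv u (k *: v) = k * inner_cv u v.
Proof. by rewrite innerC innerZl innerC. Qed.

Lemma inner0l (R : realType) (n : nat) (u : 'cV[R]_n) : inner_cv 0 u = 0.
Proof. by rewrite /inner_cv trmx0 mul0mx mxE. Qed.

Lemma inner_mulmx (R : realType) (p q : nat) (M : 'M[R]_(p, q)) (u : 'cV[R]_q)
    (v : 'cV[R]_p) : inner_cv (M *m u) v = inner_cv u (M^T *m v).
Proof. by rewrite /inner_cv trmx_mul mulmxA. Qed.

Lemma inner_delta (R : realType) (n : nat) (v : 'cV[R]_n) i :
  inner_cv (delta_mx i ord0) v = v i ord0.
Proof.
rewrite inner_cvE (bigD1 i) //= big1 ?addr0; first by rewrite mxE !eqxx mul1r.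
by move=> j ji; rewrite mxE (negbTE ji) mul0r.
Qed.

Lemma inner_eq (R : realType) (n : nat) (u v : 'cV[R]_n) :
  (forall w, inner_cv w u = inner_cv w v) -> u = v.
Proof. by move=> H; apply/colP => i; rewrite -!inner_delta H. Qed.

(** Expansion of [|K u - v|^2 >= 0], divided by [K]. *)
Lemma inner_young (R : realType) (n : nat) (K : R) (u v : 'cV[R]_n) : 0 < K ->
  2 * inner_cv u v <= K * inner_cv u u + K^-1 * inner_cv v v.
Proof.
move=> K0; have := inner_ge0 (K *: u - v).
rewrite innerDl !innerDr !innerNl !innerNr !innerZl !innerZr (innerC v u) => h.
rewrite -(ler_pM2l K0) mulrDr (mulrA K K^-1) mulfV ?gt_eqF // mul1r; lra.
Qed.

Lemma mulmx_cV_eq0 (R : realType) (p q : nat) (M : 'M[R]_(p, q)) :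
  (forall v : 'cV[R]_q, M *m v = 0) -> M = 0.
Proof.
move=> H; apply/matrixP => i j; have := H (delta_mx j ord0).
by rewrite -colE => /colP/(_ i); rewrite !mxE.
Qed.

Lemma unitmx_of_inj (R : realType) (n : nat) (M : 'M[R]_n) :
  (forall v : 'cV[R]_n, M *m v = 0 -> v = 0) -> M \in unitmx.
Proof.
move=> H; rewrite -unitmx_tr -row_free_unit -kermx_eq0; apply/eqP/row_matrixP => i.
rewrite row0; apply: trmx_inj; rewrite trmx0; apply: H.
apply: trmx_inj; rewrite trmx_mul trmxK trmx0.
by apply/sub_kermxP; exact: row_sub.
Qed.

Definition coercive (R : realType) (n : nat) (d : R) (M : 'M[R]_n) : Prop :=
  forall v : 'cV[R]_n, d * inner_cv v v <= inner_cv (M *m v) v.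

Lemma coercive_unit (R : realType) (n : nat) (d : R) (M : 'M[R]_n) :
  0 < d -> coercive d M -> M \in unitmx.
Proof.
move=> d0 H; apply: unitmx_of_inj => v Mv; apply: inner_eq0.
by have := H v; rewrite Mv inner0l pmulr_rle0.
Qed.

(** For [w = M^-1 v] coercivity gives [d |w|^2 <= <v, w>]; Young's inequality with weight [1 / d]
    bounds [2 <v, w>] by [|v|^2 / d + d |w|^2], and the last term is absorbed. *)
Lemma coercive_inv_le (R : realType) (n : nat) (d : R) (M : 'M[R]_n) (v : 'cV[R]_n) :
  0 < d -> coercive d M ->
  inner_cv (invmx M *m v) (invmx M *m v) <= d ^- 2 * inner_cv v v.
Proof.
move=> d0 H; have uM := coercive_unit d0 H.
have := H (invmx M *m v); rewrite mulKVmx //.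
have d0' : 0 < d^-1 by rewrite invr_gt0.
have := inner_young v (invmx M *m v) d0'; rewrite invrK => h1 h2.
have h3 : d * inner_cv (invmx M *m v) (invmx M *m v) <= d^-1 * inner_cv v v by lra.
by rewrite -(ler_pM2l d0) mulrA expr2 invfM mulrA mulfV ?gt_eqF // mul1r.
Qed.

Lemma coercive_inv_coord (R : realType) (n : nat) (d : R) (M : 'M[R]_n) i j :
  0 < d -> coercive d M -> `|invmx M i j| <= d^-1.
Proof.
move=> d0 H; have := coercive_inv_le (delta_mx j ord0) d0 H.
rewrite inner_delta mxE !eqxx mulr1 => h.
have h1 : invmx M i j ^+ 2 <= d^-1 ^+ 2.
  rewrite exprVn; apply: le_trans h; apply: le_trans (coord_sqr_le _ i).
  by rewrite -colE mxE.
by rewrite -ler_sqr ?nnegrE ?invr_ge0 ?(ltW d0) // real_normK ?num_real.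
Qed.

Lemma psdmx_coercive (R : realType) (n : nat) (d : R) (M : 'M[R]_n) :
  psdmx (M - d%:M) -> M^T = M /\ coercive d M.
Proof.
move=> [sM H]; split.
  move: sM; rewrite linearB /= tr_scalar_mx => h.
  by have := congr1 (fun N => N + d%:M) h; rewrite !subrK.
move=> v; have := H v; rewrite mulmxBl mul_scalar_mx innerDl innerNl innerZl.
by rewrite subr_ge0.
Qed.

Lemma pdmx_unit (R : realType) (n : nat) (M : 'M[R]_n) : pdmx M -> M \in unitmx.
Proof.
move=> [_ H]; apply: unitmx_of_inj => v Mv; apply/eqP; apply: contraT => v0.
by have := H v v0; rewrite Mv inner0l ltxx.
Qed.

Lemma continuous_bigsum (R : realType) (V : topologicalType) (I : Type) (r : seq I)
    (f : I -> V -> R) :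
  (forall i, continuous (f i)) -> continuous (fun v => \sum_(i <- r) f i v).
Proof.
move=> H; elim: r => [|i r IH] v.
  by under eq_fun do rewrite big_nil; exact: cvg_cst.
by under eq_fun do rewrite big_cons; apply: cvgD; [exact: H|exact: IH].
Qed.

Lemma inner_continuous (R : realType) (n : nat) (M : 'M[R]_n) :
  continuous (fun v : 'rV[R]_n => inner_cv (M *m v^T) v^T).
Proof.
have -> : (fun v : 'rV[R]_n => inner_cv (M *m v^T) v^T) =
    (fun v => \sum_i (\sum_j M i j * v ord0 j) * v ord0 i).
  apply/funext => v; rewrite inner_cvE; apply: eq_bigr => i _; rewrite !mxE.
  by congr (_ * _); apply: eq_bigr => j _; rewrite mxE.
apply: continuous_bigsum => i v.
have h1 : {for v, continuous (fun w : 'rV[R]_n => \sum_j M i j * w ord0 j)}.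
  apply: (@continuous_bigsum _ _ _ _ (fun j (w : 'rV[R]_n) => M i j * w ord0 j)) => j w.
  have hc : {for w, continuous (fun _ : 'rV[R]_n => M i j)} by exact: cst_continuous.
  exact: (continuousM hc (@coord_continuous _ _ _ ord0 j w)).
exact: (continuousM h1 (@coord_continuous _ _ _ ord0 i v)).
Qed.

Lemma inner_normalize (R : realType) (n : nat) (v : 'cV[R]_n) : v != 0 ->
  exists2 k : R, 0 < k & inner_cv (k *: v) (k *: v) = 1.
Proof.
move=> v0; have iv : 0 < inner_cv v v.
  rewrite lt_neqAle inner_ge0 andbT eq_sym; apply: contra v0 => /eqP h.
  by apply/eqP; apply: inner_eq0; rewrite h.
exists (Num.sqrt (inner_cv v v))^-1; first by rewrite invr_gt0 sqrtr_gt0.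
rewrite innerZl innerZr mulrA -invfM -expr2 sqr_sqrtr ?inner_ge0 //.
by rewrite mulVf // gt_eqF.
Qed.

(* A minimizer of the Rayleigh quotient on the unit sphere is an eigenvector. *)
Lemma min_spectrum_coercive (R : realType) (n : nat) (K : R) (M : 'M[R]_n) :
  M^T = M -> (K%:E <= min_spectrum M)%E -> coercive K M.
Proof.
move=> sM hK v; have [->|v0] := eqVneq v 0.
  by rewrite mulmx0 !inner0l mulr0.
pose S : set 'rV[R]_n := [set w | inner_cv w^T w^T = 1].
have E1 (w : 'rV[R]_n) : inner_cv w^T w^T = inner_cv (1%:M *m w^T) w^T by rewrite mul1mx.
have S0 : S !=set0.
  by have [k _ kv] := inner_normalize v0; exists (k *: v)^T; rewrite /S /= trmxK.
have cS : closed S.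
  have -> : S = (fun w : 'rV[R]_n => inner_cv (1%:M *m w^T) w^T) @^-1` [set 1].
    by apply/seteqP; split=> w; rewrite /S /= mul1mx.
  apply: closed_comp; last exact: closed_eq.
  by move=> w _; exact: inner_continuous.
have bS : bounded_set S.
  exists 1; split; first exact: num_real.
  move=> r r1 w /= Sw; apply: ltW; apply: le_lt_trans r1.
  rewrite /Num.Def.normr /= mx_normrE; apply: bigmax_le => // -[i j] _ /=.
  rewrite ord1; have := coord_sqr_le w^T j; rewrite Sw mxE => h.
  by rewrite -(@ler_sqr _ _ 1) ?nnegrE // real_normK ?num_real // expr1n.
have cpS := bounded_closed_compact bS cS.
have contf : {within S, continuous (fun w : 'rV[R]_n => inner_cv (M *m w^T) w^T)}.
  by apply: continuous_subspaceT; exact: inner_continuous.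
have [c cin cmin] := EVT_min_rV S0 cpS contf.
set mu := inner_cv (M *m c^T) c^T in cmin.
have Sc : inner_cv c^T c^T = 1 by move: cin; rewrite inE.
have mumin (w : 'cV[R]_n) : mu * inner_cv w w <= inner_cv (M *m w) w.
  have [->|w0] := eqVneq w 0; first by rewrite mulmx0 !inner0l mulr0.
  have [k k0 kw] := inner_normalize w0.
  have := cmin (k *: w)^T; rewrite inE /S /= trmxK => /(_ kw).
  rewrite -scalemxAr innerZl innerZr => h.
  move: kw; rewrite innerZl innerZr => kw.
  have k2 : 0 < k * k by rewrite mulr_gt0.
  by rewrite -(ler_pM2l k2) mulrCA -mulrA kw mulr1 -mulrA.
have eig : M *m c^T = mu *: c^T.
  pose N := M - mu%:M.
  have Npsd w : 0 <= inner_cv (N *m w) w.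
    by rewrite mulmxBl mul_scalar_mx innerDl innerNl innerZl subr_ge0.
  have Nc : inner_cv (N *m c^T) c^T = 0.
    by rewrite mulmxBl mul_scalar_mx innerDl innerNl innerZl Sc mulr1 subrr.
  have sN : N^T = N by rewrite linearB /= tr_scalar_mx sM.
  suff : N *m c^T = 0.
    by rewrite mulmxBl mul_scalar_mx => /eqP; rewrite subr_eq0 => /eqP.
  apply: inner_eq0; rewrite leNgt; apply/negP => pos.
  set w := N *m c^T in pos *; set a := inner_cv w w in pos.
  set b := inner_cv (N *m w) w.
  have b0 : 0 <= b by exact: Npsd.
  (* A vector on which a nonnegative form vanishes lies in the kernel: moving [c] by [- e w] gives
     the form the value [- 2 e a + e^2 b], which is negative because [e b < a]. *)
  pose e := a / (b + 1).
  have b1 : 0 < b + 1 by lra.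
  have e0 : 0 < e by rewrite divr_gt0.
  have := Npsd (c^T - e *: w).
  rewrite mulmxDr mulmxN -scalemxAr -/w !innerDl !innerDr !innerNl !innerNr.
  rewrite !innerZl !innerZr -/b -/a Nc.
  have -> : inner_cv (N *m w) c^T = a by rewrite inner_mulmx sN.
  have eb : e * b < a by rewrite /e mulrAC ltr_pdivrMr // mulrDr mulr1 ltrDl.
  have : e * (e * b) < e * a by rewrite ltr_pM2l.
  have : 0 < e * a by rewrite mulr_gt0.
  lra.
have muK : K <= mu.
  have : (min_spectrum M <= mu%:E)%E.
    apply: ereal_inf_lbound; exists mu => //; apply/eigenvalueP.
    exists c.
      apply: trmx_inj; rewrite trmx_mul sM eig linearZ //.
    by apply/eqP => c0; move: Sc; rewrite c0 trmx0 inner0l => /eqP; rewrite eq_sym oner_eq0.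
  by move=> h; rewrite -lee_fin; exact: le_trans hK h.
by apply: le_trans (mumin v); apply: ler_wpM2r => //; exact: inner_ge0.
Qed.

Lemma Loomx_invmx (R : realType) (n : nat) (a b d : R) (M : R -> 'M[R]_n) :
  0 < d -> Loomx a b M ->
  (\forall s \ae (@lebesgue_measure R), s \in `[a, b] -> psdmx (M s - d%:M)) ->
  Loomx a b (fun s => invmx (M s)).
Proof.
move=> d0 HM Hd i j; split.
  by apply: measurable_invmx => k l; case: (HM k l).
exists d^-1; apply: ae_imply Hd => s H sab.
by have [_ co] := psdmx_coercive (H sab); exact: coercive_inv_coord.
Qed.

Lemma L1_inner (R : realType) (n : nat) (a b : R) (F G : R -> 'cV[R]_n) :
  L1mx a b F -> Loomx a b G -> integrable_on a b (fun s => inner_cv (F s) (G s)).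
Proof. by move=> HF HG; exact: (L1mx_Loomx_mul (L1mxT HF) HG). Qed.

Lemma L2_inner (R : realType) (n : nat) (a b : R) (F G : R -> 'cV[R]_n) :
  L2mx a b F -> L2mx a b G -> integrable_on a b (fun s => inner_cv (F s) (G s)).
Proof. by move=> HF HG; exact: (L2mx_mul (L2mxT HF) HG). Qed.

(** The constant depends on the majorant [alpha] alone, not on [M] or on the subinterval. This
    uniformity matters near [t], where the coefficient contains the inverse of [Pi] and is
    considered on intervals whose left end approaches [t]. *)
Lemma linear_ode_bound_majorant (R : realType) (n : nat) (a0 b0 : R) (alpha : R -> R) :
  integrable_on a0 b0 alpha -> (forall s, 0 <= alpha s) ->
  exists2 C : R, 0 < C & forall (a b : R) (M : R -> 'M[R]_n) (z : R -> 'cV[R]_n),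
    a0 <= a -> a <= b -> b <= b0 ->
    (forall s, a <= s <= b -> mxsum (M s) <= alpha s) ->
    mx_ac_derive a b z (fun s => M s *m z s) ->
    inner_cv (z b) (z b) <= C * inner_cv (z a) (z a) /\
    inner_cv (z a) (z a) <= C * inner_cv (z b) (z b).
Proof.
move=> ia alpha0; pose al s := 2 * alpha s.
have al0 s : 0 <= al s by rewrite mulr_ge0.
have ial : integrable_on a0 b0 al by exact: integrable_onZ.
exists (expR (\int[@lebesgue_measure R]_(s in `[a0, b0]) al s)); first exact: expR_gt0.
move=> a b M z aa ab bb HM Hz.
have ial' := integrable_on_subitv aa bb ial.
have HE := ac_derive_inner Hz Hz.
have le_exp : expR (\int[@lebesgue_measure R]_(s in `[a, b]) al s) <=
    expR (\int[@lebesgue_measure R]_(s in `[a0, b0]) al s).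
  by rewrite ler_expR; exact: Rint_subitv.
have bound s : s \in `]a, b[ ->
    `|inner_cv (M s *m z s) (z s) + inner_cv (z s) (M s *m z s)|
    <= al s * inner_cv (z s) (z s).
  rewrite in_itv /= => /andP[/ltW as_ /ltW sb].
  rewrite (innerC (z s) (M s *m z s)) -mulr2n -mulr_natl normrM ger0_norm //.
  apply: le_trans (inner_mul_le _ _ _) _.
  rewrite /al -mulr2n -(mulr_natl (inner_cv _ _)) mulrCA mulrA.
  apply: ler_wpM2r; first exact: inner_ge0.
  by rewrite ler_pM2l // HM // as_.
have ae1 : \forall s \ae (@lebesgue_measure R), s \in `]a, b[ ->
   inner_cv (M s *m z s) (z s) + inner_cv (z s) (M s *m z s) <=
   al s * inner_cv (z s) (z s) + cst 0 s.
  by apply: aeW => s sab /=; rewrite addr0; exact: le_trans (ler_norm _) (bound s sab).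
have ae2 : \forall s \ae (@lebesgue_measure R), s \in `]a, b[ ->
   - (al s * inner_cv (z s) (z s)) <=
   inner_cv (M s *m z s) (z s) + inner_cv (z s) (M s *m z s).
  by apply: aeW => s sab /=; have := bound s sab; rewrite ler_norml => /andP[].
split.
  have := gronwall ab HE (fun s _ => inner_ge0 (z s)) ial' (integrable_on_cst a b 0)
    al0 (fun s => lexx 0) ae1.
  rewrite Rintegral_cst ?mul0r ?addr0; last exact: measurable_itv.
  by move=> h; apply: le_trans h _; apply: ler_wpM2r => //; exact: inner_ge0.
have := gronwall_backward ab HE ial' ae2 => h.
by apply: le_trans h _; apply: ler_wpM2r => //; exact: inner_ge0.
Qed.

Lemma linear_ode_bound (R : realType) (n : nat) (a0 b0 : R) (M : R -> 'M[R]_n) :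
  L1mx a0 b0 M -> exists2 C : R, 0 < C & forall (a b : R) (z : R -> 'cV[R]_n),
    a0 <= a -> a <= b -> b <= b0 -> mx_ac_derive a b z (fun s => M s *m z s) ->
    inner_cv (z b) (z b) <= C * inner_cv (z a) (z a) /\
    inner_cv (z a) (z a) <= C * inner_cv (z b) (z b).
Proof.
move=> HM; have [C C0 H] := linear_ode_bound_majorant n (integrable_on_mxsum HM)
  (fun s => mxsum_ge0 (M s)).
by exists C => // a b z ? ? ? Hz; apply: H Hz.
Qed.

Lemma within_continuous_epsilon (R : realType) (D : set R) (f : R -> R) :
  (forall x, D x -> forall e : R, 0 < e -> exists2 d : R, 0 < d &
     forall y, D y -> `|x - y| < d -> `|f x - f y| < e) ->
  {within D, continuous f}.
Proof.
move=> H; apply/subspace_continuousP => x Dx.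
apply/cvgrPdist_lt => e e0; have [d d0 Hd] := H x Dx e e0.
by rewrite near_withinE; apply/nbhs_ballP; exists d => //= y xyd Dy; exact: Hd.
Qed.

(* Gronwall keeps a solution on the half-open interval bounded, hence its
   derivative integrable up to the endpoint. *)
Lemma linear_ode_extend (R : realType) (n : nat) (a b : R) (M : R -> 'M[R]_n)
    (z : R -> 'cV[R]_n) : a < b ->
  (forall c, a <= c -> c < b -> mx_ac_derive a c z (fun s => M s *m z s)) ->
  L1mx a b M ->
  exists2 z', mx_ac_derive a b z' (fun s => M s *m z' s) &
    forall s, a <= s -> s < b -> z' s = z s.
Proof.
move=> ab H HM; have [C C0 HC] := linear_ode_bound HM.
(* The hypotheses leave [z b] free; resetting it keeps the function bounded on the closed
   interval. *)
pose zz s : 'cV[R]_n := if s < b then z s else 0.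
have Lzz : Loomx a b zz.
  move=> i j; split.
    apply/measurable_fun_itv_bndo_bndcP.
    apply: (@eq_measurable_fun _ _ _ _ _ (fun s => z s i j)).
      by move=> s; rewrite inE /= in_itv /= /zz => /andP[_ ->].
    apply: subspace_continuous_measurable_fun; first exact: measurable_itv.
    apply: within_continuous_epsilon => s /=; rewrite in_itv /= => /andP[as_ sb] e e0.
    pose c := (s + b) / 2.
    have sc : s < c by rewrite /c; lra.
    have cb : c < b by rewrite /c; lra.
    have [ac _] := H c (le_trans as_ (ltW sc)) cb i j.
    have [d d0 Hd] := abs_continuous_modulus ac e0.
    exists (Num.min d (c - s)); first by rewrite lt_min d0 /=; lra.
    move=> r; rewrite in_itv /= => /andP[ar rb]; rewrite lt_min => /andP[srd src].
    apply: Hd => //; first by rewrite as_ (ltW sc).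
    rewrite ar /=; have := ler_norm (r - s); rewrite distrC; lra.
  (* Gronwall bounds squares; [|r| <= r^2 + 1] converts this into a bound on the entries. *)
  exists (C * inner_cv (z a) (z a) + 1); apply: aeW => s.
  rewrite in_itv /= => /andP[as_ _]; rewrite ord1 /zz; case: ifP => sb; last first.
    rewrite mxE normr0; apply: addr_ge0 => //; apply: mulr_ge0; first exact: ltW.
    exact: inner_ge0.
  have [h _] := HC a s z (lexx _) as_ (ltW sb) (H s as_ sb).
  have := coord_sqr_le (z s) i; rewrite -(real_normK (num_real (z s i ord0))) => h2.
  have : `|z s i ord0| <= `|z s i ord0| ^+ 2 + 1.
    have := sqr_ge0 (`|z s i ord0| - 1); have := normr_ge0 (z s i ord0); nra.
  lra.
have zzH c : a <= c -> c < b -> mx_ac_derive a c z (fun s => M s *m zz s).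
  move=> ac cb; apply: mx_ac_derive_congr (H c ac cb) => //; apply: aeW => s.
  by rewrite in_itv /= /zz => /andP[_ sc]; rewrite (lt_trans sc cb).
have [z' Hz' zz'] := mx_ac_derive_extend zzH (L1mx_Loomx_mul HM Lzz).
exists z' => //; apply: mx_ac_derive_congr Hz' => //; apply: aeW => s.
rewrite in_itv /= => /andP[as_ sb].
by rewrite /zz sb zz' // ltW.
Qed.

(** Serves the feedback control, which is determined by the data only on [[t, T[] but has to be
    square integrable on [[t, T]]. *)
Lemma L2mx_eq_right (R : realType) (p q : nat) (a b : R) (F G : R -> 'M[R]_(p, q)) :
  (forall s, a <= s -> s < b -> F s = G s) -> L2mx a b G -> L2mx a b F.
Proof.
move=> FG HG i j; have [mG iG] := HG i j.
have mF : measurable_fun `[a, b] (fun s => F s i j).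
  apply/measurable_fun_itv_bndo_bndcP.
  apply: (@eq_measurable_fun _ _ _ _ _ (fun s => G s i j)).
    by move=> s; rewrite inE /= in_itv /= => /andP[as_ sb]; rewrite FG.
  exact/measurable_fun_itv_bndo_bndcP.
split=> //.
apply: (integrable_on_le (f := fun s => F s i j ^+ 2) _ iG).
  exact: measurable_funX.
apply: ae_imply (ae_neq b) => s sb; rewrite in_itv /= => /andP[as_].
rewrite le_eqVlt => /predU1P[//|sb']; rewrite FG // ger0_norm //.
exact: sqr_ge0.
Qed.

Lemma L2mx_Loomx_mul (R : realType) (p q r : nat) (a b : R) (F : R -> 'M[R]_(p, q))
    (G : R -> 'M[R]_(q, r)) :
  L2mx a b F -> Loomx a b G -> L2mx a b (fun s => F s *m G s).
Proof.
move=> HF HG; have := L2mxT (Loomx_L2mx_mul (LoomxT HG) (L2mxT HF)).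
by under [X in L2mx _ _ X]eq_fun do rewrite trmx_mul !trmxK.
Qed.

Lemma addmxE (R : realType) (p q : nat) (M N : 'M[R]_(p, q)) i j :
  (M + N) i j = M i j + N i j.
Proof. by rewrite mxE. Qed.

Lemma oppmxE (R : realType) (p q : nat) (M : 'M[R]_(p, q)) i j :
  (- M) i j = - M i j.
Proof. by rewrite mxE. Qed.

Ltac mx_expand := rewrite ?(mulmxDl, mulmxDr, mulNmx, mulmxN, mulmxA).
Ltac mx_ring := apply/matrixP => ? ?; rewrite ?(addmxE, oppmxE); ring.

(** * The linear-quadratic problem for fixed weights *)

Section LinearQuadratic.
Variables (R : realType) (n m : nat) (T t : R).
Hypotheses (ht0 : 0 <= t) (htT : t < T).
Variables (A : R -> 'M[R]_n) (B : R -> 'M[R]_(n, m)) (Q : R -> 'M[R]_n)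
  (Rc : R -> 'M[R]_m) (delta : R).
Hypotheses (hA : L1mx 0 T A) (hB : L2mx 0 T B) (hQ : L1mx 0 T Q)
  (hR : Loomx 0 T Rc) (hdelta : 0 < delta)
  (hRd : \forall s \ae (@lebesgue_measure R),
     s \in `[0, T] -> psdmx (Rc s - delta%:M)).
Variables (P Pi Phi Psi : R -> 'M[R]_n).
Hypotheses (hP : is_P A B Q Rc T P) (hPi : is_Pi A B Q Rc t T Pi)
  (hPhi : is_Phi A B Rc T P Phi) (hPsi : is_Psi A Q T P Phi Psi).

Local Notation g := (gain B Rc).

Lemma T_gt0 : 0 < T. Proof. exact: le_lt_trans ht0 htT. Qed.

Lemma subset_co (a b c : R) : b < c ->
  ([set` `[a, b]] : set R) `<=` [set` `[a, c[].
Proof.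
move=> bc x /=; rewrite !in_itv /= => /andP[-> xb] /=; exact: le_lt_trans bc.
Qed.

Lemma gain_L1 : L1mx 0 T g.
Proof.
rewrite /gain => i j.
have h1 : L2mx 0 T (fun s => invmx (Rc s) *m (B s)^T).
  by apply: Loomx_L2mx_mul (L2mxT hB); exact: Loomx_invmx hdelta hR hRd.
apply: integrable_on_eq (L2mx_mul hB h1 i j) => s _.
by rewrite mulmxA.
Qed.

Lemma gain_sym : \forall s \ae (@lebesgue_measure R), s \in `[0, T] -> (g s)^T = g s.
Proof.
apply: ae_imply hRd => s h sT; have [sR _] := psdmx_coercive (h sT).
by rewrite /gain !trmx_mul trmxK trmx_inv sR mulmxA.
Qed.

Lemma P_ac_derive b : b < T -> mx_ac_derive 0 b P (fun s =>
  - (P s *m A s + (A s)^T *m P s + Q s - P s *m g s *m P s)).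
Proof. by move=> bT; case: hP => _ o _; exact: ode_ac_derive (subset_co bT) o. Qed.

Lemma Phi_ac_derive b : b < T -> mx_ac_derive 0 b Phi (fun s => (A s - g s *m P s) *m Phi s).
Proof. by move=> bT; case: hPhi => o _ _; exact: ode_ac_derive (subset_co bT) o. Qed.

Lemma Psi_ac_derive : mx_ac_derive 0 T Psi (fun s => - (A s)^T *m Psi s - Q s *m Phi s).
Proof. by case: hPsi => o _; exact: ode_ac_derive o. Qed.

Lemma P_sym s : 0 <= s -> s < T -> (P s)^T = P s.
Proof. by move=> s0 sT; case: hP => h _ _; have [|] := h s; rewrite // in_itv /= s0. Qed.

(** By the Riccati equation the quadratic terms cancel and [D = P Phi - Psi] solves [D' = - A^T D]
    with [D(0) = 0]. The estimate is for vector solutions, so [D] is applied to an arbitrary [v]. *)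
Lemma PPhi_Psi s : 0 <= s -> s < T -> P s *m Phi s = Psi s.
Proof.
move=> s0 sT; apply/eqP; rewrite -subr_eq0; apply/eqP; apply: mulmx_cV_eq0 => v.
have HD : mx_ac_derive 0 s (fun r => (P r *m Phi r - Psi r) *m v)
   (fun r => - (A r)^T *m ((P r *m Phi r - Psi r) *m v)).
  apply: mx_ac_derive_congr (mx_ac_deriveMr v (mx_ac_deriveB (mx_ac_deriveM (P_ac_derive sT) (Phi_ac_derive sT))
    (mx_ac_deriveS (lexx 0) (ltW sT) Psi_ac_derive))) => //.
  by apply: aeW => r _; mx_expand; mx_ring.
have [C _ HC] := linear_ode_bound (L1mxN (L1mxT (L1mxS (lexx 0) (ltW sT) hA))).
have [h _] := HC 0 s _ (lexx _) s0 (lexx _) HD.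
apply: inner_eq0; apply: le_trans h _.
case: hPhi => _ Phi0 _; case: hPsi => _ Psi0.
by rewrite Phi0 mulmx1 Psi0 subrr mul0mx inner0l mulr0.
Qed.

Lemma AgP_L1 b : 0 <= b -> b < T -> L1mx 0 b (fun s => A s - g s *m P s).
Proof.
move=> b0 bT; apply: L1mxD; first exact: L1mxS (lexx 0) (ltW bT) hA.
apply: L1mxN; apply: L1mx_Loomx_mul; first exact: L1mxS (lexx 0) (ltW bT) gain_L1.
exact: mx_ac_derive_Loomx (P_ac_derive bT).
Qed.

(** If [Phi s *m v = 0], the backward estimate gives [v = Phi 0 *m v = 0]. The coefficient is
    integrable on [[0, s]] because [s < T]. *)
Lemma Phi_unit s : 0 <= s -> s < T -> Phi s \in unitmx.
Proof.
move=> s0 sT; apply: unitmx_of_inj => v Pv.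
have [C _ HC] := linear_ode_bound (AgP_L1 s0 sT).
have HD : mx_ac_derive 0 s (fun r => Phi r *m v) (fun r => (A r - g r *m P r) *m (Phi r *m v)).
  apply: mx_ac_derive_congr (mx_ac_deriveMr v (Phi_ac_derive sT)) => //.
  by apply: aeW => r _; rewrite mulmxA.
have [_ h] := HC 0 s _ (lexx _) s0 (lexx _) HD.
apply: inner_eq0; case: hPhi => _ Phi0 _.
by move: h; rewrite Pv inner0l mulr0 Phi0 mul1mx.
Qed.

(** State and costate are stacked into one linear system without [P] in its coefficients, so that
    Gronwall reaches [T]. *)
Definition hamiltonian_mx s : 'M[R]_(n + n) := block_mx (A s) (- g s) (- Q s) (- (A s)^T).

Lemma hamiltonian_mx_L1 : L1mx 0 T hamiltonian_mx.
Proof.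
move=> i j; case: (splitP i) => k ik; case: (splitP j) => l jl.
- have -> : i = lshift n k by exact: val_inj.
  have -> : j = lshift n l by exact: val_inj.
  by apply: integrable_on_eq (hA k l) => s _; rewrite block_mxEul.
- have -> : i = lshift n k by exact: val_inj.
  have -> : j = rshift n l by exact: val_inj.
  by apply: integrable_on_eq (L1mxN gain_L1 k l) => s _; rewrite block_mxEur.
- have -> : i = rshift n k by exact: val_inj.
  have -> : j = lshift n l by exact: val_inj.
  by apply: integrable_on_eq (L1mxN hQ k l) => s _; rewrite block_mxEdl.
- have -> : i = rshift n k by exact: val_inj.
  have -> : j = rshift n l by exact: val_inj.
  by apply: integrable_on_eq (L1mxN (L1mxT hA) k l) => s _; rewrite block_mxEdr.
Qed.

Definition hamiltonian a b (X p : R -> 'cV[R]_n) : Prop :=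
  mx_ac_derive a b X (fun s => A s *m X s - g s *m p s) /\
  mx_ac_derive a b p (fun s => - (A s)^T *m p s - Q s *m X s).

Lemma hamiltonianS a b a' b' X p : a <= a' -> b' <= b ->
  hamiltonian a b X p -> hamiltonian a' b' X p.
Proof. by move=> aa bb [h1 h2]; split; [exact: mx_ac_deriveS h1|exact: mx_ac_deriveS h2]. Qed.

Lemma hamiltonian_col a b X p : hamiltonian a b X p ->
  mx_ac_derive a b (fun s => col_mx (X s) (p s)) (fun s => hamiltonian_mx s *m col_mx (X s) (p s)).
Proof.
move=> [h1 h2]; apply: mx_ac_derive_congr (mx_ac_derive_col_mx h1 h2) => //.
apply: aeW => s _; rewrite /hamiltonian_mx mul_block_col; congr col_mx; mx_expand => //.
by rewrite addrC.
Qed.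

Lemma hamiltonian_extend a b X p : 0 <= a -> a < b -> b <= T ->
  (forall c, a <= c -> c < b -> hamiltonian a c X p) ->
  exists X' p', hamiltonian a b X' p' /\
    forall s, a <= s -> s < b -> X' s = X s /\ p' s = p s.
Proof.
move=> a0 ab bT H.
have [z' Hz' zz'] := linear_ode_extend ab
  (fun c ac cb => hamiltonian_col (H c ac cb)) (L1mxS a0 bT hamiltonian_mx_L1).
have zE s : z' s = col_mx (usubmx (z' s)) (dsubmx (z' s)) by rewrite vsubmxK.
exists (fun s => usubmx (z' s)), (fun s => dsubmx (z' s)); split; last first.
  by move=> s as_ sb; rewrite zz' // col_mxKu col_mxKd.
have rhs s : hamiltonian_mx s *m z' s = col_mx (A s *m usubmx (z' s) - g s *m dsubmx (z' s))
    (- (A s)^T *m dsubmx (z' s) - Q s *m usubmx (z' s)).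
  rewrite {1}zE /hamiltonian_mx mul_block_col; congr col_mx; mx_expand => //.
  by rewrite addrC.
split=> i j.
  apply: ac_derive_congr (Hz' (lshift n i) j); first by move=> s _; rewrite mxE.
  by apply: aeW => s _; rewrite rhs col_mxEu.
apply: ac_derive_congr (Hz' (rshift n i) j); first by move=> s _; rewrite mxE.
by apply: aeW => s _; rewrite rhs col_mxEd.
Qed.

Lemma hamiltonianB a b X p X' p' : hamiltonian a b X p -> hamiltonian a b X' p' ->
  hamiltonian a b (fun s => X s - X' s) (fun s => p s - p' s).
Proof.
move=> [h1 h2] [h1' h2']; split.
  apply: mx_ac_derive_congr (mx_ac_deriveB h1 h1') => //; apply: aeW => s _; mx_expand; mx_ring.
apply: mx_ac_derive_congr (mx_ac_deriveB h2 h2') => //; apply: aeW => s _; mx_expand; mx_ring.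
Qed.

Lemma Phi_Psi_hamiltonian_co v c : 0 <= c -> c < T ->
  hamiltonian 0 c (fun s => Phi s *m v) (fun s => Psi s *m v).
Proof.
move=> c0 cT; split.
  apply: mx_ac_derive_congr (mx_ac_deriveMr v (Phi_ac_derive cT)) => //.
  apply: aeW => s; rewrite in_itv /= => /andP[s0 sc].
  by rewrite -(PPhi_Psi (ltW s0) (lt_trans sc cT)); mx_expand.
apply: mx_ac_derive_congr (mx_ac_deriveMr v (mx_ac_deriveS (lexx 0) (ltW cT) Psi_ac_derive)) => //.
by apply: aeW => s _; mx_expand.
Qed.

Lemma P_coercive_near K : exists2 d : R, 0 < d & forall s, 0 <= s -> s < T ->
  T - s < d -> coercive K (P s).
Proof.
case: hP => Ppd _ /cvgeyPge/(_ K) [d /= d0 H].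
exists d => // s s0 sT Tsd; apply: min_spectrum_coercive; first exact: P_sym.
by apply: H => //=; rewrite gtr0_norm ?subr_gt0.
Qed.

(* [Psi = P Phi] stays bounded while the least eigenvalue of [P] blows up, so
   [Phi] tends to [0] at [T]. *)
Lemma Phi_Psi_hamiltonian v :
  hamiltonian 0 T (fun s => Phi s *m v) (fun s => Psi s *m v).
Proof.
have T0 := T_gt0.
have [X [p [Hz zE]]] := hamiltonian_extend (lexx 0) T0 (lexx T)
  (fun c c0 cT => Phi_Psi_hamiltonian_co v c0 cT).
have PT : p T = Psi T *m v.
  apply/eqP; rewrite -subr_eq0; apply/eqP/colP => i; rewrite [RHS]mxE.
  apply: (ac_derive_eq_right T0 (mx_ac_deriveB (proj2 Hz) (mx_ac_deriveMr v Psi_ac_derive) i ord0)).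
  by move=> s s0 sT; have [_ ->] := zE s s0 sT; rewrite subrr mxE.
have XT : X T = 0.
  apply: inner_eq0; rewrite leNgt; apply/negP => pos.
  set a := inner_cv (X T) (X T) in pos.
  (* Near [T] one has [K |X|^2 <= <P X, X> = <p, X>], and this passes to [T]; there the chosen [K]
     makes the left side [|<p, X>| + 1], a contradiction. *)
  pose K := (`|inner_cv (p T) (X T)| + 1) / a.
  have [d d0 Hd] := P_coercive_near K.
  pose b := Num.max 0 (T - d / 2).
  have b0 : 0 <= b by rewrite le_max lexx.
  have bT : b < T by rewrite gt_max T0 /=; lra.
  have bd : T - d / 2 <= b by rewrite le_max lexx orbT.
  have [HX Hp] := hamiltonianS b0 (lexx T) Hz.
  have := ac_derive_ge0_right bT (ac_deriveB (ac_derive_inner Hp HX) (ac_deriveZ K (ac_derive_inner HX HX))).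
  have hs s : b <= s -> s < T -> 0 <= inner_cv (p s) (X s) - K * inner_cv (X s) (X s).
    move=> bs sT; have s0 := le_trans b0 bs; have [-> ->] := zE s s0 sT.
    rewrite -(PPhi_Psi s0 sT) -mulmxA subr_ge0; apply: Hd => //; lra.
  move=> /(_ hs); rewrite -/a /K mulrVK ?unitfE ?gt_eqF //.
  have := ler_norm (inner_cv (p T) (X T)); lra.
have [_ _ PhiT] := hPhi.
have XE s : 0 <= s <= T -> Phi s *m v = X s.
  move=> /andP[s0]; rewrite le_eqVlt => /predU1P[->|sT].
    by rewrite PhiT mul0mx XT.
  by have [-> _] := zE s s0 sT.
have pE s : 0 <= s <= T -> Psi s *m v = p s.
  move=> /andP[s0]; rewrite le_eqVlt => /predU1P[->|sT]; first by rewrite PT.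
  by have [_ ->] := zE s s0 sT.
have ae01 : forall s, s \in `]0, T[ -> 0 <= s <= T.
  by move=> s; rewrite in_itv /= => /andP[/ltW -> /ltW ->].
case: Hz => HX Hp; split.
  by apply: mx_ac_derive_congr HX => //; apply: aeW => s /ae01 s01; rewrite XE // pE.
by apply: mx_ac_derive_congr Hp => //; apply: aeW => s /ae01 s01; rewrite XE // pE.
Qed.

(** [Phi] vanishes at [T], so [Psi T *m v = 0] makes the whole Hamiltonian solution vanish at [T],
    hence also at [0], where its state is [v]. *)
Lemma PsiT_unit : Psi T \in unitmx.
Proof.
apply: unitmx_of_inj => v Pv; have T0 := T_gt0.
have [_ Phi0 PhiT] := hPhi.
have [C _ HC] := linear_ode_bound hamiltonian_mx_L1.
have [_ h] := HC 0 T _ (lexx _) (ltW T0) (lexx _)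
  (hamiltonian_col (Phi_Psi_hamiltonian v)).
move: h; rewrite PhiT Pv mul0mx col_mx0 inner0l mulr0 => /inner_eq0.
rewrite Phi0 mul1mx -col_mx0 => /eq_col_mx.
by case.
Qed.

Variables (x y : 'cV[R]_n).
Local Notation eta := (eta_term Phi Psi T y).

(** The transposed inverse of [Phi] is a fundamental matrix of the adjoint closed-loop equation, so
    [eta], that matrix applied to a constant vector, solves the homogeneous adjoint equation. *)
Lemma eta_ac_derive c : 0 <= c -> c < T ->
  mx_ac_derive 0 c eta (fun s => - ((A s - g s *m P s)^T *m eta s)).
Proof.
move=> c0 cT; have uPhi s : 0 <= s <= c -> Phi s \in unitmx.
  by move=> /andP[s0 sc]; apply: Phi_unit => //; exact: le_lt_trans cT.
have HI := mx_ac_derive_inv uPhi (Phi_ac_derive cT).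
apply: mx_ac_derive_congr (mx_ac_deriveMr y (mx_ac_deriveN (mx_ac_deriveT (mx_ac_deriveMl (Psi T) HI)))) => //.
apply: aeW => s; rewrite in_itv /= => /andP[/ltW s0 /ltW sc].
have us : Phi s \in unitmx by apply: uPhi; rewrite s0.
rewrite /eta_term (mulmxA _ (A s - g s *m P s) (Phi s)) (mulmxK us).
have -> : (Psi T *m - (invmx (Phi s) *m (A s - g s *m P s)))^T =
    - (Psi T *m (invmx (Phi s) *m (A s - g s *m P s)))^T by rewrite mulmxN linearN.
by rewrite opprK mulNmx mulmxN opprK !trmx_mul !mulmxA.
Qed.

(* Variation of constants: with [X = Phi *m Y] the closed loop reduces to a
   quadrature for [Y]. *)
Lemma closed_loop_pair_co : exists X : R -> 'cV[R]_n, X t = x /\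
  forall c, t <= c -> c < T ->
    hamiltonian t c X (fun s => P s *m X s + eta s).
Proof.
pose k s : 'cV[R]_n := - (invmx (Phi s) *m (g s *m eta s)).
pose I s : 'cV[R]_n := \matrix_(i, j) \int[@lebesgue_measure R]_(r in `[t, s]) k r i j.
have HI c : t <= c -> c < T -> mx_ac_derive t c I k.
  move=> tc cT; apply: mx_ac_derive_integral; apply: L1mxN.
  have c0 := le_trans ht0 tc.
  have uPhi s : t <= s <= c -> Phi s \in unitmx.
    move=> /andP[ts sc]; apply: Phi_unit => //; first exact: le_trans ts.
    exact: le_lt_trans cT.
  apply: Loomx_L1mx_mul.
    exact: mx_ac_derive_Loomx (mx_ac_derive_inv uPhi (mx_ac_deriveS ht0 (lexx c) (Phi_ac_derive cT))).
  apply: L1mx_Loomx_mul; first exact: L1mxS ht0 (ltW cT) gain_L1.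
  exact: mx_ac_derive_Loomx (mx_ac_deriveS ht0 (lexx c) (eta_ac_derive c0 cT)).
pose X s := Phi s *m (invmx (Phi t) *m x + I s).
have I0 : I t = 0.
  by apply/matrixP => i j; rewrite !mxE set_itv1 Rintegral_set1.
exists X; split; first by rewrite /X I0 addr0 mulKVmx // Phi_unit.
move=> c tc cT; have c0 := le_trans ht0 tc.
have tcE s : s \in `]t, c[ -> 0 <= s /\ s < T.
  rewrite in_itv /= => /andP[ts sc]; split; first by rewrite (le_trans ht0) ?ltW.
  exact: lt_trans cT.
have HX : mx_ac_derive t c X (fun s => A s *m X s - g s *m (P s *m X s + eta s)).
  apply: mx_ac_derive_congr (mx_ac_deriveM (mx_ac_deriveS ht0 (lexx c) (Phi_ac_derive cT))
    (mx_ac_deriveD (mx_ac_derive_cst t c (invmx (Phi t) *m x)) (HI c tc cT))) => //.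
  apply: aeW => s /tcE[s0 sT]; rewrite add0r /k mulmxN mulKVmx ?Phi_unit //.
  by rewrite -/(X s) -(mulmxA _ (Phi s)) -/(X s); mx_expand; mx_ring.
split=> //.
have Heta := mx_ac_deriveS ht0 (lexx c) (eta_ac_derive c0 cT).
apply: mx_ac_derive_congr (mx_ac_deriveD (mx_ac_deriveM (mx_ac_deriveS ht0 (lexx c) (P_ac_derive cT)) HX) Heta) => //.
(* For [p = P X + eta] the Riccati terms and the adjoint terms combine to [- A^T p - Q X]; this
   needs the gain to be symmetric, which is known almost everywhere. *)
apply: ae_imply gain_sym => s gs sab; have [s0 sT] := tcE s sab.
have -> : (A s - g s *m P s)^T = (A s)^T - P s *m g s.
  by rewrite linearB /= trmx_mul gs ?in_itv /= ?s0 ?(ltW sT) // P_sym.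
by mx_expand; mx_ring.
Qed.

Lemma closed_loop_pair : exists X p, [/\ hamiltonian t T X p, X t = x &
  forall s, t <= s -> s < T -> p s = P s *m X s + eta s].
Proof.
have [X0 [X0t H]] := closed_loop_pair_co.
have [X [p [Hz zE]]] := hamiltonian_extend ht0 htT (lexx T) H.
exists X, p; split=> //; first by have [-> _] := zE t (lexx t) htT.
by move=> s ts sT; have [-> ->] := zE s ts sT.
Qed.

(* The symplectic pairing [Psi^T X - Phi^T p] is constantly [Psi(T)^T y], and
   [Phi] vanishes at [T]. *)
Lemma terminal_state X p : hamiltonian t T X p ->
  (forall s, t <= s -> s < T -> p s = P s *m X s + eta s) -> X T = y.
Proof.
move=> [HX Hp] pE; have [_ _ PhiT] := hPhi.
suff : (Psi T)^T *m X T = (Psi T)^T *m y.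
  move=> /(congr1 (mulmx (invmx (Psi T)^T))).
  by rewrite !mulKmx // unitmx_tr; exact: PsiT_unit.
apply: inner_eq => v; rewrite -!inner_mulmx.
have [HPhi HPsi] := hamiltonianS ht0 (lexx T) (Phi_Psi_hamiltonian v).
have := ac_derive_eq_right htT (ac_deriveB (ac_derive_inner HPsi HX) (ac_derive_inner HPhi Hp)).
move=> /(_ (inner_cv (Psi T *m v) y)).
rewrite PhiT mul0mx inner0l subr0; apply=> s ts sT.
have s0 := le_trans ht0 ts.
rewrite pE // -PPhi_Psi // -mulmxA (inner_mulmx (P s)) P_sym //.
rewrite innerDr opprD addrA subrr sub0r /eta_term mulNmx innerNr opprK.
rewrite inner_mulmx mulmxA -trmx_mul -mulmxA mulVmx ?mulmx1 ?Phi_unit //.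
by rewrite inner_mulmx.
Qed.

(** * The Riccati solution [Pi] and the terminal costate *)

Lemma Pi_ac_derive a : t < a -> mx_ac_derive a T Pi (fun s =>
  - (Pi s *m A s + (A s)^T *m Pi s - Q s + Pi s *m g s *m Pi s)).
Proof.
move=> ta; case: hPi => _ o _; apply: ode_ac_derive o => s /=.
by rewrite !in_itv /= => /andP[/(lt_le_trans ta) -> ->].
Qed.

Lemma Pi_unit s : t < s -> s <= T -> Pi s \in unitmx.
Proof. by move=> ts sT; apply: pdmx_unit; case: hPi => h _ _; apply: h; rewrite in_itv /= ts. Qed.

Lemma Pi_sym s : t < s -> s <= T -> (Pi s)^T = Pi s.
Proof. by move=> ts sT; case: hPi => h _ _; have [|] := h s; rewrite // in_itv /= ts. Qed.

Lemma Pi_coercive_near K : exists2 d : R, 0 < d & forall s, t < s -> s <= T ->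
  s - t < d -> coercive K (Pi s).
Proof.
case: hPi => Ppd _ /cvgeyPge/(_ K) [d /= d0 H].
exists d => // s ts sT std; apply: min_spectrum_coercive; first exact: Pi_sym.
by apply: H => //=; rewrite distrC gtr0_norm ?subr_gt0.
Qed.

Lemma mxsum_mul_le (M N : 'M[R]_n) (K : R) : (forall i j, `|M i j| <= K) ->
  mxsum (M *m N) <= n%:R * K * mxsum N.
Proof.
move=> MK; rewrite /mxsum.
have -> : n%:R * K * (\sum_i \sum_j `|N i j|) =
    \sum_(i < n) \sum_k \sum_j (K * `|N k j|).
  rewrite [RHS]sumr_const card_ord -[RHS]mulr_natl -mulrA; congr (_ * _).
  rewrite mulr_sumr; apply: eq_bigr => k _; by rewrite mulr_sumr.
apply: ler_sum => i _; rewrite exchange_big /=; apply: ler_sum => j _.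
rewrite mxE; apply: le_trans (ler_norm_sum _ _ _) _; apply: ler_sum => k _.
by rewrite normrM; apply: ler_wpM2r.
Qed.

Lemma mxsumD (M N : 'M[R]_n) : mxsum (M + N) <= mxsum M + mxsum N.
Proof.
rewrite /mxsum -big_split; apply: ler_sum => i _; rewrite -big_split.
by apply: ler_sum => j _; rewrite mxE; exact: ler_normD.
Qed.

Lemma mxsumN (M : 'M[R]_n) : mxsum (- M) = mxsum M.
Proof.
by rewrite /mxsum; apply: eq_bigr => i _; apply: eq_bigr => j _; rewrite mxE normrN.
Qed.

(* [Pi^-1] tends to [0] at [t], so [X + Pi^-1 p], which solves a linear
   equation, vanishes identically. *)
Lemma terminal_costate X p : hamiltonian t T X p -> X t = 0 ->
  p T = - (Pi T *m X T).
Proof.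
move=> HXp Xt; have [HX Hp] := HXp.
pose S s := invmx (Pi s).
pose xi s := X s + S s *m p s.
have uPi a s : t < a -> a <= s <= T -> Pi s \in unitmx.
  by move=> ta /andP[as_ sT]; apply: Pi_unit => //; exact: lt_le_trans as_.
have HS a : t < a -> mx_ac_derive a T S (fun s => - (S s *m
    - (Pi s *m A s + (A s)^T *m Pi s - Q s + Pi s *m g s *m Pi s) *m S s)).
  by move=> ta; apply: mx_ac_derive_inv (Pi_ac_derive ta) => s; exact: uPi.
(* The inverse solves [S' = A S + S A^T + g - S Q S]. In the derivative of [X + S p] the terms in
   [g p] and in [S A^T p] cancel, and what remains is homogeneous in [xi]. *)
have Hxi a : t < a -> mx_ac_derive a T xi (fun s => (A s - S s *m Q s) *m xi s).
  move=> ta; have [HX' Hp'] := hamiltonianS (ltW ta) (lexx T) HXp.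
  apply: mx_ac_derive_congr (mx_ac_deriveD HX' (mx_ac_deriveM (HS a ta) Hp')) => //.
  apply: aeW => s; rewrite in_itv /= => /andP[/ltW as_ /ltW sT].
  have us : Pi s \in unitmx by apply: (uPi a) => //; rewrite as_.
  rewrite /xi /S; mx_expand.
  rewrite !(mulVmx us) !mul1mx !(mulmxK us).
  by mx_ring.
have [d1 d10 co1] := Pi_coercive_near 1.
pose b := t + Num.min (d1 / 2) ((T - t) / 2).
have tT0 : 0 < T - t by rewrite subr_gt0.
have m0 : 0 < Num.min (d1 / 2) ((T - t) / 2).
  by rewrite lt_min; apply/andP; split; lra.
have tb : t < b by rewrite /b ltrDl.
have bT : b < T.
  have : Num.min (d1 / 2) ((T - t) / 2) <= (T - t) / 2 by rewrite ge_min lexx orbT.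
  rewrite /b; lra.
have bd : b - t < d1.
  have : Num.min (d1 / 2) ((T - t) / 2) <= d1 / 2 by rewrite ge_min lexx.
  rewrite /b; lra.
(* On []t, b]] the matrix [Pi] is [1]-coercive, so the entries of [S] are at most [1]. The majorant
   is then integrable on [[t, b]] and independent of the left end. *)
pose alpha s := mxsum (A s) + n%:R * 1 * mxsum (Q s).
have ialpha : integrable_on t b alpha.
  apply: integrable_onD; first exact: integrable_on_mxsum (L1mxS ht0 (ltW bT) hA).
  by apply: integrable_onZ; exact: integrable_on_mxsum (L1mxS ht0 (ltW bT) hQ).
have alpha0 s : 0 <= alpha s.
  by rewrite addr_ge0 ?mxsum_ge0 // mulr1 mulr_ge0 ?mxsum_ge0.
have [C C0 HC] := linear_ode_bound_majorant n ialpha alpha0.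
have bound s : t < s -> s <= b -> inner_cv (xi b) (xi b) <= C * inner_cv (xi s) (xi s).
  move=> ts sb.
  have [|h _] := HC s b (fun s => A s - S s *m Q s) xi (ltW ts) sb (lexx b) _
    (mx_ac_deriveS (lexx s) (ltW bT) (Hxi s ts)); last exact: h.
  move=> r /andP[sr rb]; apply: le_trans (mxsumD _ _) _; rewrite mxsumN lerD2l.
  apply: mxsum_mul_le => i j; rewrite -[leRHS]invr1; apply: coercive_inv_coord => //.
  by apply: co1; [exact: lt_le_trans sr|exact: le_trans rb (ltW bT)|lra].
have [Mp Mp0 HMp] := abs_continuous_bounded (ac_derive_abs_continuous (ac_derive_inner Hp Hp)).
have xib : xi b = 0.
  apply: inner_eq0; rewrite leNgt; apply/negP => pos.
  (* Close to [t] both [|X|^2] and [|S p|^2] are at most [e]: the first since [X t = 0], the second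
     since [K] is chosen with [Mp <= e K^2]. Hence [|xi|^2 <= 4 e] there, and the uniform bound
     gives [|xi b|^2 <= 4 C e], against [|xi b|^2 = 5 C e]. *)
  pose e := inner_cv (xi b) (xi b) / C / 5.
  have e0 : 0 < e by rewrite !divr_gt0.
  pose K := Mp / e + 1.
  have K1 : 1 <= K by rewrite /K lerDr divr_ge0 // ltW.
  have K0 : 0 < K by lra.
  have [d d0 co] := Pi_coercive_near K.
  have [d' d'0 Hd'] := abs_continuous_modulus (ac_derive_abs_continuous (ac_derive_inner HX HX)) e0.
  pose s := t + Num.min (Num.min (d / 2) (d' / 2)) (b - t).
  have ms0 : 0 < Num.min (Num.min (d / 2) (d' / 2)) (b - t).
    by rewrite !lt_min; apply/andP; split; [apply/andP; split|]; lra.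
  have ts : t < s by rewrite /s ltrDl.
  have sb : s <= b.
    have : Num.min (Num.min (d / 2) (d' / 2)) (b - t) <= b - t by rewrite ge_min lexx orbT.
    rewrite /s; lra.
  have sd : s - t < d.
    have : Num.min (Num.min (d / 2) (d' / 2)) (b - t) <= d / 2 by rewrite !ge_min lexx.
    rewrite /s; lra.
  have sd' : s - t < d'.
    have : Num.min (Num.min (d / 2) (d' / 2)) (b - t) <= d' / 2.
      by rewrite !ge_min lexx orbT.
    rewrite /s; lra.
  have sT : s <= T by exact: le_trans sb (ltW bT).
  have h1 : inner_cv (X s) (X s) < e.
    have := Hd' s t; rewrite Xt inner0l subr0 lexx (ltW ts) sT (ltW htT) /=.
    move=> /(_ isT isT); rewrite gtr0_norm ?subr_gt0 // => /(_ sd').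
    exact: le_lt_trans (ler_norm _).
  have h2 : inner_cv (S s *m p s) (S s *m p s) <= e.
    apply: le_trans (coercive_inv_le (p s) K0 (co s ts sT sd)) _.
    have hp : inner_cv (p s) (p s) <= Mp.
      by apply: le_trans (ler_norm _) (HMp s _); rewrite (ltW ts).
    rewrite mulrC ler_pdivrMr ?exprn_gt0 //; apply: le_trans hp _.
    have : Mp <= e * K by rewrite /K mulrDr mulr1 mulrCA mulfV ?gt_eqF // mulr1 lerDl ltW.
    have : e * K <= e * K ^+ 2.
      by rewrite expr2 mulrA ler_peMr // mulr_ge0 // ltW.
    lra.
  have h3 : inner_cv (xi s) (xi s) <= 4 * e.
    rewrite /xi !(innerDl, innerDr) (innerC (S s *m p s) (X s)).
    by have := inner_young (X s) (S s *m p s) (@ltr01 R); rewrite invr1; lra.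
  have := bound s ts sb; have : C * inner_cv (xi s) (xi s) <= C * (4 * e).
    by rewrite ler_pM2l.
  have : C * (5 * e) = inner_cv (xi b) (xi b).
    by rewrite /e; field; rewrite gt_eqF.
  have : 0 < C * e by rewrite mulr_gt0.
  lra.
(* On [[b, T]] the matrix [S] is bounded, and the linear estimate carries the zero from [b] to
   [T]. *)
have xiT : xi T = 0.
  have LM : L1mx b T (fun s => A s - S s *m Q s).
    have b0 : 0 <= b by exact: le_trans ht0 (ltW tb).
    apply: L1mxD; first exact: L1mxS b0 (lexx T) hA.
    apply: L1mxN; apply: Loomx_L1mx_mul (L1mxS b0 (lexx T) hQ).
    exact: mx_ac_derive_Loomx (HS b tb).
  have [C' _ HC'] := linear_ode_bound LM.
  have [h _] := HC' b T xi (lexx b) (ltW bT) (lexx T) (Hxi b tb).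
  by apply: inner_eq0; apply: le_trans h _; rewrite xib inner0l mulr0.
have uT : Pi T \in unitmx by exact: Pi_unit.
have := congr1 (mulmx (Pi T)) xiT.
rewrite /xi /S mulmxDr mulKVmx // mulmx0 addrC => /eqP.
by rewrite addr_eq0 => /eqP.
Qed.

Definition lq_value : R :=
  inner_cv (P t *m x) x - 2 * inner_cv (Psi T *m invmx (Phi t) *m x) y
  + inner_cv (Pi T *m y) y.

Lemma lq_extremal : exists X p, [/\ hamiltonian t T X p, X t = x, X T = y,
  forall s, t <= s -> s < T -> p s = P s *m X s + eta s &
  inner_cv (p t) x - inner_cv (p T) y = lq_value].
Proof.
have [X [p [HXp Xt pE]]] := closed_loop_pair.
have XT := terminal_state HXp pE.
exists X, p; split=> //.
have uPhi : Phi t \in unitmx by exact: Phi_unit.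
(* Subtracting the solution [(Phi w, Psi w)] makes the initial state zero without changing the
   terminal state, because [Phi] vanishes at [T]. Comparison with [Pi] then gives
   [p T = Psi T *m w - Pi T *m y]. *)
pose w := invmx (Phi t) *m x.
have [_ _ PhiT] := hPhi.
have := terminal_costate (hamiltonianB HXp
  (hamiltonianS ht0 (lexx T) (Phi_Psi_hamiltonian w))).
rewrite /w mulKVmx // Xt subrr => /(_ erefl); rewrite PhiT mul0mx subr0 XT => /eqP.
rewrite subr_eq => /eqP ->; rewrite pE // Xt /lq_value /eta_term.
rewrite innerDl mulNmx innerNl -[in X in _ - _ - X]innerC.
rewrite [inner_cv (_^T *m y) x]innerC -inner_mulmx innerDr innerNr (innerC y (Pi T *m y)).
rewrite (innerC y) (mulmxA (Psi T)); ring.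
Qed.

(** Since [R u = - B^T p], the integrand is the derivative of [- <p, Y>] for every competitor. The
    pairing thus depends only on the common endpoints: it is the orthogonality relation of the
    extremal and, for the extremal itself, its cost. *)
Lemma lq_optimality : exists X : R -> 'cV[R]_n,
  [/\ closed_loop_state A B Rc t T P eta x X,
    steers A B t T x y (feedback B Rc P eta X) X &
    forall v Y, steers A B t T x y v Y ->
      \int[@lebesgue_measure R]_(s in `[t, T])
        (inner_cv (Q s *m X s) (Y s) + inner_cv (Rc s *m feedback B Rc P eta X s) (v s))
      = lq_value].
Proof.
have [X [p [[HX Hp] Xt XT pE pV]]] := lq_extremal.
exists X; set u := feedback B Rc P eta X.
(* The feedback written through the costate. As [p] is continuous up to [T], this form is square
   integrable, which is not visible on the form containing [P]. *)
pose w s := - (invmx (Rc s) *m ((B s)^T *m p s)).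
have uE s : t <= s -> s < T -> u s = w s.
  by move=> ts sT; rewrite /u /feedback /w pE // !mulNmx mulmxA.
have hB' := L2mxS ht0 (lexx T) hB.
have hR' := LoomxS ht0 (lexx T) hR.
have hRd' : \forall s \ae (@lebesgue_measure R),
    s \in `[t, T] -> psdmx (Rc s - delta%:M).
  by apply: ae_imply hRd => s h sT; apply: h; exact: (subset_itv_cc ht0 (lexx T) sT).
have Lw : L2mx t T w.
  apply: L2mxN; apply: Loomx_L2mx_mul; first exact: Loomx_invmx hdelta hR' hRd'.
  by apply: L2mx_Loomx_mul (L2mxT hB') _; exact: mx_ac_derive_Loomx Hp.
have Lu : L2mx t T u by exact: L2mx_eq_right uE Lw.
have itvE s : s \in `]t, T[ -> t <= s /\ s < T.
  by rewrite in_itv /= => /andP[/ltW].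
split.
- split=> //; apply: (@mx_ac_derive_ode _ _ _ _ t T).
    by move=> s /=; rewrite !in_itv /= => /andP[-> /ltW].
  apply: mx_ac_derive_congr HX => //; apply: aeW => s /itvE[ts sT].
  by rewrite pE //; mx_expand; mx_ring.
- split=> //; split=> //; apply: (@mx_ac_derive_ode _ _ _ _ t T) => //.
  apply: mx_ac_derive_congr HX => //; apply: aeW => s /itvE[ts sT].
  by rewrite uE // /w mulmxN /gain !mulmxA.
- move=> v Y [Lv [oY Yt] YT].
  have HY : mx_ac_derive t T Y (fun s => A s *m Y s + B s *m v s) by exact: ode_ac_derive oY.
  pose f s := inner_cv (Q s *m X s) (Y s) + inner_cv (Rc s *m u s) (v s).
  have If : integrable_on t T f.
    apply: integrable_onD.
      apply: L1_inner; last exact: mx_ac_derive_Loomx HY.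
      by apply: L1mx_Loomx_mul (L1mxS ht0 (lexx T) hQ) _; exact: mx_ac_derive_Loomx HX.
    by apply: L2_inner Lv; exact: Loomx_L2mx_mul Lu.
  have Hf : ac_derive t T (fun s => - inner_cv (p s) (Y s)) f.
    apply: ac_derive_congr (ac_deriveZ (-1) (ac_derive_inner Hp HY)).
      by move=> s _; rewrite mulN1r.
    apply: ae_imply hRd' => s Rs sab; have [ts sT] := itvE s sab.
    have [_ co] := psdmx_coercive (Rs (subset_itv_oo_cc sab)).
    have uR := coercive_unit hdelta co.
    rewrite /f uE // /w mulmxN mulKVmx // innerNl.
    rewrite (inner_mulmx _ (p s) (v s)) trmxK.
    rewrite mulNmx !innerDl !innerDr !innerNl (inner_mulmx (A s)^T) trmxK.
    ring.
  rewrite -(ac_derive_FTC (ltW htT) Hf If) Yt YT opprK addrC -pV.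
  by [].
Qed.

End LinearQuadratic.

(** * Lagrangian duality *)

Section LagrangianDuality.
Variables (R : realType) (k : nat) (Z : Type).
Variables (J : 'I_k.+1 -> Z -> R) (q : 'I_k.+1 -> Z -> Z -> R) (C : R).
Hypotheses (J_ge0 : forall i z, 0 <= J i z) (q_ge0 : forall i z w, 0 <= q i z w)
  (q_diag : forall i z, q i z z = 0) (q_sym : forall i z w, q i z w = q i w z) (C_ge0 : 0 <= C)
  (q_le : forall i z w, q i z w <= C * q ord0 z w)
  (J_lip : forall i z w K, 0 < K ->
     `|J i z - J i w| <= K * J i w + (1 + K^-1) * q i z w).
Variables (V : 'cV[R]_k -> R) (zs : 'cV[R]_k -> Z).

(** [H] is left free: it is instantiated with costs of points, costs of differences, bilinear
    pairings and pointwise forms. *)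
Definition lagrangian (H : 'I_k.+1 -> R) (lam : 'cV[R]_k) : R :=
  H ord0 + \sum_(i < k) lam i ord0 * H (lift ord0 i).

Hypothesis V_opt : forall lam, multipliers R k lam -> forall z,
  lagrangian (fun i => J i z) lam = V lam + lagrangian (fun i => q i z (zs lam)) lam.
Variables (c : 'cV[R]_k) (zhat : Z).
Hypothesis slater : forall i, J (lift ord0 i) zhat < c i ord0.

Let G (i : 'I_k) z := J (lift ord0 i) z - c i ord0.
Let dual (lam : 'cV[R]_k) := V lam - inner_cv lam c.
Let ell (lam : 'cV[R]_k) z := J ord0 z + \sum_(i < k) lam i ord0 * G i z.

Lemma lagrangian_ge0 (H : 'I_k.+1 -> R) lam : multipliers R k lam ->
  (forall i, 0 <= H i) -> H ord0 <= lagrangian H lam.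
Proof.
move=> l0 H0; rewrite lerDl; apply: sumr_ge0 => i _.
by apply: mulr_ge0; [exact: l0|exact: H0].
Qed.

Lemma ellE lam z : ell lam z = lagrangian (fun i => J i z) lam - inner_cv lam c.
Proof.
rewrite /ell /lagrangian inner_cvE -addrA -sumrB; congr (_ + _).
by apply: eq_bigr => i _; rewrite /G mulrBr.
Qed.

Lemma ell_dual lam z : multipliers R k lam ->
  ell lam z = dual lam + lagrangian (fun i => q i z (zs lam)) lam.
Proof. by move=> l0; rewrite ellE V_opt // /dual addrAC. Qed.

Lemma dual_le_ell lam z : multipliers R k lam -> dual lam <= ell lam z.
Proof.
move=> l0; rewrite ell_dual // lerDl; apply: le_trans (lagrangian_ge0 l0 _) => //.
Qed.

Lemma ell_zs lam : multipliers R k lam -> ell lam (zs lam) = dual lam.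
Proof.
move=> l0; rewrite ell_dual // /lagrangian q_diag big1 ?addr0 // => i _.
by rewrite q_diag mulr0.
Qed.

Lemma compact_box (M : R) :
  compact [set r : 'rV[R]_k | forall i, (`[0, M]%classic : set R) (r ord0 i)].
Proof. by apply: (@rV_compact R k (fun=> `[0, M]%classic)) => _; exact: segment_compact. Qed.

Lemma ell_continuous z : continuous (fun r : 'rV[R]_k => ell r^T z).
Proof.
move=> r; have hc : {for r, continuous (fun _ : 'rV[R]_k => J ord0 z)}.
  exact: cst_continuous.
apply: (continuousD hc).
apply: (@continuous_bigsum _ _ _ _ (fun i (r : 'rV[R]_k) => r^T i ord0 * G i z)) => i s.
have hg : {for s, continuous (fun _ : 'rV[R]_k => G i z)} by exact: cst_continuous.
have -> : (fun r : 'rV[R]_k => r^T i ord0 * G i z) = (fun r => r ord0 i * G i z).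
  by apply/funext => w; rewrite mxE.
exact: (continuousM (@coord_continuous _ _ _ ord0 i s) hg).
Qed.

(* The dual function is an infimum of affine functions, hence upper
   semicontinuous, and the Slater point makes it coercive. *)
Lemma dual_max : exists2 lam, multipliers R k lam &
  forall mu, multipliers R k mu -> dual mu <= dual lam.
Proof.
(* The smallest Slater margin; the default [1] keeps it positive when there are no constraints. *)
pose sg : R := \big[Order.min/1]_(i < k) (- G i zhat).
have sg0 : 0 < sg.
  rewrite /sg; elim/big_ind : _ => //; first by move=> a b a0 b0; rewrite lt_min a0.
  by move=> i _; rewrite oppr_gt0 subr_lt0.
have sgG i : sg <= - G i zhat by exact: bigmin_le.
have dual_ub lam : multipliers R k lam ->
    dual lam <= J ord0 zhat - sg * \sum_(i < k) lam i ord0.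
  move=> l0; apply: le_trans (dual_le_ell zhat l0) _.
  rewrite /ell lerD2l -mulrN -sumrN mulr_sumr; apply: ler_sum => i _.
  by rewrite mulrN mulrC -mulNr; apply: ler_wpM2r; [exact: l0|have := sgG i; lra].
(* When some coordinate exceeds [M], the Slater bound on the dual is negative, since
   [sg * M = J ord0 zhat + sg], whereas [dual 0] is nonnegative. Outside the box the dual is
   therefore at most [dual 0]. *)
pose M := J ord0 zhat / sg + 1.
have M0 : 0 <= M by rewrite /M addr_ge0 // divr_ge0 // ltW.
have mult0 : multipliers R k 0 by move=> i; rewrite mxE.
have dual0 : 0 <= dual 0.
  rewrite -ell_zs // /ell big1 ?addr0 // => i _.
  by rewrite mxE mul0r.
pose K : set 'rV[R]_k := [set r | forall i, (`[0, M]%classic : set R) (r ord0 i)].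
have K_mult r : K r -> multipliers R k r^T.
  by move=> Kr i; have := Kr i; rewrite mxE /= in_itv /= => /andP[].
have outK lam : multipliers R k lam -> ~ K lam^T -> dual lam <= dual 0.
  move=> l0 nK; apply: le_trans dual0; apply: le_trans (dual_ub lam l0) _.
  have [i Mi] : exists i, M < lam i ord0.
    apply: contrapT => h; apply: nK => i; rewrite mxE /= in_itv /= l0 /= leNgt.
    by apply/negP => Mi; apply: h; exists i.
  have sumM : M <= \sum_(i < k) lam i ord0.
    rewrite (bigD1 i) //= -[M]addr0; apply: lerD; first exact: ltW.
    by apply: sumr_ge0 => j _; exact: l0.
  have : sg * M <= sg * \sum_(i < k) lam i ord0 by rewrite ler_pM2l.
  have : sg * M = J ord0 zhat + sg by rewrite /M; field; rewrite gt_eqF.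
  by lra.
pose S : set R := [set dual r^T | r in K].
have K0 : K 0 by move=> i; rewrite mxE /= in_itv /= lexx M0.
have supS : has_sup S.
  split; first by exists (dual (0 : 'rV[R]_k)^T), 0.
  exists (J ord0 zhat) => _ [r Kr <-]; apply: le_trans (dual_ub _ (K_mult r Kr)) _.
  rewrite gerBl; apply: mulr_ge0; first exact: ltW.
  by apply: sumr_ge0 => i _; exact: K_mult.
have /choice [r Hr] (N : nat) : exists r, K r /\ sup S - N.+1%:R^-1 < dual r^T.
  have e0 : 0 < N.+1%:R^-1 :> R by rewrite invr_gt0.
  by have [_ [r Kr <-] h] := sup_adherent e0 supS; exists r.
have Kr : (r @ \oo) K by exists 0%N => // N _; case: (Hr N).
have [p [Kp clp]] := @compact_box M (r @ \oo) (fmap_proper_filter r eventually_filter) Kr.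
have supp : sup S <= dual p^T.
  rewrite leNgt; apply/negP => h.
  rewrite -ell_zs in h; last exact: K_mult.
  (* The continuous function [ell _ z] dominates the dual and touches it at the cluster point [p].
     Half of the supposed gap is spent on continuity and half on the defect [1 / (N + 1)] of the
     maximizing sequence. *)
  set z := zs p^T in h.
  pose e := (sup S - ell p^T z) / 2.
  have e0 : 0 < e by rewrite /e; lra.
  have U : nbhs p [set w : 'rV[R]_k | `|ell p^T z - ell w^T z| < e].
    by have /cvgrPdist_lt/(_ e e0) := @ell_continuous z p; apply.
  have W : (r @ \oo) [set w | exists2 N : nat, w = r N & N.+1%:R^-1 <= e].
    have [N _ HN] : \forall N \near \oo, (N.+1%:R^-1 : R) < e.
      have := @cvg_harmonic R => /cvgrPdist_lt/(_ e e0).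
      apply: filterS => N /=; rewrite sub0r normrN ger0_norm ?invr_ge0 //.
    by exists N => // N' NN'; exists N' => //; apply: ltW; exact: HN.
  have [w [[N -> eN] /= Uw]] := clp _ _ W U.
  have [KrN hN] := Hr N.
  have h1 := dual_le_ell z (K_mult _ KrN).
  have h2 := ler_norm (- (ell p^T z - ell (r N)^T z)); rewrite normrN in h2.
  have h3 : 2 * e = sup S - ell p^T z by rewrite /e; field.
  have aux (a1 a2 u dl i d nrm : R) : - (a2 - a1) <= nrm -> nrm < d -> dl <= a1 ->
    u - i < dl -> i <= d -> 2 * d = u - a2 -> False by lra.
  exact: aux h2 Uw h1 hN eN h3.
exists p^T; first exact: K_mult.
move=> mu mu0; have [Kmu|nK] := pselect (K mu^T).
  apply: le_trans supp; apply: ub_le_sup; first by case: supS.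
  by exists mu^T => //; rewrite trmxK.
apply: le_trans (outK mu mu0 nK) _; apply: le_trans supp.
apply: ub_le_sup; first by case: supS.
by exists 0 => //; rewrite trmx0.
Qed.

Section VariationalInequality.
Variables (lam mu : 'cV[R]_k).
Hypotheses (lam0 : multipliers R k lam) (mu0 : multipliers R k mu)
  (lam_max : forall nu, multipliers R k nu -> dual nu <= dual lam).

(** The slope of the affine function [ell _ z] in the direction [mu - lam]. *)
Let h z := \sum_(i < k) (mu i ord0 - lam i ord0) * G i z.
Let step e := lam + e *: (mu - lam).

Lemma step_mult e : 0 < e -> e <= 1 -> multipliers R k (step e).
Proof.
move=> e0 e1 i; rewrite !mxE.
have := lam0 i; have := mu0 i; set a := mu i ord0; set b := lam i ord0 => a0 b0.
have -> : b + e * (a - b) = e * a + (1 - e) * b by ring.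
by apply: addr_ge0; apply: mulr_ge0 => //; [exact: ltW|rewrite subr_ge0].
Qed.

Lemma ell_step e z : ell (step e) z = ell lam z + e * h z.
Proof.
rewrite /ell /h -addrA mulr_sumr -big_split; congr (_ + _).
by apply: eq_bigr => i _; rewrite !mxE /=; ring.
Qed.

(** For [z] the minimizer at [step e], maximality gives [ell (step e) z <= dual lam <= ell lam z],
    and the two ends differ by [e * h z]. *)
Lemma h_step_le0 e : 0 < e -> e <= 1 -> h (zs (step e)) <= 0.
Proof.
move=> e0 e1; have se := step_mult e0 e1.
have := lam_max se; rewrite -(ell_zs se) ell_step.
have := dual_le_ell (zs (step e)) lam0 => h1 h2.
have : e * h (zs (step e)) <= 0 by lra.
by rewrite pmulr_rle0.
Qed.

(** Each of the two extremals is tested against the multiplier of the other. Adding the two exact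
    optimality identities cancels the values and leaves a quadratic surplus twice. *)
Lemma h_diff e : 0 < e -> e <= 1 ->
  2 * q ord0 (zs (step e)) (zs lam) <= e * (h (zs lam) - h (zs (step e))).
Proof.
move=> e0 e1; have se := step_mult e0 e1.
have h1 := ell_dual (zs (step e)) lam0.
have h2 := ell_dual (zs lam) se.
move: h2; rewrite -(ell_zs se) !ell_step (ell_zs lam0) => h2.
have h3 := lagrangian_ge0 lam0 (fun i => q_ge0 i (zs (step e)) (zs lam)).
have h4 := lagrangian_ge0 se (fun i => q_ge0 i (zs lam) (zs (step e))).
rewrite q_sym in h4.
by rewrite mulrBr; lra.
Qed.

(** The weight [K] stays free: [K = 1] yields a first bound on the distance between the extremals,
    and a small [K] then makes the fixed term [K * a] negligible. *)
Lemma h_lip : exists a b, [/\ 0 <= a, 0 <= b & forall z K, 0 < K ->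
  `|h z - h (zs lam)| <= K * a + (1 + K^-1) * (b * q ord0 z (zs lam))].
Proof.
exists (\sum_(i < k) `|mu i ord0 - lam i ord0| * J (lift ord0 i) (zs lam)).
exists (\sum_(i < k) `|mu i ord0 - lam i ord0| * C); split.
- by apply: sumr_ge0 => i _; rewrite mulr_ge0.
- by apply: sumr_ge0 => i _; rewrite mulr_ge0.
move=> z K K0; rewrite /h -sumrB; apply: le_trans (ler_norm_sum _ _ _) _.
rewrite mulr_suml !mulr_sumr -big_split; apply: ler_sum => i _ /=.
rewrite -mulrBr normrM.
have -> : G i z - G i (zs lam) = J (lift ord0 i) z - J (lift ord0 i) (zs lam).
  by rewrite /G; ring.
have h1 := J_lip (lift ord0 i) z (zs lam) K0.
have h2 : (1 + K^-1) * q (lift ord0 i) z (zs lam) <= (1 + K^-1) * (C * q ord0 z (zs lam)).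
  by apply: ler_wpM2l (q_le _ _ _); rewrite addr_ge0 // invr_ge0 ltW.
have := ler_wpM2l (normr_ge0 (mu i ord0 - lam i ord0)) (le_trans h1 (lerD (lexx _) h2)).
move=> h3; apply: le_trans h3 _; rewrite le_eqVlt; apply/orP; left; apply/eqP; ring.
Qed.

(* Strong convexity forces the minimizers at the perturbed multipliers to
   converge to [zs lam] at rate [sqrt e]. *)
Lemma variational_inequality : h (zs lam) <= 0.
Proof.
have [a [b [a0 b0 lip]]] := h_lip.
apply/ler_addgt0Pr => d d0; rewrite add0r.
(* Chosen so that [K * a <= d / 2]. *)
pose K := d / (2 * (a + 1)).
have a1 : 0 < 2 * (a + 1) by lra.
have K0 : 0 < K by rewrite divr_gt0.
have Ki : 0 < 1 + K^-1 by rewrite addr_gt0 ?invr_gt0.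
pose m := (1 + K^-1) * b * a + 1.
have m0 : 0 < m by rewrite ltr_wpDl // !mulr_ge0 // ltW.
(* The three bounds keep [step e] between the multipliers, absorb [2 e b Q] into [Q] so that
   [Q <= e a], and make the remaining error [(1 + 1 / K) b e a] at most [d / 2]. *)
pose e := Num.min 1 (Num.min (2 * b + 1)^-1 (d / (2 * m))).
have b1 : 0 < 2 * b + 1 by lra.
have e0 : 0 < e by rewrite !lt_min ltr01 invr_gt0 b1 divr_gt0 // mulr_gt0.
have e1 : e <= 1 by rewrite ge_min lexx.
have eb : e * (2 * b + 1) <= 1.
  by rewrite -ler_pdivlMr // div1r !ge_min lexx !orbT.
have em : e * m <= d / 2.
  have : e <= d / (2 * m) by rewrite !ge_min lexx !orbT.
  by rewrite ler_pdivlMr ?mulr_gt0 // => h1; lra.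
set z := zs (step e); set Q := q ord0 z (zs lam).
have Q0 : 0 <= Q by exact: q_ge0.
have hz : h z <= 0 by exact: h_step_le0.
have hd : 2 * Q <= e * (h (zs lam) - h z) by exact: h_diff.
have l1 := lip z 1 ltr01; rewrite invr1 mul1r -/Q in l1.
have l2 := lip z K K0; rewrite -/Q in l2.
have n1 : h (zs lam) - h z <= a + (1 + 1) * (b * Q).
  by apply: le_trans l1; rewrite distrC; exact: ler_norm.
have n2 : h (zs lam) - h z <= K * a + (1 + K^-1) * (b * Q).
  by apply: le_trans l2; rewrite distrC; exact: ler_norm.
have Qe : Q <= e * a.
  have : e * (h (zs lam) - h z) <= e * (a + (1 + 1) * (b * Q)) by rewrite ler_pM2l.
  have : e * (2 * b) * Q <= Q by rewrite ler_piMl //; lra.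
  lra.
have : (1 + K^-1) * (b * Q) <= (1 + K^-1) * (b * (e * a)).
  by rewrite ler_pM2l //; exact: ler_wpM2l.
have : (1 + K^-1) * (b * (e * a)) <= e * m.
  have -> : (1 + K^-1) * (b * (e * a)) = e * m - e by rewrite /m; ring.
  lra.
have : K * a <= d / 2.
  rewrite /K mulrAC ler_pdivrMr //; have := mulr_ge0 (ltW d0) a0; lra.
lra.
Qed.

End VariationalInequality.

(** The inequality keeps the surplus [q ord0], from which uniqueness of the optimal control is read
    off. *)
Lemma strong_duality : exists2 lam, multipliers R k lam /\
  (forall mu, multipliers R k mu -> V mu - inner_cv mu c <= V lam - inner_cv lam c) &
  (forall i, J (lift ord0 i) (zs lam) <= c i ord0) /\
  forall z, (forall i, J (lift ord0 i) z <= c i ord0) ->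
    J ord0 (zs lam) + q ord0 z (zs lam) <= J ord0 z.
Proof.
have [lam l0 lmax] := dual_max.
exists lam; first by [].
have VI mu : multipliers R k mu ->
    \sum_(i < k) (mu i ord0 - lam i ord0) * G i (zs lam) <= 0.
  by move=> mu0; exact: variational_inequality.
(* Raising a single coordinate of [lam] by one isolates the constraint [i] in the variational
   inequality. *)
have feas i : G i (zs lam) <= 0.
  have m1 : multipliers R k (lam + delta_mx i ord0).
    by move=> j; rewrite !mxE; apply: addr_ge0; [exact: l0|exact: ler0n].
  have := VI _ m1; rewrite (bigD1 i) //= big1 ?addr0; last first.
    by move=> j ji; rewrite !mxE (negbTE ji) /= addr0 subrr mul0r.
  by rewrite !mxE !eqxx /= addrAC subrr add0r mul1r.
split; first by move=> i; have := feas i; rewrite /G subr_le0.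
move=> z fz; have m0 : multipliers R k 0 by move=> i; rewrite mxE.
(* The comparison with the zero multiplier; together with feasibility it is complementary
   slackness. *)
have slack : 0 <= \sum_(i < k) lam i ord0 * G i (zs lam).
  have := VI _ m0; rewrite -oppr_ge0 -sumrN; congr (_ <= _).
  by apply: eq_bigr => i _; rewrite mxE; ring.
have := ell_dual z l0; rewrite -(ell_zs l0) /ell.
have := lagrangian_ge0 l0 (fun i => q_ge0 i z (zs lam)).
have : \sum_(i < k) lam i ord0 * G i z <= 0.
  rewrite -oppr_ge0 -sumrN; apply: sumr_ge0 => i _; rewrite -mulrN.
  by apply: mulr_ge0; [exact: l0|rewrite oppr_ge0 /G subr_le0].
lra.
Qed.

End LagrangianDuality.

(** * Costs of admissible pairs *)

Lemma L1mxZ (R : realType) (p q : nat) (a b k : R) (F : R -> 'M[R]_(p, q)) :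
  L1mx a b F -> L1mx a b (fun s => k *: F s).
Proof.
move=> HF i j.
by apply: integrable_on_eq (integrable_onZ k (HF i j)) => s _; rewrite mxE.
Qed.

Lemma L1mx_sum (R : realType) (p q : nat) (a b : R) (I : Type) (r : seq I)
    (F : I -> R -> 'M[R]_(p, q)) :
  (forall i, L1mx a b (F i)) -> L1mx a b (fun s => \sum_(i <- r) F i s).
Proof.
move=> HF i j.
apply: (@integrable_on_eq _ _ _ _ (fun s => \sum_(l <- r) F l s i j)).
  by move=> s _; rewrite summxE.
by apply: integrable_on_sum => l _; exact: HF.
Qed.

Lemma LoomxD (R : realType) (p q : nat) (a b : R) (F G : R -> 'M[R]_(p, q)) :
  Loomx a b F -> Loomx a b G -> Loomx a b (fun s => F s + G s).
Proof.
move=> HF HG i j; have [mF [M HM]] := HF i j; have [mG [N HN]] := HG i j; split.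
  by apply: measurable_fun_ext (measurable_funD mF mG) => s; rewrite mxE.
exists (M + N); apply: ae_imply2 HM HN => s Ms Ns sab; rewrite mxE.
by apply: le_trans (ler_normD _ _) _; apply: lerD; [exact: Ms|exact: Ns].
Qed.

Lemma LoomxZ (R : realType) (p q : nat) (a b k : R) (F : R -> 'M[R]_(p, q)) :
  Loomx a b F -> Loomx a b (fun s => k *: F s).
Proof.
move=> HF i j; have [mF [M HM]] := HF i j; split.
  apply: (@measurable_fun_ext _ _ _ (fun s => k * F s i j)).
    by move=> s; rewrite mxE.
  by apply: measurable_funM => //; exact: measurable_cst.
exists (`|k| * M); apply: ae_imply HM => s Ms sab; rewrite mxE normrM.
by apply: ler_wpM2l => //; exact: Ms.
Qed.

Lemma Loomx_sum (R : realType) (p q : nat) (a b : R) (I : Type) (r : seq I)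
    (F : I -> R -> 'M[R]_(p, q)) :
  (forall i, Loomx a b (F i)) -> Loomx a b (fun s => \sum_(i <- r) F i s).
Proof.
move=> HF; elim: r => [|l r IH] i j.
  split.
    apply: (@measurable_fun_ext _ _ _ (cst 0)); last exact: measurable_cst.
    by move=> s; rewrite big_nil mxE.
  by exists 0; apply: aeW => s _; rewrite big_nil mxE normr0.
have [m [M HM]] := LoomxD (HF l) IH i j; split.
  by apply: measurable_fun_ext m => s; rewrite big_cons.
by exists M; apply: ae_imply HM => s; rewrite big_cons.
Qed.

Lemma psdmxD (R : realType) (p : nat) (M N : 'M[R]_p) :
  psdmx M -> psdmx N -> psdmx (M + N).
Proof.
move=> [sM hM] [sN hN]; split; first by rewrite linearD /= sM sN.
by move=> v; rewrite mulmxDl innerDl addr_ge0.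
Qed.

Lemma psdmxZ (R : realType) (p : nat) (k : R) (M : 'M[R]_p) :
  0 <= k -> psdmx M -> psdmx (k *: M).
Proof.
move=> k0 [sM hM]; split; first by rewrite linearZ /= sM.
by move=> v; rewrite -scalemxAl innerZl mulr_ge0.
Qed.

Lemma psdmx_sum (R : realType) (p : nat) (I : Type) (r : seq I) (M : I -> 'M[R]_p) :
  (forall i, psdmx (M i)) -> psdmx (\sum_(i <- r) M i).
Proof.
move=> H; elim: r => [|i r IH].
  rewrite big_nil; split; first by rewrite trmx0.
  by move=> v; rewrite mul0mx inner0l.
by rewrite big_cons; exact: psdmxD.
Qed.

Lemma weighted_L1mx (R : realType) (k p : nat) (a b : R)
    (M : 'I_k.+1 -> R -> 'M[R]_p) lam :
  (forall i, L1mx a b (M i)) -> L1mx a b (weighted M lam).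
Proof.
by move=> H; apply: L1mxD => //; apply: L1mx_sum => i; exact: L1mxZ.
Qed.

Lemma weighted_Loomx (R : realType) (k p : nat) (a b : R)
    (M : 'I_k.+1 -> R -> 'M[R]_p) lam :
  (forall i, Loomx a b (M i)) -> Loomx a b (weighted M lam).
Proof.
by move=> H; apply: LoomxD => //; apply: Loomx_sum => i; exact: LoomxZ.
Qed.

Lemma weighted_psdmx (R : realType) (k p : nat) (N : 'M[R]_p)
    (M : 'I_k.+1 -> R -> 'M[R]_p) lam s : multipliers R k lam ->
  psdmx (M ord0 s + N) -> (forall i, psdmx (M i s)) -> psdmx (weighted M lam s + N).
Proof.
move=> l0 h0 h; rewrite /weighted addrAC; apply: psdmxD => //.
by apply: psdmx_sum => i; apply: psdmxZ.
Qed.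

Lemma inner_weighted (R : realType) (k p : nat) (M : 'I_k.+1 -> R -> 'M[R]_p) lam s
    (v w : 'cV[R]_p) :
  inner_cv (weighted M lam s *m v) w =
  lagrangian (fun i => inner_cv (M i s *m v) w) lam.
Proof.
rewrite /weighted mulmxDl innerDl; congr (_ + _).
rewrite mulmx_suml.
elim/big_rec2: _ => [|i a b _ IH]; first by rewrite inner0l.
by rewrite innerDl IH -scalemxAl innerZl.
Qed.

(** With [d = v - w] the difference is [2 <M w, d> + <M d, d>]. Nonnegativity of the form at
    [K w + d] and at [K w - d] bounds the cross term by [K <M w, w> + <M d, d> / K]. *)
Lemma psdmx_form_lip (R : realType) (p : nat) (M : 'M[R]_p) (v w : 'cV[R]_p) (K : R) :
  psdmx M -> 0 < K ->
  `|inner_cv (M *m v) v - inner_cv (M *m w) w| <=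
  K * inner_cv (M *m w) w + (1 + K^-1) * inner_cv (M *m (v - w)) (v - w).
Proof.
move=> [sM pM] K0.
have [d ->] : exists d, v = w + d by exists (v - w); rewrite addrC subrK.
rewrite (addrAC w d) subrr add0r.
have hdw : inner_cv (M *m d) w = inner_cv (M *m w) d by rewrite inner_mulmx sM innerC.
have h1 := pM (K *: w + d); have h2 := pM (K *: w - d).
move: h1 h2; rewrite !mulmxDr !mulmxN -!scalemxAr !(innerDl, innerDr).
rewrite !(innerNl, innerNr, innerZl, innerZr) hdw.
have := pM d; have := pM w.
set a := inner_cv (M *m w) w; set b := inner_cv (M *m w) d.
set e := inner_cv (M *m d) d => a0 e0 h1 h2.
have Ki : 0 < K^-1 by rewrite invr_gt0.
have KK : K * K^-1 = 1 by rewrite mulfV // gt_eqF.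
have g1 : 0 <= K * a + 2 * b + K^-1 * e.
  rewrite -(pmulr_rge0 _ K0).
  have -> : K * (K * a + 2 * b + K^-1 * e) = K * (K * a) + 2 * (K * b) + (K * K^-1) * e.
    by ring.
  by rewrite KK mul1r; lra.
have g2 : 0 <= K * a - 2 * b + K^-1 * e.
  rewrite -(pmulr_rge0 _ K0).
  have -> : K * (K * a - 2 * b + K^-1 * e) = K * (K * a) - 2 * (K * b) + (K * K^-1) * e.
    by ring.
  by rewrite KK mul1r; lra.
by rewrite ler_norml; apply/andP; split; lra.
Qed.

Lemma Rint_norm_sub_le (R : realType) (a b : R) (f1 f2 h : R -> R) :
  integrable_on a b f1 -> integrable_on a b f2 -> integrable_on a b h ->
  (\forall s \ae (@lebesgue_measure R), s \in `[a, b] -> `|f1 s - f2 s| <= h s) ->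
  `|\int[@lebesgue_measure R]_(s in `[a, b]) f1 s -
    \int[@lebesgue_measure R]_(s in `[a, b]) f2 s| <=
  \int[@lebesgue_measure R]_(s in `[a, b]) h s.
Proof.
move=> i1 i2 ih hle.
have h1 : \int[@lebesgue_measure R]_(s in `[a, b]) f1 s <=
    \int[@lebesgue_measure R]_(s in `[a, b]) f2 s +
    \int[@lebesgue_measure R]_(s in `[a, b]) h s.
  rewrite -RintD //; apply: Rint_ae_le => //; first exact: integrable_onD.
  by apply: ae_imply hle => s hs sab; have := hs sab; rewrite ler_norml => /andP[]; lra.
have h2 : \int[@lebesgue_measure R]_(s in `[a, b]) f2 s <=
    \int[@lebesgue_measure R]_(s in `[a, b]) f1 s +
    \int[@lebesgue_measure R]_(s in `[a, b]) h s.
  rewrite -RintD //; apply: Rint_ae_le => //; first exact: integrable_onD.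
  by apply: ae_imply hle => s hs sab; have := hs sab; rewrite ler_norml => /andP[]; lra.
by rewrite ler_norml; apply/andP; split; lra.
Qed.

Section Costs.
Variables (R : realType) (n m : nat) (t T : R).

(** The polarization of [cost]; on the diagonal the two are convertible, which the final argument
    exploits. *)
Definition pairing (Q : R -> 'M[R]_n) (Rc : R -> 'M[R]_m)
    (X : R -> 'cV[R]_n) (u : R -> 'cV[R]_m) (Y : R -> 'cV[R]_n) (v : R -> 'cV[R]_m) : R :=
  \int[@lebesgue_measure R]_(s in `[t, T])
    (inner_cv (Q s *m X s) (Y s) + inner_cv (Rc s *m u s) (v s)).

(** Forgets the dynamics and the endpoints, so that it is stable under differences and still makes
    all the quadratic integrands integrable. *)
Definition admissible (X : R -> 'cV[R]_n) (u : R -> 'cV[R]_m) :=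
  Loomx t T X /\ L2mx t T u.

Lemma admissibleB X u Y v : admissible X u -> admissible Y v ->
  admissible (fun s => X s - Y s) (fun s => u s - v s).
Proof.
move=> [LX Lu] [LY Lv]; split; last exact: L2mxD Lu (L2mxN Lv).
have := LoomxD LX (LoomxZ (-1) LY).
by under eq_fun do rewrite scaleN1r.
Qed.

Section OneCost.
Variables (Q : R -> 'M[R]_n) (Rc : R -> 'M[R]_m).
Hypotheses (hQ : L1mx t T Q) (hR : Loomx t T Rc)
  (pQ : \forall s \ae (@lebesgue_measure R), s \in `[t, T] -> psdmx (Q s))
  (pR : \forall s \ae (@lebesgue_measure R), s \in `[t, T] -> psdmx (Rc s)).

Lemma pairing_integrable X u Y v : admissible X u -> admissible Y v ->
  integrable_on t T
    (fun s => inner_cv (Q s *m X s) (Y s) + inner_cv (Rc s *m u s) (v s)).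
Proof.
move=> [LX Lu] [LY Lv]; apply: integrable_onD.
  by apply: L1_inner LY; exact: L1mx_Loomx_mul.
by apply: L2_inner Lv; exact: Loomx_L2mx_mul.
Qed.

Lemma cost_ge0 X u : admissible X u -> 0 <= cost Q Rc t T X u.
Proof.
move=> Hu; apply: Rint_ae_ge0.
  exact: integrable_on_measurable (pairing_integrable Hu Hu).
apply: ae_imply2 pQ pR => s qs rs sT.
by have [_ q0] := qs sT; have [_ r0] := rs sT; rewrite addr_ge0.
Qed.

Lemma cost_diag X u : cost Q Rc t T (fun s => X s - X s) (fun s => u s - u s) = 0.
Proof.
rewrite /cost; under eq_Rintegral do rewrite !subrr !mulmx0 !inner0l addr0.
by rewrite Rintegral_cst ?mul0r //; exact: measurable_itv.
Qed.

Lemma cost_subC X u Y v :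
  cost Q Rc t T (fun s => X s - Y s) (fun s => u s - v s) =
  cost Q Rc t T (fun s => Y s - X s) (fun s => v s - u s).
Proof.
rewrite /cost; apply: eq_Rintegral => s _.
rewrite -(opprB (Y s)) -(opprB (v s)) !mulmxN.
by rewrite !(innerNl (_ *m _)) !innerNr !opprK.
Qed.

Lemma cost_lip X u Y v K : 0 < K -> admissible X u -> admissible Y v ->
  `|cost Q Rc t T X u - cost Q Rc t T Y v| <=
  K * cost Q Rc t T Y v +
  (1 + K^-1) * cost Q Rc t T (fun s => X s - Y s) (fun s => u s - v s).
Proof.
move=> K0 HX HY; have HD := admissibleB HX HY.
have iX := pairing_integrable HX HX; have iY := pairing_integrable HY HY.
have iD := pairing_integrable HD HD.
rewrite /cost -(RintZ K iY) -(RintZ (1 + K^-1) iD) -RintD; last 2 first.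
- exact: integrable_onZ.
- exact: integrable_onZ.
apply: Rint_norm_sub_le => //.
  by apply: integrable_onD; exact: integrable_onZ.
apply: ae_imply2 pQ pR => s qs rs sT.
have h1 := psdmx_form_lip (X s) (Y s) (qs sT) K0.
have h2 := psdmx_form_lip (u s) (v s) (rs sT) K0.
have h := le_trans (ler_normD _ _) (lerD h1 h2).
by rewrite opprD addrACA; apply: le_trans h _; rewrite !mulrDr; lra.
Qed.

(** Expansion of a square; the two cross terms agree because the weights are symmetric almost
    everywhere. *)
Lemma cost_sub X u Y v : admissible X u -> admissible Y v ->
  cost Q Rc t T (fun s => X s - Y s) (fun s => u s - v s) =
  cost Q Rc t T X u - 2 * pairing Q Rc Y v X u + cost Q Rc t T Y v.
Proof.
move=> HX HY; have HD := admissibleB HX HY.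
have iX := pairing_integrable HX HX; have iY := pairing_integrable HY HY.
have iD := pairing_integrable HD HD; have iYX := pairing_integrable HY HX.
rewrite /cost /pairing -mulNr -(RintZ (-2) iYX) -RintD //; last exact: integrable_onZ.
rewrite -RintD //; last by apply: integrable_onD => //; exact: integrable_onZ.
apply: Rint_ae_eq.
- exact: integrable_on_measurable iD.
- apply: integrable_on_measurable; apply: integrable_onD => //.
  by apply: integrable_onD => //; exact: integrable_onZ.
apply: ae_imply2 pQ pR => s qs rs sT.
have [sQ _] := qs sT; have [sR _] := rs sT.
rewrite !mulmxDr !mulmxN !(innerDl, innerDr) !(innerNl, innerNr).
have -> : inner_cv (Q s *m X s) (Y s) = inner_cv (Q s *m Y s) (X s).
  by rewrite inner_mulmx sQ innerC.
have -> : inner_cv (Rc s *m u s) (v s) = inner_cv (Rc s *m v s) (u s).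
  by rewrite inner_mulmx sR innerC.
by ring.
Qed.

End OneCost.

Definition energy (u : R -> 'cV[R]_m) : R :=
  \int[@lebesgue_measure R]_(s in `[t, T]) inner_cv (u s) (u s).

Lemma energy_integrable (u : R -> 'cV[R]_m) : L2mx t T u ->
  integrable_on t T (fun s => inner_cv (u s) (u s)).
Proof. by move=> Lu; exact: L2_inner. Qed.

Lemma energy_ge0 u : 0 <= energy u.
Proof. by apply: Rintegral_ge0 => s _; exact: inner_ge0. Qed.

(** One half of the equivalence between cost and control energy for differences: coercivity of the
    control weight. *)
Lemma energy_le_cost (Q : R -> 'M[R]_n) (Rc : R -> 'M[R]_m) (delta : R) X u :
  0 < delta -> L1mx t T Q -> Loomx t T Rc ->
  (\forall s \ae (@lebesgue_measure R), s \in `[t, T] -> psdmx (Q s)) ->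
  (\forall s \ae (@lebesgue_measure R), s \in `[t, T] -> psdmx (Rc s - delta%:M)) ->
  admissible X u -> delta * energy u <= cost Q Rc t T X u.
Proof.
move=> d0 hQ hR pQ pR HX; have iu := energy_integrable (proj2 HX).
rewrite /energy -(RintZ delta iu); apply: Rint_ae_le.
- exact: integrable_onZ.
- exact: pairing_integrable.
apply: ae_imply2 pQ pR => s qs rs sT.
have [_ q0] := qs sT; have [_ co] := psdmx_coercive (rs sT).
by have := q0 (X s); have := co (u s); lra.
Qed.

Variables (A : R -> 'M[R]_n) (B : R -> 'M[R]_(n, m)).
Hypotheses (hA : L1mx t T A) (hB : L2mx t T B).

(* Gronwall with [2 <B w, Z> <= |w|^2 + <B B^T Z, Z>]. *)
Lemma controlled_state_bound : exists2 C : R, 0 <= C & forall Z w, L2mx t T w ->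
  mx_ac_derive t T Z (fun s => A s *m Z s + B s *m w s) -> Z t = 0 ->
  forall s, t <= s <= T -> inner_cv (Z s) (Z s) <= C * energy w.
Proof.
pose alpha s := 2 * mxsum (A s) + mxsum (B s *m (B s)^T).
have ialpha : integrable_on t T alpha.
  apply: integrable_onD; first by apply: integrable_onZ; exact: integrable_on_mxsum.
  by apply: integrable_on_mxsum; apply: L2mx_mul hB _; exact: L2mxT.
have alpha0 s : 0 <= alpha s.
  by rewrite addr_ge0 ?mulr_ge0 ?mxsum_ge0.
exists (expR (\int[@lebesgue_measure R]_(s in `[t, T]) alpha s)); first exact: expR_ge0.
move=> Z w Lw HZ Zt s /andP[ts sT].
have iw := energy_integrable Lw.
have HE := ac_deriveS (lexx t) sT (ac_derive_inner HZ HZ).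
have := gronwall ts HE (fun r _ => inner_ge0 (Z r))
  (integrable_on_subitv (lexx t) sT ialpha) (integrable_on_subitv (lexx t) sT iw)
  alpha0 (fun r => inner_ge0 (w r)) _.
rewrite Zt inner0l add0r => H.
apply: le_trans (H _) _; last first.
  apply: ler_pM; rewrite ?expR_ge0 ?ler_expR //.
  - by apply: Rintegral_ge0 => r _; exact: inner_ge0.
  - exact: Rint_subitv.
  - by apply: Rint_subitv => // r; exact: inner_ge0.
apply: aeW => r _.
rewrite (innerC (Z r) (A r *m Z r + B r *m w r)) innerDl.
have h1 := inner_mul_le (A r) (Z r) (Z r).
have h2 := inner_mul_le (B r *m (B r)^T) (Z r) (Z r).
have h3 := inner_young (w r) ((B r)^T *m Z r) (@ltr01 R).
rewrite (inner_mulmx (B r) (w r)).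
rewrite invr1 in h3.
have h4 : inner_cv ((B r)^T *m Z r) ((B r)^T *m Z r) =
    inner_cv (B r *m (B r)^T *m Z r) (Z r).
  by rewrite -mulmxA [RHS]inner_mulmx.
rewrite h4 in h3.
have h5 := ler_norm (inner_cv (A r *m Z r) (Z r)).
have h6 := ler_norm (inner_cv (B r *m (B r)^T *m Z r) (Z r)).
rewrite /alpha; lra.
Qed.

(** The other half: from the zero initial state the control energy bounds the state uniformly in
    time, and the constant does not depend on the pair. *)
Lemma cost_le_energy (Q : R -> 'M[R]_n) (Rc : R -> 'M[R]_m) :
  L1mx t T Q -> Loomx t T Rc -> exists2 C : R, 0 <= C & forall Z w, L2mx t T w ->
  mx_ac_derive t T Z (fun s => A s *m Z s + B s *m w s) -> Z t = 0 ->
  cost Q Rc t T Z w <= C * energy w.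
Proof.
move=> hQ hR; have [C C0 HC] := controlled_state_bound.
have [N HN] : exists N : R, \forall s \ae (@lebesgue_measure R),
    s \in `[t, T] -> mxsum (Rc s) <= N.
  have /choice [M HM] (ij : 'I_m * 'I_m) : exists M, \forall s \ae (@lebesgue_measure R),
    s \in `[t, T] -> `|Rc s ij.1 ij.2| <= M by case: (hR ij.1 ij.2).
  exists (\sum_i \sum_j M (i, j)); apply: ae_imply (ae_forall_fin HM) => s Ms sT.
  by apply: ler_sum => i _; apply: ler_sum => j _; exact: (Ms (i, j) sT).
have iQ := integrable_on_mxsum hQ.
exists (\int[@lebesgue_measure R]_(s in `[t, T]) mxsum (Q s) * C + `|N|).
  rewrite addr_ge0 // mulr_ge0 //; apply: Rintegral_ge0 => s _; exact: mxsum_ge0.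
move=> Z w Lw HZ Zt; have iw := energy_integrable Lw.
have -> : (\int[@lebesgue_measure R]_(s in `[t, T]) mxsum (Q s) * C + `|N|) * energy w =
    (C * energy w) * \int[@lebesgue_measure R]_(s in `[t, T]) mxsum (Q s) + `|N| * energy w.
  by ring.
rewrite -(RintZ (C * energy w) iQ) -(RintZ `|N| iw) -RintD; last 2 first.
- exact: integrable_onZ.
- exact: integrable_onZ.
apply: Rint_ae_le.
- by apply: pairing_integrable => //; split=> //; exact: mx_ac_derive_Loomx HZ.
- by apply: integrable_onD; exact: integrable_onZ.
apply: ae_imply HN => s Ns sT.
have Zs : inner_cv (Z s) (Z s) <= C * energy w.
  by apply: HC => //; move: sT; rewrite in_itv.
have h1 := inner_mul_le (Q s) (Z s) (Z s).
have h2 := inner_mul_le (Rc s) (w s) (w s).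
have h3 := ler_norm (inner_cv (Q s *m Z s) (Z s)).
have h4 := ler_norm (inner_cv (Rc s *m w s) (w s)).
have h5 : mxsum (Q s) * inner_cv (Z s) (Z s) <= mxsum (Q s) * (C * energy w).
  by apply: ler_wpM2l => //; exact: mxsum_ge0.
have h6 : mxsum (Rc s) * inner_cv (w s) (w s) <= `|N| * inner_cv (w s) (w s).
  apply: ler_wpM2r; first exact: inner_ge0.
  exact: le_trans (Ns sT) (ler_norm _).
lra.
Qed.

End Costs.

Lemma pairing_weighted (R : realType) (k n m : nat) (t T : R)
    (Q : 'I_k.+1 -> R -> 'M[R]_n) (Rc : 'I_k.+1 -> R -> 'M[R]_m) lam X u Y v :
  (forall i, L1mx t T (Q i)) -> (forall i, Loomx t T (Rc i)) ->
  admissible t T X u -> admissible t T Y v ->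
  pairing t T (weighted Q lam) (weighted Rc lam) X u Y v =
  lagrangian (fun i => pairing t T (Q i) (Rc i) X u Y v) lam.
Proof.
move=> hQ hR HX HY.
have iI i := pairing_integrable (hQ i) (hR i) HX HY.
rewrite /lagrangian /pairing.
have -> : \sum_(i < k) lam i ord0 * \int[@lebesgue_measure R]_(s in `[t, T])
     (inner_cv (Q (lift ord0 i) s *m X s) (Y s) +
      inner_cv (Rc (lift ord0 i) s *m u s) (v s)) =
   \int[@lebesgue_measure R]_(s in `[t, T]) \sum_(i < k) lam i ord0 *
     (inner_cv (Q (lift ord0 i) s *m X s) (Y s) +
      inner_cv (Rc (lift ord0 i) s *m u s) (v s)).
  rewrite Rint_sum; last by move=> i; apply: integrable_onZ; exact: iI.
  by apply: eq_bigr => i _; rewrite RintZ //; exact: iI.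
rewrite -RintD //; last first.
  by apply: integrable_on_sum => i _; apply: integrable_onZ; exact: iI.
apply: eq_Rintegral => s _; rewrite !inner_weighted /lagrangian addrACA -big_split.
by congr (_ + _); apply: eq_bigr => i _; rewrite mulrDr.
Qed.

(** * The constrained problem: duality over the steering pairs *)

Theorem theorem3p4 (R : realType) (k n m : nat) (T : R) (hT : 0 < T)
    (A : R -> 'M[R]_n) (hA : L1mx 0 T A)
    (B : R -> 'M[R]_(n, m)) (hB : L2mx 0 T B)
    (Q : 'I_k.+1 -> R -> 'M[R]_n) (hQ : forall i, L1mx 0 T (Q i))
    (hQ0 : forall i, \forall s \ae (@lebesgue_measure R),
       s \in `[0, T] -> psdmx (Q i s))
    (Rc : 'I_k.+1 -> R -> 'M[R]_m) (hS : forall i, Loomx 0 T (Rc i))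
    (hS0 : forall i, \forall s \ae (@lebesgue_measure R),
       s \in `[0, T] -> psdmx (Rc i s))
    (hSdelta : exists2 delta : R, 0 < delta &
       \forall s \ae (@lebesgue_measure R),
         s \in `[0, T] -> psdmx (Rc ord0 s - delta%:M))
    (hAB : completely_controllable A B T)
    (c : 'cV[R]_k) (hc : forall i, 0 < c i ord0)
    (t : R) (ht0 : 0 <= t) (htT : t < T) (x y : 'cV[R]_n)
    (hfeas : exists u : R -> 'cV[R]_m, strictly_feasible A B Q Rc c t T x y u)
    (P Pi Phi Psi : 'cV[R]_k -> R -> 'M[R]_n)
    (hP : forall lam, multipliers R k lam ->
       is_P A B (weighted Q lam) (weighted Rc lam) T (P lam))
    (hPi : forall lam, multipliers R k lam ->
       is_Pi A B (weighted Q lam) (weighted Rc lam) t T (Pi lam))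
    (hPhi : forall lam, multipliers R k lam ->
       is_Phi A B (weighted Rc lam) T (P lam) (Phi lam))
    (hPsi : forall lam, multipliers R k lam ->
       is_Psi A (weighted Q lam) T (P lam) (Phi lam) (Psi lam)) :
  exists2 lam : 'cV[R]_k,
    multipliers R k lam /\
    (forall mu : 'cV[R]_k, multipliers R k mu ->
       dual_function P Pi Phi Psi c t T x y mu <=
       dual_function P Pi Phi Psi c t T x y lam) &
    exists2 X : R -> 'cV[R]_n,
      closed_loop_state A B (weighted Rc lam) t T (P lam)
        (eta_term (Phi lam) (Psi lam) T y) x X &
      CLQ_the_optimal A B Q Rc c t T x y
        (feedback B (weighted Rc lam) (P lam)
           (eta_term (Phi lam) (Psi lam) T y) X).

Proof.
have sub s : s \in `[t, T] -> s \in `[0, T] by exact: (subset_itv_cc ht0 (lexx T)).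
have hA' := L1mxS ht0 (lexx T) hA; have hB' := L2mxS ht0 (lexx T) hB.
have hQ' i := L1mxS ht0 (lexx T) (hQ i).
have hS' i := LoomxS ht0 (lexx T) (hS i).
have hQ0' i : \forall s \ae (@lebesgue_measure R), s \in `[t, T] -> psdmx (Q i s).
  by apply: ae_imply (hQ0 i) => s h /sub.
have hS0' i : \forall s \ae (@lebesgue_measure R), s \in `[t, T] -> psdmx (Rc i s).
  by apply: ae_imply (hS0 i) => s h /sub.
have [delta d0 hd] := hSdelta.
have hd' : \forall s \ae (@lebesgue_measure R),
    s \in `[t, T] -> psdmx (Rc ord0 s - delta%:M).
  by apply: ae_imply hd => s h /sub.
have wQ lam : multipliers R k lam -> \forall s \ae (@lebesgue_measure R),
    s \in `[0, T] -> psdmx (weighted Q lam s).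
  move=> l0; apply: ae_imply (ae_forall_fin hQ0) => s h sT.
  by rewrite -[weighted Q lam s]addr0; apply: weighted_psdmx => // [|i]; rewrite ?addr0; apply: h.
have wS lam : multipliers R k lam -> \forall s \ae (@lebesgue_measure R),
    s \in `[0, T] -> psdmx (weighted Rc lam s - delta%:M).
  move=> l0; apply: ae_imply2 hd (ae_forall_fin hS0) => s h h0 sT.
  by apply: weighted_psdmx => // [|i]; [exact: h|exact: h0].
(* Controls are bundled with their trajectories, so the abstract costs are functions of one point;
   the strictly feasible pair is the Slater point of this type. *)
pose Z := {z : (R -> 'cV[R]_m) * (R -> 'cV[R]_n) | steers A B t T x y z.1 z.2}.
have Zmacd (z : Z) : mx_ac_derive t T (sval z).2 (fun s => A s *m (sval z).2 s + B s *m (sval z).1 s).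
  by have [_ [ode _] _] := svalP z; exact: ode_ac_derive ode.
have Zadm (z : Z) : admissible t T (sval z).2 (sval z).1.
  split; first exact: mx_ac_derive_Loomx (Zmacd z).
  by have [] := svalP z.
pose J (i : 'I_k.+1) (z : Z) := cost (Q i) (Rc i) t T (sval z).2 (sval z).1.
pose q (i : 'I_k.+1) (z w : Z) := cost (Q i) (Rc i) t T
  (fun s => (sval z).2 s - (sval w).2 s) (fun s => (sval z).1 s - (sval w).1 s).
pose V lam := lq_value T t (P lam) (Pi lam) (Phi lam) (Psi lam) x y.
have [uhat [Xhat [st0 slater]]] := hfeas.
pose zhat : Z := exist _ (uhat, Xhat) st0.
pose eta lam := eta_term (Phi lam) (Psi lam) T y.
(* [zs] has to be total; outside the multipliers it takes the Slater point as a default. *)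
have /choice [zs Hzs] (lam : 'cV[R]_k) : exists z : Z, multipliers R k lam ->
  [/\ closed_loop_state A B (weighted Rc lam) t T (P lam) (eta lam) x (sval z).2,
    (sval z).1 = feedback B (weighted Rc lam) (P lam) (eta lam) (sval z).2 &
    forall z' : Z, pairing t T (weighted Q lam) (weighted Rc lam)
      (sval z).2 (sval z).1 (sval z').2 (sval z').1 = V lam].
  have [l0|nl] := pselect (multipliers R k lam); last by exists zhat.
  have [X [cl st pV]] := lq_optimality ht0 htT hA hB
    (weighted_L1mx lam hQ) (weighted_Loomx lam hS) d0 (wS lam l0)
    (hP lam l0) (hPi lam l0) (hPhi lam l0) (hPsi lam l0) x y.
  exists (exist _ (feedback B (weighted Rc lam) (P lam) (eta lam) X, X) st) => _.
  by split=> // -[[v Y] stv]; exact: pV.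
have difference (z w : Z) : mx_ac_derive t T (fun s => (sval z).2 s - (sval w).2 s)
    (fun s => A s *m ((sval z).2 s - (sval w).2 s) + B s *m ((sval z).1 s - (sval w).1 s))
    /\ (sval z).2 t - (sval w).2 t = 0.
  split; last first.
    by have [_ [_ ->] _] := svalP z; have [_ [_ ->] _] := svalP w; rewrite subrr.
  apply: mx_ac_derive_congr (mx_ac_deriveB (Zmacd z) (Zmacd w)) => //.
  by apply: aeW => s _; mx_expand; mx_ring.
have q_adm (z w : Z) := admissibleB (Zadm z) (Zadm w).
have q0_energy (z w : Z) : delta * energy t T (fun s => (sval z).1 s - (sval w).1 s) <= q ord0 z w.
  exact: energy_le_cost d0 (hQ' ord0) (hS' ord0) (hQ0' ord0) hd' (q_adm z w).
have /choice [Ci HCi] (i : 'I_k.+1) : exists Ci, 0 <= Ci /\ forall z w,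
    q i z w <= Ci * energy t T (fun s => (sval z).1 s - (sval w).1 s).
  have [Ci C0 H] := cost_le_energy hA' hB' (hQ' i) (hS' i).
  exists Ci; split=> // z w; have [h1 h2] := difference z w.
  by apply: H => //; case: (q_adm z w).
(* Each [q i] is at most [Ci i] times the energy, and the energy is at most [q ord0 / delta]; the
   sum provides one constant for all indices. *)
pose C := (\sum_i Ci i) / delta.
have C0 : 0 <= C.
  by apply: divr_ge0 (ltW d0); apply: sumr_ge0 => i _; case: (HCi i).
have q_le i z w : q i z w <= C * q ord0 z w.
  have [Ci0 H] := HCi i; apply: le_trans (H z w) _.
  have h1 : Ci i <= \sum_i Ci i.
    by rewrite (bigD1 i) //= lerDl; apply: sumr_ge0 => j _; case: (HCi j).
  have e0 := energy_ge0 t T (fun s => (sval z).1 s - (sval w).1 s).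
  apply: le_trans (ler_wpM2r e0 h1) _.
  rewrite /C -mulrA; apply: ler_wpM2l; first exact: le_trans Ci0 h1.
  by rewrite -(ler_pM2l d0) mulrA mulfV ?gt_eqF // mul1r.
have J_ge0 i z : 0 <= J i z.
  by have := cost_ge0 (hQ' i) (hS' i) (hQ0' i) (hS0' i) (Zadm z).
have q_ge0 i z w : 0 <= q i z w.
  by have := cost_ge0 (hQ' i) (hS' i) (hQ0' i) (hS0' i) (q_adm z w).
(* In the expanded square both the cross pairing and the cost of the extremal equal [V lam], so the
   weighted cost of the difference is the weighted cost of [z] minus [V lam]. *)
have V_opt lam : multipliers R k lam -> forall z,
    lagrangian (fun i => J i z) lam = V lam + lagrangian (fun i => q i z (zs lam)) lam.
  move=> l0 z; have [_ _ pV] := Hzs lam l0.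
  rewrite -(pairing_weighted lam hQ' hS' (Zadm z) (Zadm z)).
  rewrite -(pairing_weighted lam hQ' hS' (q_adm z (zs lam)) (q_adm z (zs lam))).
  have := cost_sub (weighted_L1mx lam hQ') (weighted_Loomx lam hS')
    (Q := weighted Q lam) (Rc := weighted Rc lam).
  have wQ' : \forall s \ae (@lebesgue_measure R), s \in `[t, T] -> psdmx (weighted Q lam s).
    by apply: ae_imply (wQ lam l0) => s h /sub.
  have wS' : \forall s \ae (@lebesgue_measure R), s \in `[t, T] -> psdmx (weighted Rc lam s).
    apply: ae_imply (ae_forall_fin hS0') => s h sT.
    by rewrite -[weighted Rc lam s]addr0; apply: weighted_psdmx => // [|i];
      rewrite ?addr0; apply: h.
  move=> /(_ wQ' wS' _ _ _ _ (Zadm z) (Zadm (zs lam))).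
  rewrite pV -[cost _ _ _ _ (sval (zs lam)).2 _]/(pairing _ _ _ _ _ _ _ _) pV.
  rewrite /cost /pairing => ->; ring.
have [lam [l0 lmax] [feas weak]] := @strong_duality R k Z J q C J_ge0 q_ge0
  (fun i z => cost_diag _ _ _ _ _ _) (fun i z w => cost_subC _ _ _ _ _ _ _ _) C0 q_le
  (fun i z w K K0 => cost_lip (hQ' i) (hS' i) (hQ0' i) (hS0' i) K0 (Zadm z) (Zadm w))
  V zs V_opt c zhat slater.
have [cl uE _] := Hzs lam l0.
exists lam; first by split.
exists (sval (zs lam)).2 => //; rewrite -uE.
have feasible_zs : feasible_pair A B Q Rc c t T x y (sval (zs lam)).1 (sval (zs lam)).2.
  by split=> //; exact: (svalP (zs lam)).
split.
  exists (sval (zs lam)).2; split=> // v Y [st fv].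
  have := weak (exist _ (v, Y) st : Z) fv; apply: le_trans.
  by rewrite lerDl.
move=> v [Y [[st fv] vopt]].
pose z : Z := exist _ (v, Y) st.
have := weak z fv; have := vopt _ _ feasible_zs; rewrite -/(J ord0 z) -/(J ord0 (zs lam)).
(* Optimality of [v] and the surplus inequality leave no room for [q ord0]. The energy of the
   difference of the controls is then zero, and the controls agree almost everywhere. *)
move=> h1 h2; have qz : q ord0 z (zs lam) <= 0 by lra.
have e0 : energy t T (fun s => v s - (sval (zs lam)).1 s) <= 0.
  by rewrite -(pmulr_rle0 _ d0); apply: le_trans (q0_energy z (zs lam)) qz.
have ie := energy_integrable (proj2 (q_adm z (zs lam))).
have := Rint_eq0_ae ie (fun s => inner_ge0 _) e0.
apply: ae_imply => s h sT; apply/eqP; rewrite -subr_eq0; apply/eqP.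
by apply: inner_eq0; rewrite h.
Qed.
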